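(* Let $\mathcal{D}$ be a collection of domains in $\mathbb{C}^n$ and let $\mathcal{M}$ be an assignment of an admissible weight function $\mu_\Omega:=\mathcal{M}(\Omega)$ to each $\Omega\in\mathcal{D}$, such that for every $\Omega\in\mathcal{D}$ the weighted Bergman metric $g_{\Omega,\mu_\Omega}$ is positive definite. If $\mathcal{M}$ is invariant, then the $\mathcal{M}$-weighted Bergman metric is invariant under biholomorphisms: for every $\Omega\in\mathcal{D}$ and every biholomorphism $F:\Omega\to F(\Omega)$ with $F(\Omega)\in\mathcal{D}$, $$g_{\Omega,\mu_\Omega}=F^*g_{F(\Omega),\mu_{F(\Omega)}}.$$
   Context: Let $d\lambda$ be Lebesgue measure on $\mathbb{C}^n$. For a domain $\Omega\subset\mathbb{C}^n$ and a measurable weight $\mu:\Omega\to(0,\infty)$, $L^2(\Omega,\mu)$ is the space of measurable functions with $\|u\|^2_{\Omega,\mu}=\int_\Omega|u|^2\mu\,d\lambda<\infty$, and $\mathcal{A}^2(\Omega,\mu)=\mathcal{O}(\Omega)\cap L^2(\Omega,\mu)$, where $\mathcal{O}(\Omega)$ is the set of holomorphic functions on $\Omega$. The weight $\mu$ is admissible if $\mathcal{A}^2(\Omega,\mu)$ is closed in $L^2(\Omega,\mu)$ and every point evaluation $u\mapsto u(p)$, $p\in\Omega$, is continuous on $\mathcal{A}^2(\Omega,\mu)$. For admissible $\mu$, $K_{\Omega,\mu}(z,w)$ denotes the reproducing kernel of $\mathcal{A}^2(\Omega,\mu)$, i.e. $u(z)=\int_\Omega K_{\Omega,\mu}(z,w)u(w)\mu(w)\,d\lambda(w)$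 for all $u\in\mathcal{A}^2(\Omega,\mu)$. The weighted Bergman metric is $$g_{\Omega,\mu}=\sum_{j,k=1}^n\frac{\partial^2\log K_{\Omega,\mu}(z,z)}{\partial z_j\partial\overline{z_k}}\,dz_j\otimes d\overline{z_k}$$ (defined where $K_{\Omega,\mu}(z,z)>0$; saying it is positive definite includes that it is defined on all of $\Omega$). When it is positive definite for all $\Omega\in\mathcal{D}$, $g_{\Omega,\mu_\Omega}$ is called the $\mathcal{M}$-weighted Bergman metric of $\Omega$. The assignment $\mathcal{M}$ is invariant (under biholomorphisms) if for every $\Omega\in\mathcal{D}$ and every biholomorphism $F:\Omega\to F(\Omega)$ with $F(\Omega)\in\mathcal{D}$ there is a non-vanishing holomorphic function $h_F$ on $\Omega$ (depending on $F$) with $\mu_{F(\Omega)}\circ F=|h_F|^2\mu_\Omega$. *)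

(* Defs.v *)
From HB Require Import structures.
From mathcomp Require Import all_boot all_order all_algebra.
From mathcomp Require Import complex.
From mathcomp Require Import all_classical all_reals all_analysis.

Set Implicit Arguments.
Unset Strict Implicit.
Unset Printing Implicit Defensive.

Import Order.TTheory GRing.Theory Num.Def Num.Theory.
Import numFieldNormedType.Exports.

Local Open Scope classical_set_scope.
Local Open Scope ring_scope.
Local Open Scope complex_scope.

(** [R[i]] carries the topology and norm of its numeric field structure, so
    [differentiable] on ['rV[R[i]]_n] is complex differentiability. *)
HB.instance Definition _ (R : rcfType) := NormedModule.copy R[i] R[i]^o.

(** The complex dimension is [n.+1] throughout, so that it is positive. *)

Section LebesgueMeasure.
Context (R : realType) (n : nat).
Local Notation Cn := 'rV[R[i]]_n.+1.

Definition box (ab : Cn * Cn) : set Cn := [set z | forall i,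
  (complex.Re (ab.1 0 i) < complex.Re (z 0 i) <= complex.Re (ab.2 0 i)) &&
  (complex.Im (ab.1 0 i) < complex.Im (z 0 i) <= complex.Im (ab.2 0 i))].

Definition box_volume (ab : Cn * Cn) : R := \prod_(i < n.+1)
  (maxr 0 (complex.Re (ab.2 0 i) - complex.Re (ab.1 0 i)) *
   maxr 0 (complex.Im (ab.2 0 i) - complex.Im (ab.1 0 i))).

Definition lebesgue_outer (A : set Cn) : \bar R := ereal_inf
  [set (\sum_(k <oo) (box_volume (B k))%:E)%E
     | B in [set B : (Cn * Cn)^nat | A `<=` \bigcup_k box (B k)]].

Lemma box_volume_ge0 ab : 0 <= box_volume ab.
Proof. by apply: prodr_ge0 => i _; rewrite mulr_ge0 // le_max lexx. Qed.

Lemma lebesgue_outer_ge0 A : (0 <= lebesgue_outer A)%E.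
Proof.
apply: le_ereal_inf_tmp => x [B AB <-{x}]; apply: nneseries_ge0 => k _ _.
by rewrite lee_fin box_volume_ge0.
Qed.

Lemma lebesgue_outer_le A B : (A `<=` \bigcup_k box (B k)) ->
  (lebesgue_outer A <= \sum_(k <oo) (box_volume (B k))%:E)%E.
Proof. by move=> AB; apply: ereal_inf_lbound; exists B. Qed.

Lemma lebesgue_outer0 : lebesgue_outer set0 = 0%E.
Proof.
apply/eqP; rewrite eq_le lebesgue_outer_ge0 andbT.
apply: le_trans (lebesgue_outer_le (B := fun=> (0, 0)) _) _ => //.
rewrite eseries0// => k _ _.
by rewrite /box_volume big_ord_recl /= subrr maxxx !mul0r.
Qed.

Lemma le_lebesgue_outer : {homo lebesgue_outer : A B / A `<=` B >-> (A <= B)%E}.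
Proof.
move=> A B AB; apply/ereal_inf_le_tmp => x [F BF <-{x}].
by exists F => //; apply: subset_trans AB BF.
Qed.

Lemma lebesgue_outer_sigma_subadditive : sigma_subadditive lebesgue_outer.
Proof.
move=> A; have [[i ioo]|] := pselect (exists i, lebesgue_outer (A i) = +oo%E).
  rewrite (eseries_pinfty _ _ ioo) ?leey// => k _.
  by rewrite -ltNye (lt_le_trans _ (lebesgue_outer_ge0 _)).
rewrite -forallNE => Aoo.
apply/lee_addgt0Pr => e e0.
apply: le_trans (epsilon_trick _ _ (ltW e0)) => //; last first.
  by move=> k; exact: lebesgue_outer_ge0.
pose P k (B : (Cn * Cn)^nat) := A k `<=` \bigcup_j box (B j) /\
  (\sum_(j <oo) (box_volume (B j))%:E <=
     lebesgue_outer (A k) + (e / (2 ^ k.+1)%:R)%:E)%E.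
have [G PG] : {G : ((Cn * Cn)^nat)^nat & forall k, P k (G k)}.
  apply: (@choice _ _ P) => k.
  have ek : 0 < e / (2 ^ k.+1)%:R :> R by rewrite divr_gt0 // ltr0n expn_gt0.
  have Afin : lebesgue_outer (A k) \is a fin_num.
    by rewrite ge0_fin_numE ?lebesgue_outer_ge0// ltey; apply/eqP/Aoo.
  have [_ [B AB <-] Ble] := lb_ereal_inf_adherent ek Afin.
  by exists B; split => //; exact/ltW.
pose h := fun x : nat * nat => (box_volume (G x.1 x.2))%:E.
have h0 x : (0 <= h x)%E by rewrite lee_fin box_volume_ge0.
have /card_esym/ppcard_eqP[f] := card_nat2.
apply: le_trans (lebesgue_outer_le (B := fun k => G (f k).1 (f k).2) _) _.
  move=> z [i _ /(PG i).1[j _ Gz]]; exists (f^-1%FUN (i, j)) => //=.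
  by rewrite invK ?inE.
apply: (@le_trans _ _ (\sum_(i <oo) \sum_(j <oo) h (i, j))%E); last first.
  apply: lee_nneseries => [k _ _|k _]; last exact: (PG k).2.
  by apply: nneseries_ge0 => j _ _; exact: h0.
rewrite nneseries_esumT; last by move=> k; exact: (h0 (f k)).
rewrite nneseries_esumT; last by move=> k; apply: nneseries_ge0 => j _ _.
rewrite -(@reindex_esum _ _ _ setT setT f h) //.
under [X in (_ <= X)%E]eq_esum do rewrite nneseries_esumT//.
rewrite (@esum_esum _ _ _ setT (fun=> setT) (fun i j => h (i, j)))//.
rewrite (_ : setT `*`` (fun=> setT) = setT).
  by apply: le_esum => -[].
by apply/seteqP; split => // x _; split.
Qed.

HB.instance Definition _ := isOuterMeasure.Build R Cn lebesgue_outer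
  lebesgue_outer0 lebesgue_outer_ge0 le_lebesgue_outer
  lebesgue_outer_sigma_subadditive.

Definition lebesgue_outer_measure : {outer_measure set Cn -> \bar R} :=
  lebesgue_outer.

(** Complex space with the sigma-algebra of Lebesgue measurable sets, i.e. of the sets
    satisfying the Caratheodory criterion for the outer measure. *)
Definition CnL := caratheodory_type lebesgue_outer_measure.
HB.instance Definition _ := Measurable.on CnL.

Definition lebesgue : {measure set CnL -> \bar R} :=
  (lebesgue_outer_measure : set CnL -> \bar R).

End LebesgueMeasure.

Arguments lebesgue {R n}.

Definition domain {T : topologicalType} (Omega : set T) : Prop :=
  [/\ open Omega, connected Omega & Omega !=set0].

Section Bergman.
Context (R : realType) (n : nat).
Local Notation C := R[i].
Local Notation Cn := 'rV[C]_n.+1.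
Implicit Types (Omega : set Cn) (mu : Cn -> R).

Definition holomorphic (W : normedModType C) Omega (f : Cn -> W) : Prop :=
  forall z, Omega z -> differentiable f z.

Definition biholomorphism Omega (F : Cn -> Cn) : Prop :=
  holomorphic Omega F /\
  exists G : Cn -> Cn, holomorphic (F @` Omega) G /\
    forall z, Omega z -> G (F z) = z.

Definition lebesgue_measurable Omega (f : Cn -> R) : Prop :=
  measurable_fun (Omega : set (CnL R n)) (f : CnL R n -> R).

(** Functions on [Omega] are represented by total functions; none of the notions
    below depends on their values outside [Omega]. *)
Definition weight Omega mu : Prop :=
  lebesgue_measurable Omega mu /\ forall z, Omega z -> 0 < mu z.

Definition sqnorm Omega mu (u : Cn -> C) : \bar R :=
  (\int[lebesgue]_(z in Omega) (Normc.normc (u z) ^+ 2 * mu z)%:E)%E.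

Definition L2norm Omega mu (u : Cn -> C) : R :=
  Num.sqrt (fine (sqnorm Omega mu u)).

Definition L2 Omega mu (u : Cn -> C) : Prop :=
  [/\ lebesgue_measurable Omega (fun z => complex.Re (u z)),
      lebesgue_measurable Omega (fun z => complex.Im (u z)) &
      (sqnorm Omega mu u < +oo)%E].

Definition A2 Omega mu (u : Cn -> C) : Prop :=
  holomorphic Omega u /\ L2 Omega mu u.

(** Elements of [L2] being identified when equal almost everywhere, a class lies
    in [A2] when one of its representatives does. *)
Definition A2_closed Omega mu : Prop :=
  forall u, L2 Omega mu u ->
    (forall e : R, 0 < e ->
       exists2 v, A2 Omega mu v & L2norm Omega mu (u - v) < e) ->
    exists2 v, A2 Omega mu v &
      {ae lebesgue, forall z, Omega z -> u z = v z}.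

Definition evaluation_continuous Omega mu (p : Cn) : Prop :=
  forall u, A2 Omega mu u -> forall e : R, 0 < e ->
    exists2 d : R, 0 < d & forall v, A2 Omega mu v ->
      L2norm Omega mu (v - u) < d -> Normc.normc (v p - u p) < e.

Definition admissible Omega mu : Prop :=
  [/\ weight Omega mu, A2_closed Omega mu &
      forall p, Omega p -> evaluation_continuous Omega mu p].

Definition cintegral Omega (f : Cn -> C) : C :=
  (\int[lebesgue]_(z in Omega) complex.Re (f z)) +i*
  (\int[lebesgue]_(z in Omega) complex.Im (f z)).

Definition reproducing_kernel Omega mu (K : Cn -> Cn -> C) : Prop :=
  forall z, Omega z ->
    A2 Omega mu (fun w => conjc (K z w)) /\
    forall u, A2 Omega mu u ->
      u z = cintegral Omega (fun w => K z w * u w * (mu w)%:C).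

(** Reproducing kernels agree on [Omega * Omega], and one exists whenever [mu] is
    admissible, so the default value [0] is then irrelevant. *)
Definition bergman_kernel Omega mu : Cn -> Cn -> C :=
  xget (fun _ _ => 0) [set K | reproducing_kernel Omega mu K].

(** Derivative at [z] along [v], with respect to a real parameter. *)
Definition real_derive (v : Cn) (f : Cn -> C) (z : Cn) : C :=
  derive1 (fun t : R => complex.Re (f (z + t%:C *: v))) 0 +i*
  derive1 (fun t : R => complex.Im (f (z + t%:C *: v))) 0.

Definition std_basis (j : 'I_n.+1) : Cn := delta_mx 0 j.

Definition dz (j : 'I_n.+1) (f : Cn -> C) (z : Cn) : C :=
  (real_derive (std_basis j) f z -
     'i%C * real_derive ('i%C *: std_basis j) f z) / 2.

Definition dzbar (j : 'I_n.+1) (f : Cn -> C) (z : Cn) : C :=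
  (real_derive (std_basis j) f z +
     'i%C * real_derive ('i%C *: std_basis j) f z) / 2.

Definition log_kernel Omega mu (z : Cn) : C :=
  (ln (complex.Re (bergman_kernel Omega mu z z)))%:C.

(** The value at [z] of the tensor field
    [\sum_(j, k) d_j dbar_k log K(z, z) dz_j (x) dzbar_k] on tangent vectors. *)
Definition bergman_metric Omega mu (z v w : Cn) : C :=
  \sum_(j < n.+1) \sum_(k < n.+1)
    dz j (dzbar k (log_kernel Omega mu)) z * v 0 j * conjc (w 0 k).

Definition pullback (F : Cn -> Cn) (g : Cn -> Cn -> Cn -> C) (z v w : Cn) : C :=
  g (F z) ('d F z v) ('d F z w).

(** The metric is defined only where [K(z, z) > 0]. *)
Definition metric_posdef Omega mu : Prop :=
  forall z, Omega z -> 0 < bergman_kernel Omega mu z z /\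
    forall v : Cn, v != 0 -> 0 < bergman_metric Omega mu z v v.

Definition invariant_assignment (D : set (set Cn)) (M : set Cn -> Cn -> R) :
    Prop :=
  forall Omega F, D Omega -> biholomorphism Omega F -> D (F @` Omega) ->
    exists h : Cn -> C, [/\ holomorphic Omega h,
      forall z, Omega z -> h z != 0 &
      forall z, Omega z ->
        M (F @` Omega) (F z) = Normc.normc (h z) ^+ 2 * M Omega z].

End Bergman.

(* Main.v *)
(** Put a = det(F') h_F. By the change of variables formula, u |-> a (u o F) maps
    A^2(F(Omega)) isometrically onto A^2(Omega), so the kernels are related by
    K(x, y) = a(x) K'(F x, F y) conj(a(y)). The metric is the derivative along v in x
    of conj(D_y conj(K(x, y)) w) / K(x, y) at x = y = z; there the factor a(x) cancels
    and conj(a(y)) contributes a summand that does not depend on x. Differentiating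
    z |-> K(z, z) twice requires K to be jointly smooth: K(z, z) is locally bounded by
    a gliding hump argument, which uses that A^2 is closed in L^2, and bounded separately
    holomorphic functions are controlled by Cauchy's formula on circles. *)

Require Import Defs.
From HB Require Import structures.
From mathcomp Require Import all_boot all_order fingroup perm all_algebra.
From mathcomp Require Import complex.
From mathcomp Require Import all_classical all_reals all_analysis.
From mathcomp Require Import measurable_realfun.
From mathcomp Require Import ring lra.

Set Implicit Arguments.
Unset Strict Implicit.
Unset Printing Implicit Defensive.

Import Order.TTheory GRing.Theory Num.Def Num.Theory.
Import numFieldNormedType.Exports.
Local Open Scope classical_set_scope.
Local Open Scope ring_scope.
Local Open Scope complex_scope.

Local Notation Re := complex.Re.
Local Notation Im := complex.Im.
Local Notation cn := Normc.normc.

(** Lebesgue measure is here the Caratheodory restriction of an outer measure built from boxes, and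
    for images of sets only upper bounds of the outer measure are proved. Linear maps are factored
    into shears, stretches and permutations; on small sets a biholomorphism scales like its
    differential up to a factor q > 1; equality follows because the inverse map satisfies the same
    bound. Cauchy's formula requires no theory of curves: in the coordinates w = exp(t + i s) a
    circle about 0 is a vertical segment, so Goursat's theorem on rectangles suffices. The estimates
    that follow from it carry explicit constants, which supply the uniformity for differentiation
    under the integral sign. No complex logarithm of K(x, y) is chosen: the quotient of the
    y-derivative of K by K makes sense wherever K does not vanish, in particular near the
    diagonal. *)

Lemma le_of_eq d (T : porderType d) (x y : T) : x = y -> (x <= y)%O.
Proof. by move=> ->. Qed.

(** * Real norms and complex differentials *)

Section Differentials.
Context {R : realType}.
Local Notation C := R[i].
Implicit Types V W U : normedModType C.

(** Norms of modules over [R[i]] take their values in [R[i]]; this is the real number behind them,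
    which real arithmetic can handle. *)
Definition nrm V (v : V) : R := Re `|v|.

Lemma normE V (v : V) : `|v| = (nrm v)%:C.
Proof. by rewrite /nrm RRe_real// ger0_real. Qed.

Lemma nrm_ge0 V (v : V) : 0 <= nrm v.
Proof. by rewrite -ler0c -normE. Qed.

Lemma nrm_eq0 V (v : V) : (nrm v == 0) = (v == 0).
Proof.
rewrite -[RHS]normr_eq0 normE; apply/eqP/eqP => [->//|H].
exact: (@complexI R).
Qed.

Lemma nrm0 V : nrm (0 : V) = 0.
Proof. by apply/eqP; rewrite nrm_eq0. Qed.

Lemma nrm_gt0 V (v : V) : (0 < nrm v) = (v != 0).
Proof. by rewrite lt_def nrm_ge0 andbT nrm_eq0. Qed.

Lemma ler_nrmD V (v w : V) : nrm (v + w) <= nrm v + nrm w.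
Proof. by rewrite -lecR rmorphD/= -!normE ler_normD. Qed.

Lemma nrmN V (v : V) : nrm (- v) = nrm v.
Proof. by rewrite /nrm normrN. Qed.

Lemma nrm_distC V (v w : V) : nrm (v - w) = nrm (w - v).
Proof. by rewrite /nrm distrC. Qed.

Lemma cnE (x : C) : `|x| = (cn x)%:C.
Proof. by case: x. Qed.

Lemma nrmc (x : C) : nrm x = cn x.
Proof. by apply: (@complexI R); rewrite -normE cnE. Qed.

Lemma nrmZ V (a : C) (v : V) : nrm (a *: v) = cn a * nrm v.
Proof. by apply: (@complexI R); rewrite -normE normrZ !normE nrmc rmorphM. Qed.

Lemma cn_ge0 (x : C) : 0 <= cn x.
Proof. by rewrite -nrmc nrm_ge0. Qed.

Lemma cn_gt0 (x : C) : (0 < cn x) = (x != 0).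
Proof. by rewrite -nrmc nrm_gt0. Qed.

Lemma cn_eq0 (x : C) : (cn x == 0) = (x == 0).
Proof. by rewrite -nrmc nrm_eq0. Qed.

Lemma ler_cnD (x y : C) : cn (x + y) <= cn x + cn y.
Proof. by rewrite -!nrmc ler_nrmD. Qed.

Lemma cnN (x : C) : cn (- x) = cn x.
Proof. by rewrite -!nrmc nrmN. Qed.

Lemma ler_cnB (x y : C) : cn (x - y) <= cn x + cn y.
Proof. by rewrite -(cnN y) ler_cnD. Qed.

Lemma cn_distC (x y : C) : cn (x - y) = cn (y - x).
Proof. by rewrite -!nrmc nrm_distC. Qed.

Lemma cn_real (x : R) : cn x%:C = `|x|.
Proof. by rewrite /cn /= expr0n/= addr0 sqrtr_sqr. Qed.

Lemma cn_conj (x : C) : cn (conjc x) = cn x.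
Proof. by case: x => a b /=; rewrite sqrrN. Qed.

Lemma cn_i : cn ('i%C : C) = 1.
Proof. by rewrite /= expr0n/= add0r expr1n sqrtr1. Qed.

Lemma ler_Re_cn (x : C) : `|Re x| <= cn x.
Proof.
case: x => a b /=; rewrite -sqrtr_sqr; apply: ler_wsqrtr.
by rewrite lerDl sqr_ge0.
Qed.

Lemma ler_Im_cn (x : C) : `|Im x| <= cn x.
Proof.
case: x => a b /=; rewrite -sqrtr_sqr; apply: ler_wsqrtr.
by rewrite lerDr sqr_ge0.
Qed.

Lemma ler_cn_ReIm (x : C) :
  cn x <= `|Re x| + `|Im x|.
Proof.
rewrite {1}[x]complexE; apply: le_trans (ler_cnD _ _) _.
by rewrite Normc.normcM cn_i mul1r !cn_real.
Qed.

Lemma cn_sqr (x : C) :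
  cn x ^+ 2 = Re x ^+ 2 + Im x ^+ 2.
Proof. by case: x => a b /=; rewrite sqr_sqrtr// addr_ge0// sqr_ge0. Qed.

Lemma cReD (x y : C) : Re (x + y) = Re x + Re y.
Proof. by case: x y => [? ?] [? ?]. Qed.

Lemma cImD (x y : C) : Im (x + y) = Im x + Im y.
Proof. by case: x y => [? ?] [? ?]. Qed.

Lemma cReN (x : C) : Re (- x) = - Re x.
Proof. by case: x => [? ?]. Qed.

Lemma cImN (x : C) : Im (- x) = - Im x.
Proof. by case: x => [? ?]. Qed.

Lemma cReB (x y : C) : Re (x - y) = Re x - Re y.
Proof. by rewrite cReD cReN. Qed.

Lemma cImB (x y : C) : Im (x - y) = Im x - Im y.
Proof. by rewrite cImD cImN. Qed.

Lemma cReM (x y : C) : Re (x * y) =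
  Re x * Re y - Im x * Im y.
Proof. by case: x y => [? ?] [? ?]. Qed.

Lemma cImM (x y : C) : Im (x * y) =
  Re x * Im y + Im x * Re y.
Proof. by case: x y => [? ?] [? ?]. Qed.

Lemma complex_ext (x y : C) : Re x = Re y ->
  Im x = Im y -> x = y.
Proof. by case: x y => [? ?] [? ?] /= -> ->. Qed.

Lemma gtc0_real (e : C) : 0 < e -> 0 < Re e /\ e = (Re e)%:C.
Proof.
move=> e0; have eE : e = (Re e)%:C by rewrite RRe_real// gtr0_real.
by split => //; rewrite -ltcR -eE.
Qed.

Lemma nbhs_nrmP V (x : V) (A : set V) :
  nbhs x A <-> exists2 d : R, 0 < d & forall y, nrm (y - x) < d -> A y.
Proof.
split.
  move=> /nbhs_ballP[e /= e0 xeA]; have [re0 eE] := gtc0_real e0.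
  exists (Re e) => // y yx; apply: xeA.
  by rewrite -ball_normE /= eE normE ltcR nrm_distC.
move=> [d d0 H]; apply/nbhs_ballP; exists d%:C => /=; first by rewrite ltcR.
move=> y; rewrite -ball_normE /= normE ltcR nrm_distC; exact: H.
Qed.

Lemma open_nrmP V (A : set V) : open A ->
  forall x, A x -> exists2 d : R, 0 < d & forall y, nrm (y - x) < d -> A y.
Proof. by move=> oA x Ax; apply/nbhs_nrmP; apply: open_nbhs_nbhs. Qed.

Lemma continuous_nrmP V W (f : V -> W) x : {for x, continuous f} <->
  forall e : R, 0 < e ->
    exists2 d : R, 0 < d & forall y, nrm (y - x) < d -> nrm (f y - f x) < e.
Proof.
split.
  move=> cf e e0; have := cf [set y | nrm (y - f x) < e].
  move=> /(_ _)/nbhs_nrmP; apply; apply/nbhs_nrmP; by exists e.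
move=> H A /nbhs_nrmP[e e0 eA]; have [d d0 dA] := H e e0.
by apply/nbhs_nrmP; exists d => // y /dA /eA.
Qed.

Lemma differentiable_eps V W (f : V -> W) x : differentiable f x ->
  forall e : R, 0 < e -> exists2 d : R, 0 < d & forall h, nrm h < d ->
    nrm (f (x + h) - f x - 'd f x h) <= e * nrm h.
Proof.
move=> /diff_locally/eqaddoP fx e e0.
have /nbhs_nrmP[d d0 H] := fx e%:C ltac:(by rewrite ltcR).
exists d => // h hd; have := H h; rewrite subr0 => /(_ hd).
by rewrite /= !fctE !normE -rmorphM lecR opprD addrA [h + x]addrC.
Qed.

Lemma bounded_linear_continuous V W (A : {linear V -> W}) (k : R) : 0 <= k ->
  (forall h, nrm (A h) <= k * nrm h) -> continuous A.
Proof.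
move=> k0 Ak; apply/linear_bounded_continuous.
exists k%:C; split; first by rewrite complex_real.
move=> M kM.
(* A complex M above k is real, since the order of [R[i]] only compares numbers with equal imaginary
   parts. *)
have M0 : (M \is Num.real).
  rewrite -(subrK k%:C M) rpredD// ?complex_real//.
  by rewrite ger0_real// subr_ge0 ltW.
have ME : M = (Re M)%:C by rewrite RRe_real.
move: kM; rewrite ME ltcR => kM.
apply/nbhs_nrmP; exists 1 => // y; rewrite subr0 => y1 /=.
rewrite normE lecR (le_trans (Ak y))//.
by rewrite (le_trans _ (ltW kM))// ler_piMr// ltW.
Qed.

Lemma eps_differentiable V W (f : V -> W) x (A : {linear V -> W}) :
  continuous A ->
  (forall e : R, 0 < e -> exists2 d : R, 0 < d & forall h, nrm h < d ->
    nrm (f (x + h) - f x - A h) <= e * nrm h) ->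
  differentiable f x /\ 'd f x = A :> (V -> W).
Proof.
move=> cA H.
have E : f \o shift x = cst (f x) + A +o_0 id.
  apply/eqaddoP => e /gtc0_real[e0 ->].
  have [d d0 dP] := H _ e0.
  apply/nbhs_nrmP; exists d => // h; rewrite subr0 => /dP.
  by rewrite /= !fctE !normE -rmorphM lecR opprD addrA [h + x]addrC.
have dE := diff_unique cA E.
split => //; by apply/diff_locallyP; rewrite dE.
Qed.

Lemma eps_diff V W (f : V -> W) x (A : V -> W) (k : R) : 0 <= k ->
  (forall a u v, A (a *: u + v) = a *: A u + A v) ->
  (forall h, nrm (A h) <= k * nrm h) ->
  (forall e : R, 0 < e -> exists2 d : R, 0 < d & forall h, nrm h < d ->
    nrm (f (x + h) - f x - A h) <= e * nrm h) ->
  differentiable f x /\ 'd f x = A :> (V -> W).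
Proof.
move=> k0 linA Ak H.
pose AL : {linear V -> W} := HB.pack A (GRing.isLinear.Build _ _ _ _ A linA).
by apply: (@eps_differentiable _ _ _ _ AL) => //; exact: (bounded_linear_continuous k0).
Qed.

Section rowvec.
Variable n : nat.
Implicit Types z : 'rV[C]_n.+1.

(** The norm of a row is the maximum of the moduli of its entries; the description of balls of
    matrices as products of balls gives this without unfolding a maximum. *)
Lemma nrm_ltP z (d : R) : 0 < d -> nrm z < d <-> forall i, cn (z 0 i) < d.
Proof.
move=> d0; have -> : (nrm z < d) = (`|z| < d%:C) by rewrite normE ltcR.
have -> : (`|z| < d%:C) = `[<ball 0 d%:C z>].
  by apply/idP/asboolP; rewrite -ball_normE /= sub0r normrN.
split=> [/asboolP H i|H].
  by case: H => _ /(_ 0 i); rewrite -ball_normE /= mxE sub0r normrN cnE ltcR.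
apply/asboolP; split; first by rewrite ltcR.
move=> i j; rewrite -ball_normE /= mxE sub0r normrN cnE ltcR (ord1 i); exact: H.
Qed.

Lemma nrm_coord z i : cn (z 0 i) <= nrm z.
Proof.
apply/ler_addgt0Pr => e e0; apply: ltW.
have : nrm z < nrm z + e by rewrite ltrDl.
by move=> /nrm_ltP; apply; rewrite ltr_wpDl// nrm_ge0.
Qed.

Lemma nrm_leP z (d : R) : 0 <= d -> (forall i, cn (z 0 i) <= d) -> nrm z <= d.
Proof.
move=> d0 H; apply/ler_addgt0Pr => e e0; apply/ltW/nrm_ltP; first by rewrite ltr_wpDl.
by move=> i; rewrite (le_lt_trans (H i))// ltrDl.
Qed.

Lemma ler_nrm_sum V I (r : seq I) (P : pred I) (F : I -> V) :
  nrm (\sum_(i <- r | P i) F i) <= \sum_(i <- r | P i) nrm (F i).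
Proof.
elim/big_rec2: _ => [|i y x _ yx]; first by rewrite nrm0.
by rewrite (le_trans (ler_nrmD _ _))// lerD2l.
Qed.

End rowvec.

(* An epsilon-delta form of is_diff: the differential is an arbitrary function A,
   which unification can compare cheaply, unlike the epsilon term 'd f x. *)
Definition hasD V W (f : V -> W) (x : V) (A : V -> W) : Prop :=
  [/\ forall a u v, A (a *: u + v) = a *: A u + A v,
      exists2 k : R, 0 < k & forall h, nrm (A h) <= k * nrm h &
      forall e : R, 0 < e -> exists2 d : R, 0 < d & forall h, nrm h < d ->
        nrm (f (x + h) - f x - A h) <= e * nrm h].

Lemma hasD_diff V W (f : V -> W) x A : hasD f x A ->
  differentiable f x /\ 'd f x = A :> (V -> W).
Proof. by move=> [linA [k k0 Ak] H]; apply: (eps_diff (ltW k0)). Qed.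

Lemma diff_hasD V W (f : V -> W) x : differentiable f x -> hasD f x ('d f x).
Proof.
move=> df; split; [exact: linearP| |exact: differentiable_eps].
have cd := diff_continuous df.
have /continuous_nrmP/(_ 1 ltr01)[d d0 dP] := cd 0.
have D0 : ('d f x : V -> W) 0 = 0 by exact: linear0.
(* Continuity at 0 bounds the differential by 1 on the ball of radius d; rescaling h to norm d / 2
   gives the constant 2 / d. *)
exists (2 / d); first by rewrite divr_gt0.
move=> h; have [->|h0] := eqVneq h 0; first by rewrite D0 !nrm0 mulr0.
have nh : 0 < nrm h by rewrite nrm_gt0.
have c0 : 0 < d / 2 / nrm h by rewrite !divr_gt0.
have := dP ((d / 2 / nrm h)%:C *: h); rewrite subr0 D0 subr0 nrmZ cn_real gtr0_norm//.
rewrite divfK ?gt_eqF// => H.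
have /H : d / 2 < d by lra.
rewrite linearZ nrmZ cn_real gtr0_norm// => /ltW H2.
have -> : 2 / d * nrm h = (d / 2 / nrm h)^-1 by field; rewrite !gt_eqF.
by rewrite -[_^-1]mulr1 ler_pdivlMl.
Qed.

Lemma is_diff_hasD V W (f : V -> W) x A : is_diff x f A <-> hasD f x A.
Proof. by split=> [[df <-]|/hasD_diff[df E]]; [exact: diff_hasD|exact: DiffDef]. Qed.

Lemma differentiable_hasD V W (f : V -> W) x :
  differentiable f x <-> exists A, hasD f x A.
Proof. by split=> [df|[A /hasD_diff[]//]]; exists ('d f x); exact: diff_hasD. Qed.

Lemma hasD_unique V W (f : V -> W) x A B : hasD f x A -> hasD f x B -> A = B.
Proof. by move=> /hasD_diff[_ <-] /hasD_diff[_ <-]. Qed.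

Lemma hasD0 V W (f : V -> W) x A : hasD f x A -> A 0 = 0.
Proof.
move=> [linA _ _]; have := linA 0 0 0; rewrite !scale0r !add0r => H.
by have := linA 1 0 0; rewrite !scale1r addr0 => /eqP; rewrite -subr_eq0 opprD addrA subrr add0r oppr_eq0 => /eqP.
Qed.

Lemma hasDZ V W (f : V -> W) x A a v : hasD f x A -> A (a *: v) = a *: A v.
Proof. by move=> H; have [linA _ _] := H; rewrite -[a *: v]addr0 linA (hasD0 H) addr0. Qed.

Lemma hasDZc V (f : V -> C) x A a v : hasD f x A -> A (a *: v) = a * A v.
Proof. by move=> H; rewrite (hasDZ _ _ H). Qed.

Lemma hasDD V W (f : V -> W) x A u v : hasD f x A -> A (u + v) = A u + A v.
Proof. by move=> [linA _ _]; have := linA 1 u v; rewrite !scale1r. Qed.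

Lemma hasD_near V W (f g : V -> W) x A (d : R) : 0 < d ->
  (forall y, nrm (y - x) < d -> f y = g y) -> hasD f x A -> hasD g x A.
Proof.
move=> d0 fg [linA Ak H]; split => // e e0.
have [d' d'0 dP] := H e e0.
exists (minr d d'); first by rewrite lt_min d0.
move=> h; rewrite lt_min => /andP[hd /dP].
by rewrite !fg// ?subrr ?nrm0// addrC addKr.
Qed.

Lemma hasD_cst V W (c : W) (x : V) : hasD (fun=> c) x (fun=> 0).
Proof. exact/is_diff_hasD. Qed.

Lemma hasD_id V (x : V) : hasD id x id.
Proof. exact/is_diff_hasD. Qed.

Lemma hasD_shift V (c x : V) : hasD (fun y => y + c) x id.
Proof.
have -> : id = (fun v : V => v + 0) by apply/funext => v; rewrite addr0.
exact/is_diff_hasD.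
Qed.

Lemma hasD_linear V W (f : V -> W) x A : hasD f x A -> forall y, hasD A y A.
Proof.
move=> H y; have [linA Ak _] := H; split => // e e0; exists 1 => // h _.
by rewrite (hasDD y h H) [A y + _]addrC addrK subrr nrm0 mulr_ge0 ?nrm_ge0// ltW.
Qed.

Lemma hasD_comp U V W (f : U -> V) (g : V -> W) x A B :
  hasD f x A -> hasD g (f x) B -> hasD (fun y => g (f y)) x (fun v => B (A v)).
Proof. by move=> /is_diff_hasD hf /is_diff_hasD hg; apply/is_diff_hasD; exact: is_diff_comp. Qed.

Lemma hasD_sub V W (f g : V -> W) x A B : hasD f x A -> hasD g x B ->
  hasD (fun y => f y - g y) x (fun v => A v - B v).
Proof. by move=> /is_diff_hasD hf /is_diff_hasD hg; apply/is_diff_hasD. Qed.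

Lemma hasD_mul V (f g : V -> C) x A B : hasD f x A -> hasD g x B ->
  hasD (fun y => f y * g y) x (fun v => f x * B v + g x * A v).
Proof. by move=> /is_diff_hasD hf /is_diff_hasD hg; apply/is_diff_hasD. Qed.

Lemma hasD_inv V (f : V -> C) x D : f x != 0 -> hasD f x D ->
  hasD (fun y => (f y)^-1) x (fun v => - (f x) ^- 2 * D v).
Proof.
move=> fx /hasD_diff[df E].
have := diffV df fx; have := diff_hasD (differentiableV df fx).
move: (diff _ _) => T HT ET; rewrite ET in HT.
have -> : (fun v => - (f x) ^- 2 * D v) = (fun v => - (f x) ^- 2 * 'd f x v).
  by apply/funext => v; congr (_ * _); rewrite E.
exact: HT.
Qed.

Lemma hasD_cmul V (c : C) (f : V -> C) x A : hasD f x A ->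
  hasD (fun y => c * f y) x (fun v => c * A v).
Proof.
move=> /(hasD_mul (hasD_cst c x)).
by have -> : (fun v => c * A v + f x * 0) = (fun v => c * A v)
  by apply/funext => v; rewrite mulr0 addr0.
Qed.

Lemma hasD_add V (f g : V -> C) x A B : hasD f x A -> hasD g x B ->
  hasD (fun y => f y + g y) x (fun v => A v + B v).
Proof. by move=> /is_diff_hasD hf /is_diff_hasD hg; apply/is_diff_hasD. Qed.

Lemma hasD_continuous V W (f : V -> W) x A : hasD f x A ->
  forall e : R, 0 < e -> exists2 d : R, 0 < d & forall y, nrm (y - x) < d -> nrm (f y - f x) < e.
Proof.
by move=> /hasD_diff[/differentiable_continuous/continuous_nrmP].
Qed.

End Differentials.

(** Serves to let the mesh or the error factor of a covering argument tend to 0: the bounds exist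
    only for s > 0, and x, an outer measure or an integral, may be infinite. *)
Lemma lee_lim0 (R : realType) (x : \bar R) (g : R -> R) :
  {for 0, continuous g} ->
  (forall s, 0 < s -> (x <= (g s)%:E)%E) -> (x <= (g 0)%:E)%E.
Proof.
move=> cg H; case: x H => [x| |] H; last by rewrite leNye.
- rewrite lee_fin; apply/ler_addgt0Pr => e e0.
  have /nbhs_ballP[d /= d0 dP] : nbhs (0:R) [set y | `|g 0 - g y| < e].
    by apply: (cg [set y | `|g 0 - y| < e]); apply/nbhs_ballP; exists e.
  have /dP : ball (0:R) d (d / 2).
    by rewrite -ball_normE /= sub0r normrN gtr0_norm ?divr_gt0// ltr_pdivrMr// ltr_pMr// ltr1n.
  move=> /= gd; have := H (d/2); rewrite lee_fin divr_gt0// => /(_ isT) xg.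
  by move: gd; rewrite ltr_norml => /andP[gd _]; lra.
- by have := H 1 ltr01; rewrite leye_eq.
Qed.

Lemma continuous_prodr (R : realType) (I : Type) (r : seq I) (F : I -> R -> R) x :
  (forall i, {for x, continuous (F i)}) ->
  {for x, continuous (fun s => \prod_(i <- r) F i s)}.
Proof.
move=> cF; elim: r => [|i r IH].
  have -> : (fun s => \prod_(i <- [::]) F i s) = cst 1 by apply/funext => s; rewrite big_nil.
  exact: cvg_cst.
have -> : (fun s => \prod_(i <- i :: r) F i s) = F i * (fun s => \prod_(i <- r) F i s).
  by apply/funext => s; rewrite big_cons.
exact: continuousM.
Qed.

(** * Images of sets under linear maps *)

Section LebesgueMeasure.
Context {R : realType} {n : nat}.
Local Notation C := R[i].
Local Notation Cn := 'rV[R[i]]_n.+1.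
Local Notation I := ('I_n.+1 * bool)%type.
Local Notation L := (@lebesgue_outer R n).
Implicit Types (a b : I -> R) (z : Cn).

(** Real coordinates on complex space, indexed by pairs; the boolean [true] selects the imaginary
    part. *)
Definition crd (c : I) z : R :=
  if c.2 then Im (z 0 c.1) else Re (z 0 c.1).

Definition toC a : Cn := \row_i (a (i, false) +i* a (i, true)).

Lemma crd_toC a c : crd c (toC a) = a c.
Proof. by case: c => i [] /=; rewrite /crd mxE. Qed.

Lemma crd_ext z w : (forall c, crd c z = crd c w) -> z = w.
Proof.
move=> H; apply/rowP => i; apply: complex_ext.
  exact: (H (i, false)).
exact: (H (i, true)).
Qed.

Lemma crdD c z w : crd c (z + w) = crd c z + crd c w.
Proof. by rewrite /crd mxE; case: c.2; rewrite ?cReD ?cImD. Qed.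

Lemma crdB c z w : crd c (z - w) = crd c z - crd c w.
Proof. by rewrite /crd !mxE; case: c.2; rewrite ?cReB ?cImB. Qed.

Definition rbox a b : set Cn := [set z | forall c, a c < crd c z <= b c].
Definition rvol a b : R := \prod_c maxr 0 (b c - a c).

Lemma boxE (ab : Cn * Cn) : box ab = rbox (crd^~ ab.1) (crd^~ ab.2).
Proof.
apply/seteqP; split=> z H; last first.
  by move=> i; apply/andP; split; [exact: (H (i, false))|exact: (H (i, true))].
by case=> i [] /=; have /andP[] := H i.
Qed.

Lemma box_volumeE (ab : Cn * Cn) :
  box_volume ab = rvol (crd^~ ab.1) (crd^~ ab.2).
Proof.
rewrite /rvol (eq_bigr (fun c => (fun (i : 'I_n.+1) (e : bool) =>
  maxr 0 (crd (i, e) ab.2 - crd (i, e) ab.1)) c.1 c.2)); last by case.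
rewrite -(pair_bigA _ (fun (i : 'I_n.+1) (e : bool) =>
  maxr 0 (crd (i, e) ab.2 - crd (i, e) ab.1))).
by apply: eq_bigr => i _; rewrite big_bool mulrC.
Qed.

Lemma rboxE a b : rbox a b = box (toC a, toC b).
Proof.
by rewrite boxE; congr rbox; apply/funext => c; rewrite crd_toC.
Qed.

Lemma rvolE a b : rvol a b = box_volume (toC a, toC b).
Proof.
by rewrite box_volumeE; congr rvol; apply/funext => c; rewrite crd_toC.
Qed.

Lemma rvol_ge0 a b : 0 <= rvol a b.
Proof. by rewrite rvolE box_volume_ge0. Qed.

Lemma outer_le_rvol (A : set Cn) (a b : nat -> I -> R) :
  A `<=` \bigcup_k rbox (a k) (b k) ->
  (L A <= \sum_(k <oo) (rvol (a k) (b k))%:E)%E.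
Proof.
move=> H; under eq_eseriesr do rewrite rvolE.
by apply: lebesgue_outer_le => z /H[k _]; rewrite rboxE => ?; exists k.
Qed.

Lemma outer_lb (A : set Cn) (x : \bar R) :
  (forall a b : nat -> I -> R, A `<=` \bigcup_k rbox (a k) (b k) ->
    (x <= \sum_(k <oo) (rvol (a k) (b k))%:E)%E) -> (x <= L A)%E.
Proof.
move=> H; apply: le_ereal_inf_tmp => _ [B AB <-].
under eq_eseriesr do rewrite box_volumeE.
by apply: H => z /AB[k _]; rewrite boxE => ?; exists k.
Qed.

(* Set functions to which a comparison with L on boxes extends to all sets; they
   include A |-> L (f @` (A `&` S)). *)
Definition subadd (nu : set Cn -> \bar R) :=
  [/\ nu set0 = 0%E, forall A, (0 <= nu A)%E,
      {homo nu : A B / A `<=` B >-> (A <= B)%E} & sigma_subadditive nu].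

Lemma subadd_outer : subadd L.
Proof.
split; [exact: lebesgue_outer0|exact: lebesgue_outer_ge0|exact: le_lebesgue_outer|].
exact: lebesgue_outer_sigma_subadditive.
Qed.

Lemma subadd_image (f : Cn -> Cn) (S : set Cn) :
  subadd (fun A => L (f @` (A `&` S))).
Proof.
split.
- by rewrite set0I image_set0 lebesgue_outer0.
- by move=> A; exact: lebesgue_outer_ge0.
- move=> A B AB; apply: le_lebesgue_outer => _ [z [Az Sz] <-].
  by exists z => //; split => //; exact: AB.
- move=> A; rewrite setI_bigcupl image_bigcup.
  exact: lebesgue_outer_sigma_subadditive.
Qed.

Lemma subadd_fin (nu : set Cn -> \bar R) N (A : set Cn) (B : nat -> set Cn) :
  subadd nu -> (forall z, A z -> exists2 k, (k < N)%N & B k z) ->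
  (nu A <= \sum_(0 <= k < N) nu (B k))%E.
Proof.
move=> [nu0 nup num nus] AB.
pose B' k := if (k < N)%N then B k else set0.
apply: (@le_trans _ _ (nu (\bigcup_k B' k))).
  by apply: num => z /AB[k kN Bk]; exists k => //; rewrite /B' kN.
apply: le_trans (nus _) _.
rewrite (nneseries_split 0 N) ?add0n; last by move=> k _; exact: nup.
rewrite eseries0 ?adde0; last by move=> k Nk _; rewrite /B' ltnNge Nk.
by rewrite big_nat [X in (_ <= X)%E]big_nat lee_sum// => k /andP[_ kN]; rewrite /B' kN.
Qed.

(** [L A] is an infimum over covers by boxes, so monotonicity and countable subadditivity of [nu]
    carry the bound from the boxes of a cover over to A. *)
Lemma subadd_dominated (nu : set Cn -> \bar R) (k : R) : subadd nu -> 0 < k ->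
  (forall a b, (nu (rbox a b) <= (k * rvol a b)%:E)%E) ->
  forall A, (nu A <= k%:E * L A)%E.
Proof.
move=> [nu0 nup num nus] k0 H A.
rewrite -lee_pdivrMl//; apply: outer_lb => a b Aab.
rewrite lee_pdivrMl// -nneseriesZl; last by move=> *; rewrite lee_fin rvol_ge0.
apply: le_trans (num _ _ Aab) _; apply: le_trans (nus _) _.
apply: lee_nneseries => [j _ _|j _]; first exact: nup.
exact: H.
Qed.

Definition upd (a : I -> R) (c : I) (x : R) : I -> R :=
  fun d => if d == c then x else a d.

Lemma strip_ex (t s : R) (N : nat) : 0 < t -> t <= N%:R * s ->
  exists2 k, (k < N)%N & k%:R * s < t <= k.+1%:R * s.
Proof.
move=> t0; elim: N => [|N IH]; first by rewrite mul0r leNgt t0.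
move=> tN; case: (leP t (N%:R * s)) => [/IH[k kN H]|Nt].
  by exists k => //; apply: ltnW.
by exists N => //; rewrite Nt tN.
Qed.

Lemma rbox_split a b c s N z : rbox a b z -> b c - a c <= N%:R * s ->
  exists2 k, (k < N)%N &
    rbox (upd a c (a c + k%:R * s)) (upd b c (a c + k.+1%:R * s)) z.
Proof.
move=> zab H; have /andP[z1 z2] := zab c.
have [||k kN /andP[k1 k2]] := @strip_ex (crd c z - a c) s N; first by rewrite subr_gt0.
  by apply: le_trans H; rewrite lerD2r.
exists k => // d; rewrite /upd; case: eqP => [->|_]; last exact: zab.
by apply/andP; split; lra.
Qed.

(** Induction on the list S of the coordinates whose side may differ from s: cutting a side of
    length w into pieces of length s costs a factor w + s instead of w. With all coordinates in S,
    letting s tend to 0 gives the volume of the box. *)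
Lemma cubes_suffice (nu : set Cn -> \bar R) (k : R) : subadd nu -> 0 <= k ->
  (forall a s, 0 < s -> (nu (rbox a (fun c => (a c + s)%R)) <=
     (k * s ^+ #|{: I}|)%:E)%E) ->
  forall a b, (nu (rbox a b) <= (k * rvol a b)%:E)%E.
Proof.
move=> snu k0 H.
have [nu0 nup num nus] := snu.
have step s (S : seq I) : 0 < s -> forall a b, (forall d, d \notin S -> b d = a d + s) ->
    (nu (rbox a b) <= (k * \prod_d (if d \in S then maxr 0 (b d - a d) + s else s))%:E)%E.
  move=> s0; elim: S => [|c S IH] a b Sab.
    rewrite (eq_bigr (fun=> s))// prodr_const; apply: le_trans (H a s s0).
    by apply: num => z zab d; rewrite -Sab//; exact: zab.
  case: (boolP (c \in S)) => cS.
    rewrite (eq_bigr (fun d => if d \in S then maxr 0 (b d - a d) + s else s)).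
      apply: IH => d dS; apply: Sab; rewrite inE negb_or dS andbT.
      by apply: contraNneq dS => ->.
    by move=> d _; rewrite inE; case: eqP => //= ->; rewrite cS.
  pose w := maxr 0 (b c - a c).
  (* The pieces cover the side and exceed it by at most one piece: w <= N s <= w + s. *)
  pose N := (Num.trunc (w / s)).+1.
  have w0 : 0 <= w by rewrite le_max lexx.
  have wN : w <= N%:R * s.
    by rewrite -ler_pdivrMr// ltW// truncnS_gt.
  have Nw : N%:R * s <= w + s.
    have /truncn_itv/andP[tr _] : 0 <= w / s by rewrite divr_ge0// ltW.
    by rewrite /N -natr1 mulrDl mul1r lerD2r -ler_pdivlMr.
  apply: le_trans (@subadd_fin nu N (rbox a b) (fun j => rbox (upd a c (a c + j%:R * s)) (upd b c (a c + j.+1%:R * s))) snu _) _.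
    move=> z zab; apply: rbox_split => //; apply: le_trans wN.
    by rewrite le_max lexx orbT.
  pose P := \prod_(d | d != c) (if d \in S then maxr 0 (b d - a d) + s else s).
  have P0 : 0 <= P.
    apply: prodr_ge0 => d _; case: ifP => _; last exact: ltW.
    by apply: addr_ge0; [rewrite le_max lexx|exact: ltW].
  apply: (@le_trans _ _ (\sum_(0 <= j < N) (k * (s * P))%:E)%E).
    apply: lee_sum => j _; apply: le_trans (IH _ _ _) _.
      move=> d dS; rewrite /upd; case: eqP => [_|/eqP dc].
        by rewrite -natr1; ring.
      by apply: Sab; rewrite inE negb_or dc.
    rewrite lee_fin ler_wpM2l// (bigD1 c)//= (negbTE cS).
    apply: ler_wpM2l; first exact: ltW.
    apply: le_of_eq.
    by apply: eq_bigr => d dc; rewrite /upd (negbTE dc).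
  rewrite sumEFin lee_fin sumr_const_nat subn0 -mulrnAr ler_wpM2l//.
  rewrite (bigD1 c)//= inE eqxx /= -mulrnAl.
  have -> : \prod_(i | i != c) (if i \in c :: S then maxr 0 (b i - a i) + s else s) = P.
    by apply: eq_bigr => d dc; rewrite inE (negbTE dc).
  by rewrite ler_wpM2r// -mulr_natl.
move=> a b.
pose g s := k * \prod_d (maxr 0 (b d - a d) + s).
have -> : k * rvol a b = g 0 by rewrite /g /rvol; congr (_ * _); apply: eq_bigr => d _; rewrite addr0.
apply: lee_lim0.
  apply: continuousM; first exact: cvg_cst.
  apply: continuous_prodr => d; apply: continuousD; [exact: cvg_cst|exact: cvg_id].
move=> s s0; apply: le_trans (step s (enum {: I}) s0 a b _) _.
  by move=> d; rewrite mem_enum.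
rewrite lee_fin /g ler_wpM2l//; under eq_bigr do rewrite mem_enum /=; done.
Qed.

(** * Measurability of boxes and of open sets *)

Lemma measurable_crd_le (c : I) (r : R) :
  measurable ([set z | crd c z <= r] : set (CnL R n)).
Proof.
apply: (@le_caratheodory_measurable R _ (lebesgue_outer_measure R n)) => X.
rewrite /=; apply: outer_lb => a b Xab.
(* The half-space cuts each box of a cover into two boxes whose volumes add up; this is the
   Caratheodory inequality. *)
have min_r (x y : R) : maxr 0 (minr y r - x) + maxr 0 (y - maxr x r) = maxr 0 (y - x).
  have [h|h] := leP y r; have [h2|h2] := leP x r;
    do ![have [?|?] := leP 0 (_ - _)]; try lra.
pose b' k := upd (b k) c (minr (b k c) r).
pose a' k := upd (a k) c (maxr (a k c) r).
have E k : rvol (a k) (b k) = rvol (a k) (b' k) + rvol (a' k) (b k).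
  rewrite /rvol !(bigD1 c (P := predT))//= /b' /a' /upd eqxx -(min_r (a k c) (b k c)) mulrDl.
  by congr (_ * _ + _ * _); apply: eq_bigr => d /negbTE ->.
under eq_eseriesr do rewrite E EFinD.
rewrite nneseriesD; try by move=> *; rewrite lee_fin rvol_ge0.
apply: leeD; apply: outer_le_rvol => z [/Xab[k _ zk] /= zr]; exists k => // d; have := zk d; rewrite /b' /a' /upd; case: eqP => [->|//] /andP[z1 z2].
  by rewrite z1 le_min z2 zr.
by rewrite z2 gt_max z1 ltNge andbT; apply/negP.
Qed.

Lemma measurable_rbox a b : measurable (rbox a b : set (CnL R n)).
Proof.
have -> : rbox a b = \bigcap_(c in [set: I]) ([set z | crd c z <= b c] `\` [set z | crd c z <= a c]).
  apply/seteqP; split=> z H.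
    move=> c _; have /andP[h1 h2] := H c; split => //=; by apply/negP; rewrite -ltNge.
  by move=> c; have [/= h1 /negP h2] := H c Logic.I; rewrite ltNge h2 h1.
apply: fin_bigcap_measurable; first exact: finite_finset.
by move=> c _; apply: measurableD; exact: measurable_crd_le.
Qed.

Lemma nrm_rbox (z w : Cn) (d : R) : 0 < d ->
  (forall c, `|crd c w - crd c z| < d / 2) -> nrm (w - z) < d.
Proof.
move=> d0 H; apply/nrm_ltP => // i.
apply: le_lt_trans (ler_cn_ReIm _) _.
have := H (i, false); have := H (i, true); rewrite -!crdB /crd /= => h1 h2.
by rewrite (splitr d) ltrD.
Qed.

Lemma crd_nrm z c : `|crd c z| <= nrm z.
Proof.
apply: le_trans (nrm_coord z c.1); rewrite /crd.
by case: c.2; [exact: ler_Im_cn|exact: ler_Re_cn].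
Qed.

(** A countable base of boxes: it makes open sets measurable and later enumerates the pieces of the
    change of variables. *)
Definition ratbox (t : {ffun I -> rat} * {ffun I -> rat}) : set Cn :=
  rbox (fun c => ratr (t.1 c)) (fun c => ratr (t.2 c)).

Lemma ratbox_base (U : set Cn) z : open U -> U z ->
  exists2 t, ratbox t z & ratbox t `<=` U.
Proof.
move=> oU /(open_nrmP oU)[d d0 dU].
have H (x : R) : exists p : rat * rat, x - d / 4 < ratr p.1 < x /\ x < ratr p.2 < x + d / 4.
  have [|p p1] := @rat_in_itvoo R (x - d / 4) x; first by rewrite ltrBlDr ltrDl divr_gt0.
  have [|q q1] := @rat_in_itvoo R x (x + d / 4); first by rewrite ltrDl divr_gt0.
  by exists (p, q); move: p1 q1; rewrite !in_itv.
pose p c := sval (cid (H (crd c z))).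
exists ([ffun c => (p c).1], [ffun c => (p c).2]).
  move=> c; rewrite !ffunE /p; case: cid => /= x [/andP[_ h1] /andP[h2 _]].
  by rewrite h1 ltW.
move=> w /= wp; apply: dU; apply: nrm_rbox => // c.
have := wp c; rewrite !ffunE /p; case: cid => /= x [/andP[h1 h2] /andP[h3 h4]] /andP[h5 h6].
rewrite ltr_norml; apply/andP; split; lra.
Qed.

Lemma open_measurable_CnL (U : set Cn) : open U -> measurable (U : set (CnL R n)).
Proof.
move=> oU.
pose B t : set (CnL R n) := if pselect (ratbox t `<=` U) then ratbox t else set0.
have -> : U = \bigcup_t B t.
  apply/seteqP; split=> z.
    by move=> /(ratbox_base oU)[t zt tU]; exists t => //; rewrite /B; case: pselect.
  by move=> [t _]; rewrite /B; case: pselect => // tU /tU.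
apply: countable_bigcupT_measurable; first exact: countableP.
by move=> t; rewrite /B; case: pselect => [tU|ntU]; [exact: measurable_rbox|exact: measurable0].
Qed.

(** * Scaling of the outer measure under linear maps *)

Definition outer_scales (f : Cn -> Cn) (k : R) :=
  0 < k /\ forall A, (L (f @` A) <= k%:E * L A)%E.

Lemma outer_scales_comp f g k l : outer_scales f k -> outer_scales g l ->
  outer_scales (f \o g) (k * l).
Proof.
move=> [k0 fk] [l0 gl]; split; first by rewrite mulr_gt0.
move=> A; rewrite -image_comp; apply: le_trans (fk _) _.
by rewrite EFinM -muleA lee_pmul2l.
Qed.

Lemma outer_scales_box f k : 0 < k ->
  (forall a b, (L (f @` rbox a b) <= (k * rvol a b)%:E)%E) -> outer_scales f k.
Proof.
move=> k0 H; split => // A.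
have := subadd_image f setT.
have -> : (fun A => L (f @` (A `&` setT))) = (fun A => L (f @` A)).
  by apply/funext => B; rewrite setIT.
by move=> /subadd_dominated /(_ k0 H).
Qed.

Lemma outer_rbox a b : (L (rbox a b) <= (rvol a b)%:E)%E.
Proof.
pose a' k := if k is 0%N then a else cst 0.
pose b' k := if k is 0%N then b else cst 0.
apply: le_trans (outer_le_rvol (a := a') (b := b') _) _.
  by move=> z zab; exists 0%N.
rewrite (nneseries_split 0 1) ?add0n; last by move=> *; rewrite lee_fin rvol_ge0.
rewrite big_nat1 eseries0 ?adde0// => k k1 _; case: k k1 => //= k _.
by rewrite /rvol (bigD1 (ord0, true))//= /cst subrr maxxx mul0r.
Qed.

Lemma outer_scales_subbox f k : 0 < k ->
  (forall a b, exists a' b', f @` rbox a b `<=` rbox a' b' /\ rvol a' b' <= k * rvol a b) ->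
  outer_scales f k.
Proof.
move=> k0 H; apply: outer_scales_box => // a b.
have [a' [b' [sub v]]] := H a b.
apply: le_trans (le_lebesgue_outer sub) _; apply: le_trans (outer_rbox _ _) _.
by rewrite lee_fin.
Qed.

Lemma outer_scales_shift (z0 : Cn) : outer_scales (fun z => z0 + z) 1.
Proof.
apply: outer_scales_subbox => // a b.
exists (fun c => crd c z0 + a c), (fun c => crd c z0 + b c); split.
  by move=> _ [z zab <-] c; rewrite crdD ltrD2l lerD2l.
rewrite mul1r /rvol ler_prod// => c _; rewrite le_max lexx /=.
by rewrite opprD addrACA subrr add0r.
Qed.

Lemma outer_shift (z0 : Cn) A : (L ((fun z => (z0 + z)%R) @` A) <= L A)%E.
Proof. by have [_ /(_ A)] := outer_scales_shift z0; rewrite mul1e. Qed.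

Definition shear (c d : I) (t : R) z : Cn :=
  toC (fun e => if e == c then crd c z + t * crd d z else crd e z).

Lemma crd_shear c d t z e :
  crd e (shear c d t z) = if e == c then crd c z + t * crd d z else crd e z.
Proof. by rewrite crd_toC. Qed.

(* Cut along the coordinate d into N slabs of height r: on each of them the shear is a
   translation up to an error |t| r, and r tends to 0. *)
Lemma outer_scales_shear c d t : c != d -> outer_scales (shear c d t) 1.
Proof.
move=> cd; apply: outer_scales_box => // a b; rewrite mul1r.
pose w e := maxr 0 (b e - a e).
have w0 e : 0 <= w e by rewrite le_max lexx.
pose P := \prod_(e | (e != c) && (e != d)) w e.
have P0 : 0 <= P by apply: prodr_ge0.
pose g s := (w c + 2 * `|t| * s) * (w d * P).
have -> : rvol a b = g 0.
  rewrite /g mulr0 addr0 /rvol (bigD1 c)//= (bigD1 d)//=.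
  by rewrite eq_sym.
apply: lee_lim0.
  apply: continuousM; last exact: cvg_cst.
  apply: continuousD; first exact: cvg_cst.
  apply: continuousM; [exact: cvg_cst|exact: cvg_id].
move=> s s0.
pose N := (Num.trunc (w d / s)).+1.
have N0 : 0 < N%:R :> R by rewrite ltr0n.
pose r := w d / N%:R.
have r0 : 0 <= r by rewrite divr_ge0// ltW.
have rs : r <= s.
  by rewrite ler_pdivrMr// -ler_pdivrMl// mulrC ltW// truncnS_gt.
have Nr : N%:R * r = w d by rewrite /r mulrC divfK// gt_eqF.
pose ak (k : nat) := upd (upd a d (a d + k%:R * r)) c (a c + (t * (a d + k%:R * r) - `|t| * r)).
pose bk (k : nat) := upd (upd b d (a d + k.+1%:R * r)) c (b c + (t * (a d + k%:R * r) + `|t| * r)).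
apply: le_trans (@subadd_fin L N _ (fun k => rbox (ak k) (bk k)) subadd_outer _) _.
  move=> _ [z zab <-].
  have [|k kN Hk] := @rbox_split a b d r N z zab.
    by rewrite Nr le_max lexx orbT.
  exists k => // e; rewrite crd_shear /ak /bk {1 3}/upd; case: (eqVneq e c) => [_|_]; last exact: Hk.
  have := Hk c; rewrite /upd (negbTE cd) => /andP[h1 h2].
  have := Hk d; rewrite /upd eqxx => /andP[h3 h4].
  set u := crd d z - (a d + k%:R * r).
  have u0 : 0 <= u <= r by rewrite /u -[k.+1]addn1 natrD in h4 *; apply/andP; split; lra.
  have : `|t * u| <= `|t| * r.
    by rewrite normrM ler_wpM2l//; case/andP: u0 => u0 ur; rewrite ger0_norm.
  rewrite ler_norml => /andP[h5 h6].
  have -> : t * crd d z = t * (a d + k%:R * r) + t * u by rewrite /u; ring.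
  by apply/andP; split; lra.
apply: (@le_trans _ _ (\sum_(0 <= k < N) ((w c + 2 * `|t| * r) * (r * P))%:E)%E).
  apply: lee_sum => k _; apply: le_trans (outer_rbox _ _) _; rewrite lee_fin.
  rewrite /rvol (bigD1 c)//= (bigD1 d)//=; last by rewrite eq_sym.
  have -> : maxr 0 (bk k d - ak k d) = r.
    rewrite /bk /ak /upd eq_sym (negbTE cd) eqxx -natr1.
    by rewrite (_ : _ - _ = r) ?max_r//; ring.
  rewrite (eq_bigr w); last first.
    by move=> e /andP[/negbTE h1 /negbTE h2]; rewrite /ak /bk /upd h1 h2.
  rewrite ler_wpM2r ?mulr_ge0// /ak /bk /upd eqxx ge_max.
  have h : b c - a c <= w c by rewrite le_max lexx orbT.
  have h' : 0 <= `|t| * r by rewrite mulr_ge0.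
  have := w0 c; move=> h''; apply/andP; split; lra.
rewrite sumEFin lee_fin sumr_const_nat subn0 -[leLHS]mulr_natl /g.
rewrite mulrCA [N%:R * _]mulrA Nr ler_wpM2r ?mulr_ge0// lerD2l ler_wpM2l// mulr_ge0.
Qed.

Definition stretch (c : I) (r : R) z : Cn :=
  toC (fun e => if e == c then r * crd c z else crd e z).

Lemma outer_scales_stretch c r : 0 < r -> outer_scales (stretch c r) r.
Proof.
move=> r0; apply: outer_scales_subbox => // a b.
exists (upd a c (r * a c)), (upd b c (r * b c)); split.
  move=> _ [z zab <-] e; rewrite crd_toC /upd; case: eqP => [_|_]; last exact: zab.
  have := zab c.
  by rewrite ltr_pM2l// ler_pM2l.
rewrite /rvol (bigD1 c)//= [in leRHS](bigD1 c)//= /upd eqxx -mulrBr.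
rewrite mulrA (_ : maxr 0 (r * _) = r * maxr 0 (b c - a c)); last first.
  by rewrite maxr_pMr ?ltW// mulr0.
rewrite (eq_bigr (fun e => maxr 0 (b e - a e)))// => e /negbTE ->; done.
Qed.

Definition cscal (i : 'I_n.+1) (x : C) z : Cn :=
  \row_j (if j == i then x * z 0 i else z 0 j).

Lemma cscal_comp i x y : cscal i x \o cscal i y = cscal i (x * y).
Proof.
apply/funext => z; apply/rowP => j; rewrite !mxE eqxx.
by case: eqP => // _; rewrite mulrA.
Qed.

(* If Re y > 0, multiplication by y is a product of two shears and two positive
   stretches; the other cases reduce to this one through i = (1 + i) (1 + i) / 2. *)
Lemma outer_scales_cscal i x : x != 0 -> outer_scales (cscal i x) (cn x ^+ 2).
Proof.
have pos y : 0 < Re y -> outer_scales (cscal i y) (cn y ^+ 2).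
  move=> p0; set p := Re y in p0; set q := Im y.
  have pn : p != 0 by rewrite gt_eqF.
  (* The factorisation lower unipotent, diagonal, upper unipotent of the real 2 x 2 matrix of
     multiplication by p + i q. The pivots p and (p^2 + q^2) / p multiply to |y|^2. *)
  have -> : cscal i y = shear (i, true) (i, false) (q / p) \o
      (stretch (i, false) p \o (stretch (i, true) ((p ^+ 2 + q ^+ 2) / p) \o
      shear (i, false) (i, true) (- q / p))).
    apply/funext => z; apply: crd_ext => -[j e].
    rewrite /= !crd_shear !crd_toC !xpair_eqE !eqxx /=.
    case: (eqVneq j i) => [->|ji]; last first.
      by rewrite /= /crd mxE (negbTE ji).
    case: e; rewrite /= /crd /= mxE eqxx ?cImM ?cReM -/p -/q; field; exact: pn.
  have -> : cn y ^+ 2 = 1 * (p * ((p ^+ 2 + q ^+ 2) / p * 1)).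
    by rewrite cn_sqr -/p -/q; field; exact: pn.
  apply: outer_scales_comp; first by apply: outer_scales_shear; rewrite xpair_eqE andbF.
  apply: outer_scales_comp; first exact: outer_scales_stretch.
  apply: outer_scales_comp; last by apply: outer_scales_shear; rewrite xpair_eqE andbF.
  apply: outer_scales_stretch; rewrite divr_gt0// ltr_pwDl ?sqr_ge0// exprn_gt0//.
have mul y w : outer_scales (cscal i y) (cn y ^+ 2) ->
    outer_scales (cscal i w) (cn w ^+ 2) ->
    outer_scales (cscal i (y * w)) (cn (y * w) ^+ 2).
  move=> h1 h2; rewrite -cscal_comp Normc.normcM exprMn; exact: outer_scales_comp.
have si : outer_scales (cscal i 'i%C) (cn ('i%C : C) ^+ 2).
  have -> : ('i%C : C) = (1 +i* 1) * ((1/2) +i* (1/2)).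
    by apply: complex_ext; rewrite ?cReM ?cImM /=; field.
  by apply: mul; apply: pos => /=; lra.
have imp y : 0 < Im y -> outer_scales (cscal i y) (cn y ^+ 2).
  move=> y0; have -> : y = 'i%C * (Im y -i* Re y).
    by apply: complex_ext; rewrite ?cReM ?cImM /=; ring.
  by apply: mul => //; exact: pos.
have neg y : outer_scales (cscal i (- y)) (cn (- y) ^+ 2) ->
    outer_scales (cscal i y) (cn y ^+ 2).
  move=> h; have -> : y = 'i%C * ('i%C * (- y)).
    by rewrite mulrA -expr2 sqr_i mulN1r opprK.
  exact: (mul _ _ si (mul _ _ si h)).
move=> x0; have [xp|xn|xz] := ltgtP 0 (Re x); first exact: pos.
  by apply: neg; apply: pos; rewrite cReN oppr_gt0.
have [yp|yn|yz] := ltgtP 0 (Im x); first exact: imp.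
  by apply: neg; apply: imp; rewrite cImN oppr_gt0.
by case/eqP: x0; apply: complex_ext.
Qed.

Definition caxpy (k j : 'I_n.+1) (x : C) z : Cn :=
  \row_e (if e == k then z 0 k + x * z 0 j else z 0 e).

Lemma outer_scales_caxpy k j x : k != j -> outer_scales (caxpy k j x) 1.
Proof.
move=> kj; have jk : (j == k) = false by rewrite eq_sym (negbTE kj).
have -> : caxpy k j x = shear (k, false) (j, false) (Re x) \o
   (shear (k, false) (j, true) (- Im x) \o
   (shear (k, true) (j, false) (Im x) \o
   shear (k, true) (j, true) (Re x))).
  apply/funext => z; apply: crd_ext => -[l e].
  rewrite /= !crd_shear !xpair_eqE jk !eqxx /= ?andbF ?andbT /=.
  rewrite [in LHS]/crd mxE; case: (eqVneq l k) => [->|lk] /=.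
    case: e; rewrite /= ?cReD ?cImD ?cReM ?cImM /crd /=; ring.
  by case: e.
have -> : 1 = 1 * (1 * (1 * 1)) :> R by rewrite !mul1r.
by do 3?[apply: outer_scales_comp]; apply: outer_scales_shear; rewrite xpair_eqE negb_and kj.
Qed.

Definition rowop (k : 'I_n.+1) (u : 'I_n.+1 -> C) (S : seq 'I_n.+1) z : Cn :=
  \row_e (if e == k then z 0 k * u k + \sum_(j <- S) z 0 j * u j else z 0 e).

(** A scaling of coordinate k by [u k], followed by one [caxpy] for each index of S. As k is not in
    S, the coordinates that are read have not been altered. *)
Lemma outer_scales_rowop k u S : k \notin S -> u k != 0 ->
  outer_scales (rowop k u S) (cn (u k) ^+ 2).
Proof.
move=> + uk; elim: S => [_|j S IH].
  have -> : rowop k u [::] = cscal k (u k).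
    by apply/funext => z; apply/rowP => e; rewrite !mxE big_nil addr0 mulrC.
  exact: outer_scales_cscal.
rewrite inE negb_or => /andP[kj kS].
have -> : rowop k u (j :: S) = caxpy k j (u j) \o rowop k u S.
  apply/funext => z; apply/rowP => e; rewrite !mxE big_cons eqxx.
  case: eqP => // _; rewrite eq_sym (negbTE kj) [u j * _]mulrC.
  by rewrite -!addrA [X in _ = _ + X]addrC.
by rewrite -[X in outer_scales _ X]mul1r; apply: outer_scales_comp; [exact: outer_scales_caxpy|exact: IH].
Qed.

Lemma outer_scales_triangular (T : 'M[C]_n.+1) (rho : 'I_n.+1 -> nat) :
  injective rho -> (forall i, rho i < n.+1)%N ->
  (forall j k, T j k != 0 -> (rho j <= rho k)%N) -> (forall k, T k k != 0) ->
  outer_scales (fun z => z *m T) (\prod_k cn (T k k) ^+ 2).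
Proof.
move=> rinj rlt Ttri Tnz.
(* The intermediate state in which the coordinates of rank at least q have been replaced. *)
pose M q z : Cn := \row_k (if (q <= rho k)%N then (z *m T) 0 k else z 0 k).
pose c q := \prod_k (if (q <= rho k)%N then cn (T k k) ^+ 2 else 1).
suff H p : (p <= n.+1)%N -> outer_scales (M (n.+1 - p)%N) (c (n.+1 - p)%N).
  have := H n.+1 (leqnn _); rewrite subnn.
  have -> : M 0%N = (fun z => z *m T).
    by apply/funext => z; apply/rowP => k; rewrite !mxE leq0n.
  by [].
elim: p => [_|p IH pn].
  rewrite subn0.
  have -> : M n.+1 = id.
    by apply/funext => z; apply/rowP => k; rewrite mxE leqNgt ltnS -ltnS rlt.
  have -> : c n.+1 = 1.
    by rewrite /c big1// => k _; rewrite leqNgt ltnS -ltnS rlt.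
  by split => // A; rewrite image_id mul1e.
have {IH} := IH (ltnW pn); rewrite -(subnSK pn); set q := (n.+1 - p.+1)%N => IH.
case: (pickP (fun k => rho k == q)) => [k /eqP kq|nok]; last first.
  have E k : (q <= rho k)%N = (q < rho k)%N by rewrite leq_eqVlt eq_sym nok.
  have -> : M q = M q.+1 by apply/funext => z; apply/rowP => k; rewrite !mxE E.
  by have -> : c q = c q.+1 by apply: eq_bigr => k _; rewrite E.
have E e : e != k -> (q <= rho e)%N = (q < rho e)%N.
  move=> ek; rewrite leq_eqVlt -kq; case: eqP => // /rinj ke.
  by rewrite ke eqxx in ek.
pose S := [seq j <- enum 'I_n.+1 | j != k].
have -> : M q = rowop k (fun j => T j k) S \o M q.+1.
  apply/funext => z; apply/rowP => e; rewrite !mxE.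
  case: (eqVneq e k) => [->|ek]; last by rewrite E.
  rewrite kq leqnn ltnn (bigD1 k)//= big_filter big_enum_cond /=; congr (_ + _).
  apply: eq_bigr => j jk; rewrite mxE.
  case: ifP => // qj; have [->|Tn] := eqVneq (T j k) 0; first by rewrite !mulr0.
  by have := Ttri _ _ Tn; rewrite kq leqNgt qj.
have -> : c q = cn (T k k) ^+ 2 * c q.+1.
  rewrite /c (bigD1 k)//= kq leqnn [in RHS](bigD1 k)//= kq ltnn mul1r; congr (_ * _).
  by apply: eq_bigr => e ek; rewrite E.
apply: outer_scales_comp => //.
by apply: outer_scales_rowop => //; rewrite mem_filter eqxx.
Qed.

Lemma outer_scales_perm (s : {perm 'I_n.+1}) :
  outer_scales (fun z => \row_j z 0 (s j)) 1.
Proof.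
apply: outer_scales_subbox => // a b.
pose h (c : I) : I := (s c.1, c.2).
exists (a \o h), (b \o h); split.
  by move=> _ [z zab <-] c; have := zab (h c); rewrite /crd /= mxE.
rewrite mul1r /rvol [leRHS](reindex_inj (h := h))//.
by move=> [i e] [j f] [] /= /perm_inj -> ->.
Qed.

(** LUP decomposition: the permutation and the unit triangular factor contribute 1, and the product
    of the diagonal of U is det A up to sign. *)
Lemma outer_scales_mulmx (A : 'M[C]_n.+1) : A \in unitmx ->
  outer_scales (fun z => z *m A) (cn (\det A) ^+ 2).
Proof.
move=> Au.
have := cormen_lup_correct A; have := cormen_lup_perm A.
have := @cormen_lup_lower _ _ A; have := @cormen_lup_upper _ _ A.
have := cormen_lup_detL A.
case: (cormen_lup A) => -[P Lo] U /= dL Uup Llow /is_perm_mxP[s Ps] PA.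
have dP : cn (\det P) = 1.
  rewrite Ps det_perm; case: (perm.odd_perm s); rewrite ?expr1 ?expr0 ?cnN.
    exact: Normc.normc1.
  exact: Normc.normc1.
have dU : \det U = \prod_k U k k.
  rewrite -det_tr det_trig; first by apply: eq_bigr => k _; rewrite mxE.
  by apply/is_trig_mxP => i j ij; rewrite mxE Uup.
have dA : cn (\det A) = cn (\det U).
  have /(congr1 (fun M => cn (\det M))) := PA.
  by rewrite !det_mulmx dL mul1r Normc.normcM dP mul1r.
have AE : A = perm_mx (s^-1)%g *m (Lo *m U).
  have -> : Lo *m U = P *m A by [].
  by rewrite Ps mulmxA -perm_mxM mulVg perm_mx1 mul1mx.
have Unz k : U k k != 0.
  move: Au; rewrite unitmxE unitfE -cn_eq0 dA dU cn_eq0.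
  by apply: contraNneq => Uk; rewrite (bigD1 k)//= Uk mul0r.
have -> : cn (\det A) ^+ 2 = cn (\det U) ^+ 2 * (1 * 1) by rewrite dA !mulr1.
have -> : (fun z => z *m A) = (fun z => z *m U) \o ((fun z => z *m Lo) \o
    (fun z : Cn => \row_j z 0 (s j))).
  apply/funext => z /=; rewrite AE !mulmxA; congr (_ *m _ *m _).
  apply/rowP => j; rewrite !mxE (bigD1 (s j))//= !mxE permK eqxx mulr1 big1 ?addr0//.
  move=> i ij; rewrite !mxE; case: eqP => [E|_]; last by rewrite mulr0.
  by rewrite -E permKV eqxx in ij.
apply: outer_scales_comp.
  have -> : cn (\det U) ^+ 2 = \prod_k cn (U k k) ^+ 2.
    rewrite dU.
    elim/big_rec2 : _ => [|k x y _ <-]; first by rewrite Normc.normc1 expr1n.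
    by rewrite Normc.normcM exprMn.
  apply: (outer_scales_triangular (rho := val)) => //; first by move=> i; exact: ltn_ord.
  by move=> j k; apply: contraNT; rewrite -ltnNge => kj; rewrite Uup.
apply: outer_scales_comp; last exact: outer_scales_perm.
have -> : 1 = \prod_k cn (Lo k k) ^+ 2.
  by rewrite big1// => k _; rewrite Llow// eqxx Normc.normc1 expr1n.
apply: (outer_scales_triangular (rho := @rev_ord n.+1)).
- by move=> i j /val_inj /rev_ord_inj.
- by move=> i; exact: ltn_ord.
- move=> j k; apply: contraNT; rewrite -ltnNge /= => kj.
  have jk : (j < k)%N by rewrite ltn_sub2lE in kj.
  rewrite Llow; last exact: ltnW.
  by rewrite -(inj_eq val_inj) (ltn_eqF jk).
- by move=> k; rewrite Llow// eqxx oner_eq0.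
Qed.

End LebesgueMeasure.

(** * Complex integrals over intervals *)

Section IntervalIntegral.
Context {R : realType}.

Lemma nbhs_realP (x : R) (A : set R) :
  nbhs x A <-> exists2 d : R, 0 < d & forall y, `|y - x| < d -> A y.
Proof.
split.
  move=> /nbhs_ballP[d /= d0 dA]; exists d => // y yx; apply: dA.
  by rewrite -ball_normE /= distrC.
move=> [d d0 dA]; apply/nbhs_ballP; exists d => // y.
by rewrite -ball_normE /= distrC; exact: dA.
Qed.

Lemma continuous_mulR (f g : R -> R) : continuous f -> continuous g ->
  continuous (fun x => f x * g x).
Proof. by move=> cf cg x; apply: continuousM; [exact: cf|exact: cg]. Qed.

Lemma continuous_addR (f g : R -> R) : continuous f -> continuous g ->
  continuous (fun x => f x + g x).
Proof. by move=> cf cg x; apply: continuousD; [exact: cf|exact: cg]. Qed.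

Lemma continuous_subR (f g : R -> R) : continuous f -> continuous g ->
  continuous (fun x => f x - g x).
Proof. by move=> cf cg x; apply: continuousB; [exact: cf|exact: cg]. Qed.

Lemma continuous_cstR (z : R) : continuous (fun _ : R => z).
Proof. by move=> x; exact: cvg_cst. Qed.

Lemma continuous_idR : continuous (fun x : R => x).
Proof. by move=> x; exact: cvg_id. Qed.

Lemma continuous_compR (f g : R -> R) : continuous f -> continuous g ->
  continuous (fun x => f (g x)).
Proof. by move=> cf cg x; apply: continuous_comp; [exact: cg|exact: cf]. Qed.

Lemma is_derive_eps (f : R -> R) (x df : R) : is_derive x 1 f df ->
  forall e : R, 0 < e -> exists2 d : R, 0 < d & forall h : R, `|h| < d ->
    `|f (x + h) - f x - df * h| <= e * `|h|.
Proof.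
move=> [dfx dfE] e e0; have fx := dfx.
move/derivable1_diffP: fx => fx.
have dE h : 'd f x h = df * h.
  rewrite -[h in LHS]mulr1 -[h * 1]/(h *: 1) linearZ /= -deriveE// dfE.
  by rewrite mulrC.
have /eqaddoP /(_ e e0) /nbhs_realP[d d0 dP] := diff_locally fx.
exists d => // h hd; have /= := dP h; rewrite subr0 => /(_ hd).
by rewrite !fctE dE opprD addrA [h + x]addrC.
Qed.

Lemma eps_is_derive (f : R -> R) (x df : R) :
  (forall e : R, 0 < e -> exists2 d : R, 0 < d & forall h : R, `|h| < d ->
    `|f (x + h) - f x - df * h| <= e * `|h|) -> is_derive x 1 f df.
Proof.
move=> H.
pose A : R -> R := fun h => h *: df.
have linA : linear A by move=> a u v; rewrite /A scalerDl scalerA.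
pose AL : {linear R -> R} := HB.pack A (GRing.isLinear.Build _ _ _ _ A linA).
have cA : continuous AL by move=> y; apply: continuousZl; exact: cvg_id.
have E : f \o shift x = cst (f x) + AL +o_0 id.
  apply/eqaddoP => e e0; have [d d0 dP] := H e e0.
  apply/nbhs_realP; exists d => // h; rewrite subr0 => /dP.
  by rewrite /= !fctE opprD addrA [h + x]addrC /A /= -[h *: df]/(h * df) [h * df]mulrC.
have dE := diff_unique cA E.
have dfx : differentiable f x by apply/diff_locallyP; rewrite dE.
have D : derivable f x 1 by exact: diff_derivable.
have := derivableP D.
have -> : 'D_1 f x = df by rewrite deriveE// dE; exact: mul1r.
by [].
Qed.
Local Notation C := R[i].
Local Notation mu := (@lebesgue_measure R).
Implicit Types (h g : R -> C) (a b c : R).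

Lemma continuous_RCP h x : {for x, continuous h} <->
  forall e : R, 0 < e ->
    exists2 d : R, 0 < d & forall y, `|y - x| < d -> cn (h y - h x) < e.
Proof.
split.
  move=> ch e e0.
  have /nbhs_ballP[d /= d0 dP] := ch [set y | nrm (y - h x) < e] (proj2 (nbhs_nrmP _ _) (ex_intro2 _ _ e e0 (fun _ H => H))).
  exists d => // y yx; rewrite -nrmc; apply: dP.
  by rewrite -ball_normE /= distrC.
move=> H A /nbhs_nrmP[e e0 eA]; have [d d0 dA] := H e e0.
apply/nbhs_ballP; exists d => //= y; rewrite -ball_normE /= distrC => /dA yA.
by apply: eA; rewrite nrmc.
Qed.

Lemma continuous_cRe h : continuous h -> continuous (fun x => Re (h x)).
Proof.
move=> ch x; apply/cvgrPdist_lt => e e0.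
have N : nbhs x [set y | nrm (h y - h x) < e].
  by apply: (ch x [set w | nrm (w - h x) < e]); apply/nbhs_nrmP; exists e.
apply: filterS N => y /=; apply: le_lt_trans.
by rewrite -cReB nrmc cn_distC; exact: ler_Re_cn.
Qed.

Lemma continuous_cIm h : continuous h -> continuous (fun x => Im (h x)).
Proof.
move=> ch x; apply/cvgrPdist_lt => e e0.
have N : nbhs x [set y | nrm (h y - h x) < e].
  by apply: (ch x [set w | nrm (w - h x) < e]); apply/nbhs_nrmP; exists e.
apply: filterS N => y /=; apply: le_lt_trans.
by rewrite -cImB nrmc cn_distC; exact: ler_Im_cn.
Qed.

Lemma integrable_itv (f : R -> R) a b : continuous f ->
  mu.-integrable `[a, b] (EFin \o f).
Proof.
move=> cf; apply: continuous_compact_integrable; first exact: segment_compact.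
exact: continuous_subspaceT.
Qed.

Definition cint a b h : C :=
  (\int[mu]_(x in `[a, b]) Re (h x)) +i*
  (\int[mu]_(x in `[a, b]) Im (h x)).

Lemma eq_cint a b h g : (forall x, a <= x <= b -> h x = g x) ->
  cint a b h = cint a b g.
Proof.
by move=> H; congr (_ +i* _); apply: eq_Rintegral => x; rewrite inE /= in_itv /= => /H ->.
Qed.

Lemma Rintegral_itv_cst a b (r : R) : a <= b ->
  \int[mu]_(x in `[a, b]) r = (b - a) * r.
Proof.
move=> ab; rewrite Rintegral_cst// mulrC.
have E : lebesgue_measure (`[a, b]%classic : set R) = (b - a)%:E.
  rewrite lebesgue_measure_itv /= lte_fin.
  by move: ab; rewrite le_eqVlt => /orP[/eqP ->|->//]; rewrite ltxx subrr.
by congr (_ * _); exact: (congr1 fine E).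
Qed.

Lemma cint_cst a b (z : C) : a <= b -> cint a b (fun=> z) = (b - a)%:C * z.
Proof.
move=> ab; rewrite /cint !Rintegral_itv_cst//.
by apply: complex_ext; rewrite ?cReM ?cImM /= mul0r ?subr0 ?addr0.
Qed.

Lemma continuous_cst_RC (z : C) : continuous (fun _ : R => z).
Proof. by move=> x; exact: cvg_cst. Qed.

Lemma continuous_sub_RC h g : continuous h -> continuous g ->
  continuous (fun x => h x - g x).
Proof. by move=> ch cg x; apply: continuousB; [exact: ch|exact: cg]. Qed.

Lemma continuous_mul_RC h g : continuous h -> continuous g ->
  continuous (fun x => h x * g x).
Proof. by move=> ch cg x; apply: continuousM; [exact: ch|exact: cg]. Qed.

Lemma cintD a b h g : continuous h -> continuous g ->
  cint a b (fun x => h x + g x) = cint a b h + cint a b g.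
Proof.
move=> ch cg; apply: complex_ext; rewrite ?cReD ?cImD /= -RintegralD//;
  try (apply: integrable_itv; by [exact: continuous_cRe|exact: continuous_cIm]).
  by apply: eq_Rintegral => x _; rewrite cReD.
by apply: eq_Rintegral => x _; rewrite cImD.
Qed.

Lemma cintZ a b (z : C) h : continuous h ->
  cint a b (fun x => z * h x) = z * cint a b h.
Proof.
move=> ch; have cR := continuous_cRe ch; have cI := continuous_cIm ch.
apply: complex_ext; rewrite ?cReM ?cImM /= -!RintegralZl//;
  try by apply: integrable_itv.
  rewrite -RintegralB//; try by apply: integrable_itv; apply: continuous_mulR => //; exact: continuous_cstR.
  by apply: eq_Rintegral => x _; rewrite cReM.
rewrite -RintegralD//; try by apply: integrable_itv; apply: continuous_mulR => //; exact: continuous_cstR.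
by apply: eq_Rintegral => x _; rewrite cImM.
Qed.

Lemma cintB a b h g : continuous h -> continuous g ->
  cint a b (fun x => h x - g x) = cint a b h - cint a b g.
Proof.
move=> ch cg.
have cg' : continuous (fun x => -1 * g x).
  exact: (continuous_mul_RC (@continuous_cst_RC (-1)) cg).
have -> : (fun x => h x - g x) = (fun x => h x + -1 * g x).
  by apply/funext => x; rewrite mulN1r.
by rewrite (cintD a b ch cg') (cintZ a b (-1) cg) mulN1r.
Qed.

Lemma Rintegral_itv_split (f : R -> R) a b c : continuous f -> a <= b -> b <= c ->
  \int[mu]_(x in `[a, c]) f x =
  \int[mu]_(x in `[a, b]) f x + \int[mu]_(x in `[b, c]) f x.
Proof.
move=> cf ab bc.
have := @Rintegral_itvB R f (BLeft a) (BRight c) b (integrable_itv a c cf).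
rewrite !bnd_simp => /(_ ab bc) /eqP; rewrite subr_eq => /eqP ->.
rewrite addrC; congr (_ + _).
rewrite Rintegral_itv_obnd_cbnd//.
apply: integrableS (integrable_itv b c cf) => //.
by move=> x /=; rewrite !in_itv /= => /andP[/ltW -> ->].
Qed.

Lemma cint_split a b c h : continuous h -> a <= b -> b <= c ->
  cint a c h = cint a b h + cint b c h.
Proof.
move=> ch ab bc.
by rewrite /cint (Rintegral_itv_split (continuous_cRe ch) ab bc) (Rintegral_itv_split (continuous_cIm ch) ab bc).
Qed.

Lemma Rintegral_itv_bound (f : R -> R) a b M : continuous f -> a <= b ->
  (forall x, a <= x <= b -> `|f x| <= M) ->
  `|\int[mu]_(x in `[a, b]) f x| <= (b - a) * M.
Proof.
move=> cf ab H; apply: le_trans (le_normr_Rintegral _ (integrable_itv a b cf)) _ => //.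
rewrite -Rintegral_itv_cst//; apply: le_Rintegral => //.
- by apply: integrable_itv => x; apply: continuous_comp; [exact: cf|exact: norm_continuous].
- by apply: integrable_itv => x; exact: cvg_cst.
Qed.

(** The factor 2 is the price of estimating real and imaginary parts separately; it is harmless, as
    only the order of magnitude matters afterwards. *)
Lemma cint_bound a b h M : continuous h -> a <= b ->
  (forall x, a <= x <= b -> cn (h x) <= M) ->
  cn (cint a b h) <= 2 * (b - a) * M.
Proof.
move=> ch ab H; apply: le_trans (ler_cn_ReIm _) _.
rewrite -mulrA mulrDl mul1r; apply: lerD => /=.
  apply: Rintegral_itv_bound => //; first exact: continuous_cRe.
  by move=> x /H; apply: le_trans; exact: ler_Re_cn.
apply: Rintegral_itv_bound => //; first exact: continuous_cIm.
by move=> x /H; apply: le_trans; exact: ler_Im_cn.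
Qed.

(** Meant for derivatives depending on a parameter, which are uniform limits of difference
    quotients. *)
Lemma continuous_uniform_limit h :
  (forall e : R, 0 < e -> exists2 g, continuous g & forall x, cn (h x - g x) <= e) ->
  continuous h.
Proof.
move=> H x; apply/continuous_RCP => e e0.
have [|g cg hg] := H (e / 4); first by rewrite divr_gt0.
have /continuous_RCP/(_ (e / 4))[|d d0 dP] := cg x; first by rewrite divr_gt0.
exists d => // y /dP gyx.
have -> : h y - h x = (h y - g y) + ((g y - g x) + (g x - h x)) by ring.
have := ler_cnD (h y - g y) ((g y - g x) + (g x - h x)).
have := ler_cnD (g y - g x) (g x - h x).
have := hg y; have := hg x; rewrite (cn_distC (h x)) => ? ? ? ?; lra.
Qed.

End IntervalIntegral.

(** * Goursat's theorem on rectangles *)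

Section Goursat.
Context {R : realType}.
Local Notation C := R[i].
Variable G : R -> R -> C.
Hypothesis Gt : forall s, continuous (fun t => G t s).
Hypothesis Gs : forall t, continuous (G t).

(* With z = t + i s, this is complex differentiability of G with derivative l. *)
Definition cdiff2 t0 s0 l := forall e : R, 0 < e -> exists2 d : R, 0 < d &
  forall t s, `|t - t0| < d -> `|s - s0| < d ->
    cn (G t s - G t0 s0 - l * ((t - t0) +i* (s - s0))) <= e * (`|t - t0| + `|s - s0|).

(* The contour integral of -i G over the boundary of [t1, t2] x [s1, s2]. *)
Definition rint t1 t2 s1 s2 : C :=
  cint s1 s2 (fun s => G t2 s - G t1 s) + 'i%C * cint t1 t2 (fun t => G t s2 - G t s1).

Lemma rint_splitl t1 tm t2 s1 s2 : t1 <= tm -> tm <= t2 ->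
  rint t1 t2 s1 s2 = rint t1 tm s1 s2 + rint tm t2 s1 s2.
Proof.
move=> h1 h2; rewrite /rint (cint_split _ h1 h2); last first.
  by move=> x; apply: continuousB; exact: Gt.
rewrite mulrDr addrACA; congr (_ + _).
rewrite -cintD; try by move=> x; apply: continuousB; exact: Gs.
by apply: eq_cint => x _; ring.
Qed.

Lemma rint_splitr t1 t2 s1 sm s2 : s1 <= sm -> sm <= s2 ->
  rint t1 t2 s1 s2 = rint t1 t2 s1 sm + rint t1 t2 sm s2.
Proof.
move=> h1 h2; rewrite /rint (cint_split _ h1 h2); last first.
  by move=> x; apply: continuousB; exact: Gs.
rewrite [in RHS]addrACA -mulrDr; congr (_ + 'i%C * _).
rewrite -cintD; try by move=> x; apply: continuousB; exact: Gt.
by apply: eq_cint => x _; ring.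
Qed.

(** The affine part of G integrates to 0: its slope contributes l (t2 - t1)(s2 - s1) to the vertical
    edges and, because i^2 = -1, the opposite to the horizontal ones. Only the error of order e
    remains. *)
Lemma rint_small t0 s0 l e d t1 t2 s1 s2 :
  0 <= e ->
  (forall t s, `|t - t0| < d -> `|s - s0| < d ->
    cn (G t s - G t0 s0 - l * ((t - t0) +i* (s - s0))) <= e * (`|t - t0| + `|s - s0|)) ->
  t1 <= t0 <= t2 -> s1 <= s0 <= s2 -> t2 - t1 < d -> s2 - s1 < d ->
  cn (rint t1 t2 s1 s2) <= 4 * e * ((t2 - t1) + (s2 - s1)) ^+ 2.
Proof.
move=> e0 H /andP[t10 t02] /andP[s10 s02] td sd.
set D := (t2 - t1) + (s2 - s1).
have D0 : 0 <= D by rewrite /D; lra.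
have H' t s : t1 <= t <= t2 -> s1 <= s <= s2 ->
    cn (G t s - G t0 s0 - l * ((t - t0) +i* (s - s0))) <= e * D.
  move=> /andP[ht1 ht2] /andP[hs1 hs2].
  have a1 : `|t - t0| <= t2 - t1 by rewrite ler_norml; apply/andP; split; lra.
  have a2 : `|s - s0| <= s2 - s1 by rewrite ler_norml; apply/andP; split; lra.
  apply: le_trans (H t s _ _) _; try lra.
  by rewrite ler_wpM2l// lerD.
have H2 t s t' s' : t1 <= t <= t2 -> s1 <= s <= s2 -> t1 <= t' <= t2 -> s1 <= s' <= s2 ->
    cn (G t s - G t' s' - l * ((t - t') +i* (s - s'))) <= 2 * e * D.
  move=> h1 h2 h3 h4.
  have -> : G t s - G t' s' - l * ((t - t') +i* (s - s')) =
    (G t s - G t0 s0 - l * ((t - t0) +i* (s - s0))) -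
    (G t' s' - G t0 s0 - l * ((t' - t0) +i* (s' - s0))).
    have -> : (t - t') +i* (s - s') = ((t - t0) +i* (s - s0)) - ((t' - t0) +i* (s' - s0)).
      by apply: complex_ext; rewrite ?cReB ?cImB /=; ring.
    by ring.
  apply: le_trans (ler_cnB _ _) _.
  by have := H' _ _ h1 h2; have := H' _ _ h3 h4 => ? ?; lra.
have t12 : t1 <= t2 by lra.
have s12 : s1 <= s2 by lra.
pose A := cint s1 s2 (fun s => G t2 s - G t1 s - l * (t2 - t1)%:C).
pose B := cint t1 t2 (fun t => G t s2 - G t s1 - l * ('i%C * (s2 - s1)%:C)).
have -> : rint t1 t2 s1 s2 = A + 'i%C * B.
  rewrite /rint /A /B !cintB; try by [move=> x; apply: cvg_cst|apply: Gs|apply: Gt|move=> x; apply: continuousB; apply: Gs|move=> x; apply: continuousB; apply: Gt].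
  rewrite !cint_cst//.
  have ii := sqr_i R.
  rewrite (_ : 'i%C * (_ - _ - _) = 'i%C * (cint t1 t2 (G^~ s2) - cint t1 t2 (G^~ s1)) - 'i%C ^+ 2 * ((t2 - t1)%:C * (l * (s2 - s1)%:C))); last by ring.
  by rewrite ii; ring.
have EA : cn A <= 2 * (s2 - s1) * (2 * e * D).
  apply: cint_bound => //.
    exact: (continuous_sub_RC (continuous_sub_RC (@Gs t2) (@Gs t1)) (@continuous_cst_RC _ _)).
  move=> s hs; have := H2 t2 s t1 s; rewrite subrr; apply => //; lra.
have EB : cn B <= 2 * (t2 - t1) * (2 * e * D).
  apply: cint_bound => //.
    exact: (continuous_sub_RC (continuous_sub_RC (@Gt s2) (@Gt s1)) (@continuous_cst_RC _ _)).
  move=> t ht; have := H2 t s2 t s1; rewrite subrr.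
  have -> : (0 +i* (s2 - s1)) = 'i%C * (s2 - s1)%:C.
    by apply: complex_ext; rewrite ?cReM ?cImM /=; ring.
  by apply => //; lra.
apply: le_trans (ler_cnD _ _) _; rewrite Normc.normcM cn_i mul1r.
apply: le_trans (lerD EA EB) _.
by apply: le_of_eq; rewrite /D; ring.
Qed.

(** Bisection: one of the four quarters carries at least a quarter of the modulus. The nested
    rectangles shrink to a point, where the quadratic bound of [rint_small] compensates the factor
    4^n. *)
Lemma goursat a b c d : a <= b -> c <= d ->
  (forall t s, a <= t <= b -> c <= s <= d -> exists l, cdiff2 t s l) ->
  rint a b c d = 0.
Proof.
move=> ab cd H.
set X := b - a; set Y := d - c.
have X0 : 0 <= X by rewrite /X; lra.
have Y0 : 0 <= Y by rewrite /Y; lra.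
pose u n : R := 2^-1 ^+ n.
have u0 n : 0 < u n by rewrite exprn_gt0.
have uS n : u n = 2 * u n.+1 by rewrite /u exprS mulrA divff// mul1r.
(* A rectangle of generation n is determined by its lower left corner p. *)
pose Q n (p : R * R) := rint p.1 (p.1 + X * u n) p.2 (p.2 + Y * u n).
have step n p : exists p' : R * R, [/\ cn (Q n p) <= 4 * cn (Q n.+1 p'),
   p.1 <= p'.1 /\ p'.1 + X * u n.+1 <= p.1 + X * u n &
   p.2 <= p'.2 /\ p'.2 + Y * u n.+1 <= p.2 + Y * u n].
  have xu := mulr_ge0 X0 (ltW (u0 n.+1)).
  have yu := mulr_ge0 Y0 (ltW (u0 n.+1)).
  pose p1 := (p.1, p.2); pose p2 := (p.1 + X * u n.+1, p.2).
  pose p3 := (p.1, p.2 + Y * u n.+1); pose p4 := (p.1 + X * u n.+1, p.2 + Y * u n.+1).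
  have E : Q n p = (Q n.+1 p1 + Q n.+1 p3) + (Q n.+1 p2 + Q n.+1 p4).
    have A1 : p.1 <= p.1 + X * u n.+1 by lra.
    have A2 : p.1 + X * u n.+1 <= p.1 + X * (2 * u n.+1) by lra.
    have B1 : p.2 <= p.2 + Y * u n.+1 by lra.
    have B2 : p.2 + Y * u n.+1 <= p.2 + Y * (2 * u n.+1) by lra.
    rewrite /Q /= uS (rint_splitl _ _ A1 A2) !(rint_splitr _ _ B1 B2).
    by congr (rint _ _ _ _ + rint _ _ _ _ + (rint _ _ _ _ + rint _ _ _ _)); ring.
  have A0 : p.1 + X * u n.+1 + X * u n.+1 = p.1 + X * u n by rewrite (uS n); ring.
  have B0 : p.2 + Y * u n.+1 + Y * u n.+1 = p.2 + Y * u n by rewrite (uS n); ring.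
  have A1 : p.1 <= p.1 + X * u n.+1 by rewrite lerDl.
  have B1 : p.2 <= p.2 + Y * u n.+1 by rewrite lerDl.
  have A2 : p.1 + X * u n.+1 <= p.1 + X * u n by rewrite -A0 lerDl.
  have B2 : p.2 + Y * u n.+1 <= p.2 + Y * u n by rewrite -B0 lerDl.
  have A3 : p.1 + X * u n.+1 + X * u n.+1 <= p.1 + X * u n by rewrite A0.
  have B3 : p.2 + Y * u n.+1 + Y * u n.+1 <= p.2 + Y * u n by rewrite B0.
  have B : cn (Q n p) <= cn (Q n.+1 p1) + cn (Q n.+1 p3) + (cn (Q n.+1 p2) + cn (Q n.+1 p4)).
    by rewrite E (le_trans (ler_cnD _ _))// lerD// ler_cnD.
  have [h1|h1] := leP (cn (Q n p)) (4 * cn (Q n.+1 p1)); first by exists p1.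
  have [h2|h2] := leP (cn (Q n p)) (4 * cn (Q n.+1 p2)); first by exists p2.
  have [h3|h3] := leP (cn (Q n p)) (4 * cn (Q n.+1 p3)); first by exists p3.
  have [h4|h4] := leP (cn (Q n p)) (4 * cn (Q n.+1 p4)); first by exists p4.
  exfalso; move: B h1 h2 h3 h4; clear.
  move: (cn _) (cn _) (cn _) (cn _) (cn _) => v w x y z *.
  lra.
pose nx n p := sval (cid (step n p)).
have nxP n p : [/\ cn (Q n p) <= 4 * cn (Q n.+1 (nx n p)),
   p.1 <= (nx n p).1 /\ (nx n p).1 + X * u n.+1 <= p.1 + X * u n &
   p.2 <= (nx n p).2 /\ (nx n p).2 + Y * u n.+1 <= p.2 + Y * u n].
  exact: (svalP (cid (step n p))).
pose P := fix P n := if n is m.+1 then nx m (P m) else (a, c).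
have Qn n : cn (rint a b c d) <= 4 ^+ n * cn (Q n (P n)).
  elim: n => [|n IH].
    rewrite expr0 mul1r /Q /= /u expr0 !mulr1 /X /Y.
    by rewrite (addrC a) subrK (addrC c) subrK.
  apply: le_trans IH _; have [h _ _] := nxP n (P n).
  by rewrite exprSr -mulrA ler_wpM2l// exprn_ge0.
(* Nested intervals: the supremum of the left ends lies in all of them. *)
have mon (z : nat -> R) (w : R) : 0 <= w ->
    (forall n, z n <= z n.+1 /\ z n.+1 + w * u n.+1 <= z n + w * u n) ->
    exists x, forall n, z n <= x <= z n + w * u n.
  move=> w0 zS.
  have z1 n k : z n <= z (n + k)%N.
    by elim: k => [|k IH]; rewrite ?addn0// addnS (le_trans IH)//; exact: (zS _).1.
  have z2 n k : z (n + k)%N + w * u (n + k)%N <= z n + w * u n.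
    by elim: k => [|k IH]; rewrite ?addn0// addnS (le_trans _ IH)//; exact: (zS _).2.
  have zz n m : z m <= z n + w * u n.
    apply: le_trans (z2 n m); apply: le_trans (_ : z m <= z (n + m)%N) _.
      by rewrite addnC.
    by rewrite lerDl mulr_ge0// ltW.
  exists (sup (range z)) => n; apply/andP; split.
    apply: ub_le_sup; last by exists n.
    by exists (z 0%N + w * u 0%N) => _ [m _ <-].
  apply: ge_sup; first by exists (z 0%N); exists 0%N.
  by move=> _ [m _ <-].
have [x xP] : exists x, forall n, (P n).1 <= x <= (P n).1 + X * u n.
  by apply: mon => // n /=; have [_ h _] := nxP n (P n).
have [y yP] : exists y, forall n, (P n).2 <= y <= (P n).2 + Y * u n.
  by apply: mon => // n /=; have [_ _ h] := nxP n (P n).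
have [l lP] : exists l, cdiff2 x y l.
  apply: H; first by have := xP 0%N; rewrite /= /u expr0 mulr1 /X; lra.
  by have := yP 0%N; rewrite /= /u expr0 mulr1 /Y; lra.
have small : forall e, 0 < e -> cn (rint a b c d) <= e * (4 * (X + Y) ^+ 2).
  move=> e e0; have [dl d0 dP] := lP e e0.
  have [n [nX nY]] : exists n, X * u n < dl /\ Y * u n < dl.
    have [N] : exists N : nat, (X + Y) / dl < N%:R.
      by exists (Num.trunc ((X + Y) / dl)).+1; exact: truncnS_gt.
    rewrite ltr_pdivrMr// => hN.
    have uN : u N * N%:R <= 1.
      have : N%:R <= (2 : R) ^+ N by rewrite -natrX ler_nat ltnW// ltn_expl.
      by rewrite /u exprVn mulrC ler_pdivrMr ?exprn_gt0// mul1r.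
    exists N; have h := u0 N.
    have : (X + Y) * u N < dl.
      apply: (@lt_le_trans _ _ (N%:R * dl * u N)); first by rewrite ltr_pM2r.
      by rewrite mulrAC (mulrC N%:R) ler_piMl// ltW.
    rewrite mulrDl; have := mulr_ge0 X0 (ltW h); have := mulr_ge0 Y0 (ltW h) => ? ? ?.
    by split; lra.
  apply: le_trans (Qn n) _.
  have := @rint_small x y l e dl (P n).1 ((P n).1 + X * u n) (P n).2 ((P n).2 + Y * u n) (ltW e0) dP (xP n) (yP n).
  rewrite -/(Q n (P n)) [_ + X * u n]addrC [_ + Y * u n]addrC !addrK => /(_ nX nY) h.
  apply: (@le_trans _ _ (4 ^+ n * (4 * e * (X * u n + Y * u n) ^+ 2))).
    by rewrite ler_wpM2l ?exprn_ge0.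
  have E : 4 ^+ n * (u n) ^+ 2 = 1.
    by rewrite /u -exprM mulnC exprM -exprMn (_ : 4 * _ = 1) ?expr1n//; field.
  apply: le_of_eq.
  transitivity (4 * e * (X + Y) ^+ 2 * (4 ^+ n * (u n) ^+ 2)); first by ring.
  by rewrite E; ring.
apply/eqP; rewrite -cn_eq0 eq_le cn_ge0 andbT.
have K0 : 0 <= 4 * (X + Y) ^+ 2 by rewrite mulr_ge0// sqr_ge0.
apply/ler_addgt0Pr => e e0; rewrite add0r.
apply: le_trans (small (e / (4 * (X + Y) ^+ 2 + 1)) _) _.
  by rewrite divr_gt0// ltr_wpDl.
rewrite -mulrA; apply: ler_piMr; first exact: ltW.
by rewrite mulrC ler_pdivrMr ?ltr_wpDl// mul1r lerDl.
Qed.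

End Goursat.

(** * Cauchy's formula on circles *)

Section CircleFormula.
Context {R : realType}.
Local Notation C := R[i].

(** The exponential of t + i s, used as logarithmic polar coordinates on the punctured plane. *)
Definition cexp (t s : R) : C := (expR t * cos s) +i* (expR t * sin s).

Lemma cexpD t s t' s' : cexp (t + t') (s + s') = cexp t s * cexp t' s'.
Proof.
by apply: complex_ext; rewrite ?cReM ?cImM /= expRD ?cosD ?sinD; ring.
Qed.

Lemma cn_cexp t s : cn (cexp t s) = expR t.
Proof.
apply/eqP; rewrite -(eqrXn2 (n := 2))// ?cn_ge0// ?expR_ge0//.
by rewrite cn_sqr /= !exprMn -mulrDr cos2Dsin2 mulr1.
Qed.

Lemma cexp2pi t : cexp t (2 * pi) = cexp t 0.
Proof.
by rewrite /cexp mulr_natl cos2pi sin2pi cos0 sin0.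
Qed.

Lemma cexp_neq0 t s : cexp t s != 0.
Proof. by rewrite -cn_gt0 cn_cexp expR_gt0. Qed.

Lemma conj_cexp s : conjc (cexp 0 s) = (cexp 0 s)^-1.
Proof.
apply: (mulfI (cexp_neq0 0 s)); rewrite mulfV ?cexp_neq0//.
apply: complex_ext; rewrite ?cReM ?cImM /= expR0 !mul1r; last by ring.
by rewrite mulrN opprK -!expr2 cos2Dsin2.
Qed.

Lemma cexp_small (e : R) : 0 < e -> exists2 d : R, 0 < d & forall t s : R, `|t| < d -> `|s| < d ->
  cn (cexp t s - 1 - (t +i* s)) <= e * (`|t| + `|s|).
Proof.
move=> e0.
(* The divisor 10 leaves room for the coefficients 1 of |t| and 3 + 3 + 2 of |s| that are collected
   below. *)
have [ee ee0 [ee1 eee]] : exists2 ee : R, 0 < ee & ee <= 1 /\ 10 * ee <= e.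
  exists (minr 1 (e / 10)); first by rewrite lt_min ltr01 divr_gt0.
  by split; rewrite ?ge_min ?lexx// mulrC -ler_pdivlMr// ge_min lexx orbT.
have [d1 d10 H1] := is_derive_eps (is_derive_expR 0) ee0.
have [d2 d20 H2] := is_derive_eps (is_derive_cos 0) ee0.
have [d3 d30 H3] := is_derive_eps (is_derive_sin 0) ee0.
exists (minr ee (minr d1 (minr d2 d3))); first by rewrite !lt_min ee0 d10 d20 d30.
move=> t s; rewrite !lt_min => /and4P[t0 t1 t2 t3] /and4P[s0 s1 s2 s3].
have := H1 t t1; have := H2 s s2; have := H3 s s3.
rewrite !add0r expR0 cos0 sin0 oppr0 mul0r !mul1r !subr0 !addr0.
set c := cos s - 1; set p := sin s - s; set q := expR t - 1 - t.
move=> hp hc hq.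
apply: le_trans (ler_cn_ReIm _) _; rewrite !cReB !cImB /=.
have -> : expR t * cos s - 1 - t = q + c * (1 + t + q) by rewrite /q /c; ring.
have -> : expR t * sin s - 0 - s = p * (1 + t + q) + s * (t + q) by rewrite /q /p; ring.
have t1' : `|t| <= 1 by apply: le_trans (ltW t0) ee1.
have tq : `|t + q| <= 2 * `|t|.
  apply: le_trans (ler_normD _ _) _; have := ler_wpM2r (normr_ge0 t) ee1; lra.
have q1 : `|1 + t + q| <= 3.
  rewrite -addrA; apply: le_trans (ler_normD _ _) _; rewrite normr1; lra.
have X1 : `|q + c * (1 + t + q)| <= ee * `|t| + ee * `|s| * 3.
  apply: le_trans (ler_normD _ _) _; apply: lerD => //.
  by rewrite normrM; apply: ler_pM.
have X2 : `|p * (1 + t + q) + s * (t + q)| <= ee * `|s| * 3 + `|s| * (2 * ee).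
  apply: le_trans (ler_normD _ _) _; apply: lerD.
    by rewrite normrM; apply: ler_pM.
  rewrite normrM ler_wpM2l//; apply: le_trans tq _; rewrite ler_wpM2l//; exact: ltW.
have := ler_wpM2r (normr_ge0 t) eee; have := ler_wpM2r (normr_ge0 s) eee.
have := mulr_ge0 (ltW ee0) (normr_ge0 t); have := mulr_ge0 (ltW ee0) (normr_ge0 s).
by move=> ? ? ? ?; lra.
Qed.

Lemma continuous_ReIm (h : R -> C) : continuous (fun x => Re (h x)) ->
  continuous (fun x => Im (h x)) -> continuous h.
Proof.
move=> cR cI x A /nbhs_nrmP[e e0 eA].
have e20 : 0 < e / 2 by rewrite divr_gt0.
have N1 : nbhs x [set y | `|Re (h x) - Re (h y)| < e / 2].
  by have /cvgrPdist_lt := cR x; apply.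
have N2 : nbhs x [set y | `|Im (h x) - Im (h y)| < e / 2].
  by have /cvgrPdist_lt := cI x; apply.
apply: filterS (filterI N1 N2) => y /= [h1 h2]; apply: eA.
rewrite nrmc cn_distC (le_lt_trans (ler_cn_ReIm _))// cReB cImB.
by rewrite (splitr e) ltrD.
Qed.

Lemma continuous_cexp (p q : R -> R) : continuous p -> continuous q ->
  continuous (fun x => cexp (p x) (q x)).
Proof.
move=> cp cq; apply: continuous_ReIm => /=.
  apply: continuous_mulR; first exact: (continuous_compR (@continuous_expR R) cp).
  exact: (continuous_compR (@continuous_cos R) cq).
apply: continuous_mulR; first exact: (continuous_compR (@continuous_expR R) cp).
exact: (continuous_compR (@continuous_sin R) cq).
Qed.

(** Chain rule, the exponential being its own derivative. The function k is the identity near t0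
    only, which leaves room to clip t elsewhere. *)
Lemma cdiff2_cexp (g : C -> C) t0 s0 A (k : R -> R) (r : R) : 0 < r ->
  (forall t, `|t - t0| < r -> k t = t) -> hasD g (cexp t0 s0) A ->
  cdiff2 (fun t s => g (cexp (k t) s)) t0 s0 (A 1 * cexp t0 s0).
Proof.
move=> r0 kt HA e e0; have [_ _ H] := HA.
have Al h : A h = A 1 * h by rewrite mulrC -(hasDZc _ _ HA); congr A; exact: esym (mulr1 h).
move: (A 1) Al => l Al.
set w := cexp t0 s0; set W := cn w.
have W0 : 0 < W by rewrite /W cn_cexp expR_gt0.
have [d1 d10 H1] := H (e / (4 * W)) (divr_gt0 e0 (mulr_gt0 (ltr0n _ 4) W0)).
rewrite -/w in H1.
have lW0 : 0 < 2 * (cn l * W + 1).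
  by rewrite mulr_gt0// ltr_wpDl// mulr_ge0 ?cn_ge0// ltW.
have e20 : 0 < minr 1 (e / (2 * (cn l * W + 1))) by rewrite lt_min ltr01 divr_gt0.
have [d2 d20 H2] := cexp_small e20; set e2 := minr _ _ in e20 H2.
have e21 : e2 <= 1 by rewrite ge_min lexx.
have e2e : e2 * (2 * (cn l * W + 1)) <= e by rewrite -ler_pdivlMr// ge_min lexx orbT.
have d40 : 0 < d1 / (4 * W) by rewrite divr_gt0// mulr_gt0.
exists (minr r (minr d2 (d1 / (4 * W)))); first by rewrite !lt_min r0 d20 d40.
move=> t s; rewrite !lt_min => /and3P[tr t2 t3] /and3P[_ s2 s3].
rewrite kt// (kt t0) ?subrr ?normr0//.
have := H2 _ _ t2 s2.
set D := (t - t0) +i* (s - s0); set S := `|t - t0| + `|s - s0|.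
set er := _ - 1 - D => her.
have S0 : 0 <= S by rewrite addr_ge0.
have DS : cn D <= S by apply: ler_cn_ReIm.
pose h := w * (D + er).
have wh : cexp t s = w + h.
  rewrite -{1}(subrK t0 t) -{1}(subrK s0 s) cexpD -/w /h /er; ring.
have hS : cn h <= 2 * W * S.
  rewrite Normc.normcM -/W [2 * W]mulrC -mulrA ler_wpM2l ?(ltW W0)//.
  apply: le_trans (ler_cnD _ _) _; have := ler_wpM2r S0 e21; lra.
have hd : cn h < d1.
  apply: le_lt_trans hS _.
  have : S < d1 / (4 * W) + d1 / (4 * W) by exact: ltrD.
  have -> : d1 / (4 * W) + d1 / (4 * W) = d1 / (2 * W) by field; rewrite gt_eqF.
  by rewrite ltr_pdivlMr ?mulr_gt0// mulrC.
have := H1 h; rewrite !nrmc Al -wh => /(_ hd) hg.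
have -> : g (cexp t s) - g w - l * w * D =
   (g (cexp t s) - g w - l * h) + l * w * er by rewrite /h; ring.
apply: le_trans (ler_cnD _ _) _; rewrite !Normc.normcM -/W.
have X1 : e / (4 * W) * cn h <= e / 2 * S.
  apply: (@le_trans _ _ (e / (4 * W) * (2 * W * S))).
    by rewrite ler_wpM2l// ltW// divr_gt0// mulr_gt0.
  by apply: le_of_eq; field; rewrite gt_eqF.
have lW : 0 <= cn l * W by rewrite mulr_ge0 ?cn_ge0// ltW.
have X2 : cn l * W * cn er <= e / 2 * S.
  apply: (@le_trans _ _ (cn l * W * (e2 * S))); first by rewrite ler_wpM2l.
  rewrite mulrA ler_wpM2r//; have := ltW e20; move: e2e lW; clear.
  move: (cn l * W) => a; nra.
by lra.
Qed.

Lemma circle_mean (g : C -> C) rho r : 0 < r -> r < rho ->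
  (forall w, 0 < cn w -> cn w < rho -> differentiable g w) ->
  (forall e : R, 0 < e -> exists2 d : R, 0 < d & forall w, cn w < d -> cn (g w - g 0) <= e) ->
  cint 0 (2 * pi) (fun s => g (r%:C * cexp 0 s)) = (2 * pi)%:C * g 0.
Proof.
move=> r0 rrho dg cg.
set m := (r + rho) / 2.
have rm : r < m by rewrite /m; lra.
have mrho : m < rho by rewrite /m; lra.
have m0 : 0 < m by lra.
pose T := ln m.
have eT : expR T = m by rewrite /T lnK.
(* k clips t at T, so that g (cexp (k t) s) is continuous on the whole plane. *)
pose k t := (t + T - `|t - T|) / 2.
have kT t : k t <= T.
  by rewrite /k; have := ler_norm (t - T); lra.
have kt t : t <= T -> k t = t.
  by move=> tT; rewrite /k ler0_norm ?subr_le0//; field.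
have ck : continuous k.
  apply: continuous_mulR; last exact: continuous_cstR.
  apply: continuous_subR.
    by apply: continuous_addR; [exact: continuous_idR|exact: continuous_cstR].
  apply: (continuous_compR (f := fun x => `|x|)); first exact: norm_continuous.
  by apply: continuous_subR; [exact: continuous_idR|exact: continuous_cstR].
pose G t s := g (cexp (k t) s).
have in_rho t s : 0 < cn (cexp (k t) s) < rho.
  rewrite cn_cexp expR_gt0 /=; apply: le_lt_trans mrho.
  by rewrite -eT ler_expR.
have ccomp (h : R -> C) : continuous h -> (forall x, 0 < cn (h x) < rho) -> continuous (fun x => g (h x)).
  move=> ch hx x; apply/continuous_RCP => e e0.
  have /andP[h1 h2] := hx x.
  have [d d0 dP] := hasD_continuous (diff_hasD (dg _ h1 h2)) e0.
  have /continuous_RCP/(_ d d0)[d' d'0 dP'] := ch x.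
  by exists d' => // y /dP' hy; rewrite -nrmc; apply: dP; rewrite nrmc.
have Gt s : continuous (fun t => G t s).
  apply: ccomp; last by move=> x; exact: in_rho.
  by apply: continuous_cexp => // x; exact: cvg_cst.
have Gs t : continuous (G t).
  apply: ccomp; last by move=> x; exact: in_rho.
  by apply: continuous_cexp => // x; [exact: cvg_cst|exact: cvg_id].
have pi0 : 0 <= 2 * pi :> R by rewrite mulr_ge0// pi_ge0.
pose t2 := ln r.
have et2 : expR t2 = r by rewrite /t2 lnK.
have t2T : t2 < T by rewrite -ltr_expR et2 eT.
have main t1 : t1 <= t2 -> cint 0 (2 * pi) (G t2) = cint 0 (2 * pi) (G t1).
  move=> t12.
  have := @goursat R G Gt Gs t1 t2 0 (2 * pi) t12 pi0.
  have -> : rint G t1 t2 0 (2 * pi) = cint 0 (2 * pi) (G t2) - cint 0 (2 * pi) (G t1).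
    rewrite /rint cintB//.
    have -> : cint t1 t2 (fun t => G t (2 * pi) - G t 0) = 0.
      rewrite (eq_cint (g := fun=> 0)); last by move=> t _; rewrite /G cexp2pi subrr.
      by rewrite cint_cst// mulr0.
    by rewrite mulr0 addr0.
  move=> H; apply/eqP; rewrite -subr_eq0; apply/eqP; apply: H.
  move=> t s /andP[_ tt2] _.
  have tT : t < T by apply: le_lt_trans t2T.
  have /andP[h1 h2] := in_rho t s; rewrite kt ?(ltW tT)// in h1 h2.
  have dgs := diff_hasD (dg _ h1 h2).
  eexists; apply: (@cdiff2_cexp _ _ _ _ _ (T - t) _ _ dgs).
    by rewrite subr_gt0.
  by move=> t' /ltr_normlW; rewrite ltrD2r => /ltW /kt.
have -> : cint 0 (2 * pi) (fun s => g (r%:C * cexp 0 s)) = cint 0 (2 * pi) (G t2).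
  apply: eq_cint => s _; rewrite /G kt ?(ltW t2T)//; congr g.
  by apply: complex_ext; rewrite ?cReM ?cImM /cexp /= expR0 et2; ring.
apply/eqP; rewrite -subr_eq0 -cn_eq0 eq_le cn_ge0 andbT.
apply/ler_addgt0Pr => e e0; rewrite add0r.
have p0 : 0 < 2 * (2 * pi) + 1 :> R by rewrite ltr_wpDl// mulr_ge0.
have [d d0 dP] := cg (e / (2 * (2 * pi) + 1)) (divr_gt0 e0 p0).
pose t1 := minr t2 (ln (d / 2)).
have t12 : t1 <= t2 by rewrite ge_min lexx.
rewrite (main _ t12) -[2 * pi in X in _ - X]subr0 -cint_cst// -cintB//; last first.
  exact: continuous_cst_RC.
apply: le_trans (cint_bound (M := e / (2 * (2 * pi) + 1)) _ pi0 _) _.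
- exact: (continuous_sub_RC (@Gs t1) (@continuous_cst_RC _ _)).
- move=> s _; apply: dP; rewrite cn_cexp kt; last by rewrite (le_trans t12)// ltW.
  apply: (@le_lt_trans _ _ (d / 2)); last by lra.
  rewrite -[leRHS]lnK; last by rewrite posrE divr_gt0.
  by rewrite ler_expR ge_min lexx orbT.
- rewrite subr0 mulrCA; apply: ler_piMr; first exact: ltW.
  by rewrite ler_pdivrMr// mul1r lerDl.
Qed.

Lemma cint_conj (a b : R) (h : R -> C) : continuous h ->
  cint a b (fun x => conjc (h x)) = conjc (cint a b h).
Proof.
move=> ch; rewrite /cint /=; congr (_ +i* _).
  by apply: eq_Rintegral => x _; case: (h x).
rewrite -mulN1r -RintegralZl//; last by apply: integrable_itv; exact: continuous_cIm.
by apply: eq_Rintegral => x _; rewrite mulN1r; case: (h x).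
Qed.

Lemma continuous_circle : continuous (fun s : R => cexp 0 s).
Proof. by apply: continuous_cexp; [exact: continuous_cstR|exact: continuous_idR]. Qed.

Lemma continuous_conj (h : R -> C) : continuous h -> continuous (fun x => conjc (h x)).
Proof.
move=> ch; apply: continuous_ReIm.
  have -> : (fun x => Re (conjc (h x))) = (fun x => Re (h x)).
    by apply/funext => x; case: (h x).
  exact: continuous_cRe.
have -> : (fun x => Im (conjc (h x))) = (fun x => 0 - Im (h x)).
  by apply/funext => x; rewrite sub0r; case: (h x).
by apply: continuous_subR; [exact: continuous_cstR|exact: continuous_cIm].
Qed.

Lemma cint_conj_circle : cint 0 (2 * pi) (fun s : R => conjc (cexp 0 s)) = 0.
Proof.
rewrite cint_conj; last exact: continuous_circle.
have := @circle_mean id 2 1 ltr01 (ltr1n _ 2).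
rewrite mulr0 (eq_cint (g := fun s => cexp 0 s)); last by move=> s _; rewrite mul1r.
move=> ->; first exact: conjc0.
  by move=> w _ _; apply/differentiable_hasD; eexists; exact: hasD_id.
by move=> e e0; exists e => // w /ltW; rewrite subr0.
Qed.

Variable n : nat.
Local Notation Cn := 'rV[C]_n.+1.

Lemma continuous_circle_comp (f : Cn -> C) z v (r rho : R) : 0 < r -> r < rho ->
  (forall w : C, cn w < rho -> differentiable f (z + w *: v)) ->
  continuous (fun s => f (z + (r%:C * cexp 0 s) *: v)).
Proof.
move=> r0 rrho df s0; apply/continuous_RCP => e e0.
have /df /differentiable_hasD[A HA] : cn (r%:C * cexp 0 s0) < rho.
  by rewrite Normc.normcM cn_cexp expR0 mulr1 cn_real gtr0_norm.
have [d d0 dP] := hasD_continuous HA e0.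
have k0 : 0 < r * (nrm v + 1) by rewrite mulr_gt0// ltr_wpDl// nrm_ge0.
have /continuous_RCP/(_ _ (divr_gt0 d0 k0))[d' d'0 dP'] := @continuous_circle s0.
exists d' => // y /dP'; rewrite ltr_pdivlMr// => yd; rewrite -nrmc; apply: dP.
rewrite opprD addrACA subrr add0r -scalerBl -mulrBr nrmZ Normc.normcM cn_real gtr0_norm//.
apply: le_lt_trans yd; rewrite mulrA [cn _ * r]mulrC ler_wpM2l//.
  by rewrite mulr_ge0 ?cn_ge0// ltW.
by rewrite lerDl.
Qed.

Lemma hasD_line (z v : Cn) (w : C) : hasD (fun w : C => z + w *: v) w (fun h : C => h *: v).
Proof.
split.
- by move=> a x y; rewrite scalerDl -[a *: x]/(a * x) scalerA.
- exists (nrm v + 1); first by rewrite ltr_wpDl// nrm_ge0.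
  by move=> h; rewrite nrmZ nrmc mulrC ler_wpM2r ?cn_ge0// lerDl.
move=> e e0; exists 1 => // h _.
have -> : z + (w + h) *: v - (z + w *: v) - h *: v = 0.
  by rewrite scalerDl addrA [z + _ + _]addrC addrK subrr.
by rewrite nrm0 mulr_ge0 ?nrm_ge0// ltW.
Qed.

(** Cauchy's formula for a directional derivative: [circle_mean] for the difference quotient (f(z +
    w v) - f(z)) / w, completed by [A v] at w = 0. On the unit circle conjugation is inversion, and
    the constant f(z) drops out because conj(w) has mean 0. *)
Lemma circle_formula (f : Cn -> C) z v (r rho : R) A : 0 < r -> r < rho ->
  (forall w : C, cn w < rho -> differentiable f (z + w *: v)) -> hasD f z A ->
  cint 0 (2 * pi) (fun s => f (z + (r%:C * cexp 0 s) *: v) * conjc (cexp 0 s)) =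
  (2 * pi * r)%:C * A v.
Proof.
move=> r0 rrho df HA.
have z0 : z + 0 *: v = z by rewrite scale0r addr0.
pose N w := f (z + w *: v) - f z.
have N0 w B : hasD f (z + w *: v) B -> hasD N w (fun h => B (h *: v) - 0).
  by move=> HB; exact: hasD_sub (hasD_comp (hasD_line z v w) HB) (hasD_cst _ _).
pose g w := if w == 0 then A v else N w / w.
have g0 : g 0 = A v by rewrite /g eqxx.
have rho0 : 0 < rho by apply: lt_trans rrho.
have H : cint 0 (2 * pi) (fun s => g (r%:C * cexp 0 s)) = (2 * pi)%:C * A v.
  rewrite -g0; apply: (circle_mean r0 rrho).
    move=> w w0 wrho; have wn : w != 0 by rewrite -cn_gt0.
    have /differentiable_hasD[B /N0 HB] := df _ wrho.
    apply/differentiable_hasD; eexists.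
    apply: hasD_near w0 _ (hasD_mul HB (hasD_inv (f := id) wn (hasD_id _))) => y hy.
    rewrite /g ifF//; apply/negP => /eqP y0.
    by move: hy; rewrite y0 sub0r nrmN nrmc ltxx.
  move=> e e0; have [_ _ Neps] := N0 0 A (eq_ind_r (fun p => hasD f p A) HA z0).
  have [d d0 dP] := Neps e e0.
  exists d => // w wd; rewrite g0 /g; case: eqVneq => [_|wn].
    by rewrite subrr Normc.normc0 ltW.
  have := dP w; rewrite !nrmc => /(_ wd).
  rewrite add0r {2}/N scale0r addr0 subrr !subr0 (hasDZc _ _ HA).
  have w0 : 0 < cn w by rewrite cn_gt0.
  rewrite -ler_pdivrMr// -Normc.normcV -Normc.normcM.
  suff -> : (N w - w * A v) / w = N w / w - A v by [].
  by field.
have cf := continuous_circle_comp r0 rrho df.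
have cc := continuous_conj continuous_circle.
have rn : r%:C != 0 by rewrite -cn_gt0 cn_real normr_gt0 gt_eqF.
have E : cint 0 (2 * pi) (fun s => g (r%:C * cexp 0 s)) =
  (r%:C)^-1 * cint 0 (2 * pi) (fun s => f (z + (r%:C * cexp 0 s) *: v) * conjc (cexp 0 s)).
  transitivity (cint 0 (2 * pi) (fun s => (r%:C)^-1 *
     (f (z + (r%:C * cexp 0 s) *: v) * conjc (cexp 0 s) - f z * conjc (cexp 0 s)))).
    apply: eq_cint => s _; have nz : r%:C * cexp 0 s != 0 by rewrite mulf_neq0// cexp_neq0.
    rewrite /g ifF; last exact: negbTE.
    by rewrite /N conj_cexp; field; rewrite rn cexp_neq0.
  have c1 := continuous_mul_RC cf cc.
  have c2 := continuous_mul_RC (@continuous_cst_RC R (f z)) cc.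
  rewrite (cintZ _ _ _ (continuous_sub_RC c1 c2)) (cintB _ _ c1 c2) (cintZ _ _ _ cc).
  by rewrite cint_conj_circle mulr0 subr0.
rewrite rmorphM /= mulrAC -H E; field; exact: rn.
Qed.

(** Cauchy's estimate on the circle of radius rho / 2; the constant 4 is 2 from the radius times 2
    from [cint_bound]. *)
Lemma cauchy_line (f : Cn -> C) z v (rho M : R) A : 0 < rho ->
  (forall w : C, cn w < rho -> differentiable f (z + w *: v) /\ cn (f (z + w *: v)) <= M) ->
  hasD f z A -> cn (A v) * rho <= 4 * M.
Proof.
move=> rho0 H HA.
have r0 : 0 < rho / 2 by rewrite divr_gt0.
have rrho : rho / 2 < rho by lra.
have df w (h : cn w < rho) := (H w h).1.
have E := circle_formula r0 rrho df HA.
have p0 : 0 < 2 * pi :> R by rewrite mulr_gt0// pi_gt0.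
have : cn (cint 0 (2 * pi) (fun s => f (z + ((rho / 2)%:C * cexp 0 s) *: v) * conjc (cexp 0 s))) <= 2 * (2 * pi - 0) * M.
  apply: cint_bound; last 2 first.
  - exact: ltW.
  - move=> s _; rewrite Normc.normcM cn_conj cn_cexp expR0 mulr1.
    by apply: (H _ _).2; rewrite Normc.normcM cn_cexp expR0 mulr1 cn_real gtr0_norm.
  apply: continuous_mul_RC; first exact: (continuous_circle_comp r0 rrho df).
  exact: (continuous_conj continuous_circle).
rewrite E Normc.normcM cn_real ger0_norm; last by rewrite mulr_ge0// ltW.
rewrite subr0 (_ : 2 * (2 * pi) * M = 2 * pi * (2 * M)); last by ring.
by rewrite -(mulrA (2 * pi)) ler_pM2l// => ?; lra.
Qed.

(** * Uniform estimates for bounded holomorphic functions on balls *)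

Definition holo_bounded (f : Cn -> C) z (rho M : R) :=
  forall w, nrm (w - z) < rho -> differentiable f w /\ cn (f w) <= M.

Lemma cauchy_ball (f : Cn -> C) z (rho M : R) A : 0 < rho ->
  holo_bounded f z rho M -> hasD f z A ->
  forall v, cn (A v) <= 4 * M / rho * nrm v.
Proof.
move=> rho0 H HA v; have [->|v0] := eqVneq v 0.
  by rewrite (hasD0 HA) nrm0 mulr0 Normc.normc0.
have nv : 0 < nrm v by rewrite nrm_gt0.
have rv : 0 < rho / nrm v by rewrite divr_gt0.
have K : cn (A v) * (rho / nrm v) <= 4 * M.
  apply: cauchy_line HA => // w; rewrite ltr_pdivlMr// => wr; apply: H.
  by rewrite addrC addKr nrmZ.
have -> : 4 * M / rho * nrm v = 4 * M / (rho / nrm v) by field; rewrite !gt_eqF.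
by rewrite ler_pdivlMr.
Qed.

Lemma is_derive_line (f : Cn -> C) z h (t : R) A : hasD f (z + t%:C *: h) A ->
  is_derive t 1 (fun s => Re (f (z + s%:C *: h))) (Re (A h)) /\
  is_derive t 1 (fun s => Im (f (z + s%:C *: h))) (Im (A h)).
Proof.
move=> HA; have [_ _ Aeps] := HA.
have key (e : R) : 0 < e -> exists2 d : R, 0 < d & forall s : R, `|s| < d ->
   cn (f (z + (t + s)%:C *: h) - f (z + t%:C *: h) - s%:C * A h) <= e * `|s|.
  move=> e0; have h0 : 0 < nrm h + 1 by rewrite ltr_wpDl// nrm_ge0.
  have [d d0 dP] := Aeps _ (divr_gt0 e0 h0).
  exists (d / (nrm h + 1)); first by rewrite divr_gt0.
  move=> s; rewrite ltr_pdivlMr// => sd.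
  have hn : nrm (s%:C *: h) = `|s| * nrm h by rewrite nrmZ cn_real.
  have hd : nrm (s%:C *: h) < d.
    by rewrite hn; apply: le_lt_trans sd; rewrite ler_wpM2l// lerDl.
  have := dP _ hd; rewrite nrmc hn (hasDZc _ _ HA).
  have -> : z + t%:C *: h + s%:C *: h = z + (t + s)%:C *: h.
    by rewrite rmorphD /= scalerDl addrA.
  move=> H; apply: le_trans H _.
  rewrite mulrCA mulrC ler_wpM2r// mulrAC -mulrA; apply: ler_piMr; first exact: ltW.
  by rewrite ler_pdivrMr// mul1r lerDl.
split; apply: eps_is_derive => e e0; have [d d0 dP] := key e e0; exists d => // s /dP;
  apply: le_trans.
  apply: le_trans (ler_Re_cn _); rewrite !cReB cReM /= mul0r subr0.
  by rewrite [_ * s]mulrC.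
apply: le_trans (ler_Im_cn _); rewrite !cImB cImM /= mul0r addr0.
by rewrite [_ * s]mulrC.
Qed.

Lemma mvt_itv (g dg : R -> R) :
  (forall t : R, 0 <= t <= 1 -> is_derive t 1 g (dg t)) ->
  exists2 c, 0 <= c <= 1 & g 1 - g 0 = dg c.
Proof.
move=> gd; have [||c] := @MVT_segment R g dg 0 1 ler01.
- by move=> x; rewrite in_itv /= => /andP[/ltW x0 /ltW x1]; apply: gd; rewrite x0.
- apply: derivable_within_continuous => x; rewrite in_itv /= => x01.
  by have [] := gd x x01.
by rewrite in_itv /= => c01 ->; exists c => //; rewrite subr0 mulr1.
Qed.

(** The mean value theorem is a real statement, so real and imaginary parts use different
    intermediate points; hence the factor 2. *)
Lemma mvt_bound (f : Cn -> C) z h (K : R) (D : R -> Cn -> C) :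
  (forall t : R, 0 <= t <= 1 -> hasD f (z + t%:C *: h) (D t) /\ cn (D t h) <= K) ->
  cn (f (z + h) - f z) <= 2 * K.
Proof.
move=> H.
have df (t : R) (h01 : 0 <= t <= 1) := is_derive_line (H t h01).1.
have [c c01] := mvt_itv (fun t h01 => (df t h01).1).
have [c' c01'] := mvt_itv (fun t h01 => (df t h01).2).
rewrite scale1r scale0r addr0 -cReB -cImB => EI ER.
rewrite (le_trans (ler_cn_ReIm _))// ER EI mulr_natl mulr2n lerD//.
  by rewrite (le_trans (ler_Re_cn _))// (H _ _).2.
by rewrite (le_trans (ler_Im_cn _))// (H _ _).2.
Qed.

Lemma nrm_conv (w w' z : Cn) (t rho : R) : 0 <= t <= 1 ->
  nrm (w - z) < rho -> nrm (w' - z) < rho -> nrm (w' + t%:C *: (w - w') - z) < rho.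
Proof.
move=> /andP[t0 t1] wr w'r.
have -> : w' + t%:C *: (w - w') - z = t%:C *: (w - z) + (1 - t)%:C *: (w' - z).
  by rewrite rmorphB scalerBl !scalerBr scale1r; apply/rowP => i; rewrite !mxE; move: (t%:C * _) (t%:C * _) (t%:C * _) => p q r; ring.
apply: le_lt_trans (ler_nrmD _ _) _; rewrite !nrmZ !cn_real (ger0_norm t0) ger0_norm ?subr_ge0//.
have [->|tn] := eqVneq t 0; first by rewrite mul0r add0r subr0 mul1r.
have tp : 0 < t by rewrite lt_def tn.
apply: (@lt_le_trans _ _ (t * rho + (1 - t) * rho)); last by lra.
by apply: ltr_leD; [rewrite ltr_pM2l|rewrite ler_wpM2l ?subr_ge0// ltW].
Qed.

Lemma mvt_ball (f : Cn -> C) z (rho K : R) (D : Cn -> Cn -> C) :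
  (forall w, nrm (w - z) < rho -> hasD f w (D w) /\ forall v, cn (D w v) <= K * nrm v) ->
  forall w w', nrm (w - z) < rho -> nrm (w' - z) < rho ->
  cn (f w - f w') <= 2 * K * nrm (w - w').
Proof.
move=> H w w' wr w'r.
have := @mvt_bound f w' (w - w') (K * nrm (w - w')) (fun t => D (w' + t%:C *: (w - w'))).
rewrite [w' + (w - w')]addrC subrK -mulrA; apply => t t01.
have conv := nrm_conv t01 wr w'r.
by split; [exact: (H _ conv).1|exact: (H _ conv).2].
Qed.

Lemma holo_bounded_sub f z (rho M : R) z' (rho' : R) : holo_bounded f z rho M ->
  nrm (z' - z) + rho' <= rho -> holo_bounded f z' rho' M.
Proof.
move=> H zr w wr; apply: H; rewrite -(subrK z' w) -addrA.
apply: le_lt_trans (ler_nrmD _ _) _; apply: lt_le_trans zr.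
by rewrite [X in X < _]addrC ltrD2l.
Qed.

(** Cauchy's estimate on balls of radius rho / 2 around the points of the half ball, integrated
    along segments. *)
Lemma lipschitz_ball f z (rho M : R) : 0 < rho -> holo_bounded f z rho M ->
  forall w w', nrm (w - z) < rho / 2 -> nrm (w' - z) < rho / 2 ->
  cn (f w - f w') <= 16 * M / rho * nrm (w - w').
Proof.
move=> rho0 H.
have -> : 16 * M / rho = 2 * (4 * M / (rho / 2)) by field; rewrite gt_eqF.
apply: (@mvt_ball _ _ _ _ (fun w => 'd f w)) => w wr.
have dfw : differentiable f w by apply: (H _ _).1; lra.
split; first exact: diff_hasD.
apply: cauchy_ball; [lra| |exact: diff_hasD].
by apply: (holo_bounded_sub H); lra.
Qed.

Lemma cauchy_const_ge0 (k : nat) (M rho : R) : 0 < rho -> 0 <= M ->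
  0 <= k%:R * M / rho ^+ 2.
Proof.
move=> rho0 M0; apply: divr_ge0; first exact: mulr_ge0 (ler0n _ _) M0.
exact: exprn_ge0 _ (ltW rho0).
Qed.

Lemma holo_bounded_ge0 f z (rho M : R) : 0 < rho -> holo_bounded f z rho M -> 0 <= M.
Proof.
by move=> rho0 /(_ z); rewrite subrr nrm0 => /(_ rho0)[_]; apply: le_trans; exact: cn_ge0.
Qed.

(** B - A is the derivative at z of the difference between a translate of f by w - z and f itself.
    This difference is small by [lipschitz_ball], so Cauchy's estimate applies to it. *)
Lemma cauchy_diff f z (rho M : R) w A B : 0 < rho -> holo_bounded f z rho M ->
  hasD f z A -> hasD f w B -> nrm (w - z) < rho / 4 ->
  forall v, cn (B v - A v) <= 256 * M / rho ^+ 2 * nrm (w - z) * nrm v.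
Proof.
move=> rho0 H HA HB wr.
have r4 : 0 < rho / 4 by lra.
have -> : 256 * M / rho ^+ 2 * nrm (w - z) = 4 * (16 * M / rho * nrm (w - z)) / (rho / 4).
  by field; rewrite gt_eqF.
have HBs : hasD (fun y => f (y + (w - z))) z B.
  by apply: (hasD_comp (hasD_shift (w - z) z) (B := B)); rewrite addrC subrK.
apply: (cauchy_ball r4 _ (hasD_sub HBs HA)) => x xr.
have xw : nrm (x + (w - z) - z) < rho / 2.
  rewrite addrAC; apply: le_lt_trans (ler_nrmD _ _) _; lra.
have xz : nrm (x - z) < rho / 2 by lra.
have /differentiable_hasD[A1 HA1] : differentiable f x by apply: (H _ _).1; lra.
have /differentiable_hasD[B1 HB1] : differentiable f (x + (w - z)) by apply: (H _ _).1; lra.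
split.
  apply/differentiable_hasD; eexists; apply: hasD_sub HA1.
  exact: (hasD_comp (hasD_shift (w - z) x) HB1).
have := lipschitz_ball rho0 H xw xz.
by rewrite [x + _ - x]addrC addKr.
Qed.

(** A quadratic remainder whose constant depends on M and rho only, hence is uniform over families
    of functions with a common bound. *)
Lemma taylor2 f z (rho M : R) A : 0 < rho -> holo_bounded f z rho M -> hasD f z A ->
  forall h, nrm h < rho / 4 ->
  cn (f (z + h) - f z - A h) <= 512 * M / rho ^+ 2 * nrm h ^+ 2.
Proof.
move=> rho0 H HA h hr.
have M0 := holo_bounded_ge0 rho0 H.
have E : f (z + h) - f z - A h = (f (z + h) - A (z + h)) - (f z - A z).
  by rewrite (hasDD z h HA); ring.
have -> : 512 * M / rho ^+ 2 * nrm h ^+ 2 = 2 * (256 * M / rho ^+ 2 * nrm h * nrm h) by ring.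
rewrite E; pose D t := fun v => 'd f (z + t%:C *: h) v - A v.
apply: (@mvt_bound (fun y => f y - A y) z h _ D) => t /andP[t0 t1].
have nE : nrm (z + t%:C *: h - z) = t * nrm h by rewrite addrC addKr nrmZ cn_real ger0_norm.
have tr : t * nrm h <= nrm h by rewrite ler_piMl// nrm_ge0.
have dft : differentiable f (z + t%:C *: h) by apply: (H _ _).1; rewrite nE; lra.
split; first by apply: hasD_sub; [exact: diff_hasD|exact: hasD_linear HA _].
have lt4 : nrm (z + t%:C *: h - z) < rho / 4 by rewrite nE; lra.
apply: le_trans (cauchy_diff rho0 H HA (diff_hasD dft) lt4 h) _.
rewrite nE ler_wpM2r ?nrm_ge0// ler_wpM2l//.
exact: cauchy_const_ge0 rho0 M0.
Qed.

End CircleFormula.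

(** * Holomorphic derivatives and Hermitian kernels *)

Section Holomorphy.
Context {R : realType} {n : nat}.
Local Notation C := R[i].
Local Notation Cn := 'rV[C]_n.+1.

(** Differentiation under the integral sign: the remainder of [taylor2] is uniform in s. Continuity
    of the derivative in s is not assumed but obtained, as the difference quotients converge
    uniformly in s. *)
Lemma holo_param (P : Cn -> R -> C) z (rho M a b : R) (D : R -> Cn -> C) :
  0 < rho -> a <= b ->
  (forall s, holo_bounded (fun x => P x s) z rho M) ->
  (forall x, nrm (x - z) < rho -> continuous (P x)) ->
  (forall s, hasD (fun x => P x s) z (D s)) ->
  hasD (fun x => cint a b (P x)) z (fun h => cint a b (fun s => D s h)).
Proof.
move=> rho0 ab HP cP HD.
have M0 := holo_bounded_ge0 rho0 (HP 0).
have zz : nrm (z - z) < rho by rewrite subrr nrm0.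
set K := 512 * M / rho ^+ 2.
have K0 : 0 <= K.
  exact: cauchy_const_ge0 rho0 M0.
have T s h : nrm h < rho / 4 -> cn (P (z + h) s - P z s - D s h) <= K * nrm h ^+ 2.
  by move=> hr; have := taylor2 rho0 (HP s) (HD s) hr.
have cD h : continuous (fun s => D s h).
  apply: continuous_uniform_limit => e e0.
  have nh := nrm_ge0 h.
  have nh0 : 0 < 8 * (nrm h + 1) by rewrite mulr_gt0// ltr_wpDl.
  have nk0 : 0 < K * nrm h ^+ 2 + 1 by rewrite ltr_wpDl// mulr_ge0// exprn_ge0.
  (* The first bound keeps z + s0 h in the ball; the second makes the error K s0 |h|^2 of the
     quotient at most e. *)
  set s0 := minr (rho / (8 * (nrm h + 1))) (e / (K * nrm h ^+ 2 + 1)).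
  have s00 : 0 < s0 by rewrite lt_min !divr_gt0.
  have sh : s0 * (8 * (nrm h + 1)) <= rho by rewrite -ler_pdivlMr// ge_min lexx.
  have se : s0 * (K * nrm h ^+ 2 + 1) <= e by rewrite -ler_pdivlMr// ge_min lexx orbT.
  have hn : nrm (s0%:C *: h) = s0 * nrm h by rewrite nrmZ cn_real gtr0_norm.
  have hr : nrm (s0%:C *: h) < rho / 4 by rewrite hn; nra.
  have hr' : nrm (z + s0%:C *: h - z) < rho by rewrite addrC addKr; lra.
  exists (fun s => (s0%:C)^-1 * (P (z + s0%:C *: h) s - P z s)).
    apply: continuous_mul_RC; first exact: continuous_cst_RC.
    by apply: continuous_sub_RC; exact: cP.
  move=> s; have sn : s0%:C != 0 by rewrite -cn_gt0 cn_real normr_gt0 gt_eqF.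
  have -> : D s h - (s0%:C)^-1 * (P (z + s0%:C *: h) s - P z s) =
    - ((s0%:C)^-1 * (P (z + s0%:C *: h) s - P z s - D s (s0%:C *: h))).
    by rewrite (hasDZc _ _ (HD s)); field.
  rewrite cnN Normc.normcM Normc.normcV cn_real gtr0_norm// ler_pdivrMl//.
  apply: le_trans (T s _ hr) _; rewrite hn exprMn mulrCA expr2 -mulrA ler_wpM2l ?(ltW s00)//.
  by apply: le_trans se; rewrite mulrDr mulr1 lerDl ltW.
split.
- move=> c u v.
  transitivity (c * cint a b (fun s => D s u) + cint a b (fun s => D s v)); last by [].
  rewrite -cintZ// -cintD//; last first.
    exact: continuous_mul_RC (@continuous_cst_RC _ _) _.
  by apply: eq_cint => s _; have [-> _ _] := HD s.
- exists (2 * (b - a) * (4 * M / rho) + 1).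
    by rewrite ltr_wpDl// !mulr_ge0 ?invr_ge0 ?(ltW rho0)// subr_ge0.
  move=> h; rewrite nrmc; apply: (@le_trans _ _ (2 * (b - a) * (4 * M / rho * nrm h))).
    by apply: cint_bound => // s _; exact: (cauchy_ball rho0 (HP s) (HD s)).
  by rewrite mulrA ler_wpM2r ?nrm_ge0// lerDl.
move=> e e0.
have q0 : 0 < 2 * (b - a) * K + 1.
  rewrite ltr_wpDl//; apply: mulr_ge0 K0; rewrite mulr_ge0// subr_ge0//.
exists (minr (rho / 4) (e / (2 * (b - a) * K + 1))).
  by rewrite lt_min !divr_gt0.
move=> h; rewrite lt_min => /andP[hr]; rewrite ltr_pdivlMr// => he.
have hr' : nrm (z + h - z) < rho by rewrite addrC addKr; lra.
rewrite nrmc -!cintB//; try exact: cP.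
  apply: (@le_trans _ _ (2 * (b - a) * (K * nrm h ^+ 2))).
    apply: cint_bound => //.
      by apply: continuous_sub_RC => //; apply: continuous_sub_RC; exact: cP.
    by move=> s _; exact: T.
  rewrite mulrA expr2 mulrA ler_wpM2r ?nrm_ge0// mulrC; apply: le_trans (ltW he).
  by rewrite ler_wpM2l ?nrm_ge0// lerDl.
by apply: continuous_sub_RC; exact: cP.
Qed.

Lemma holo_locally_bounded (O : set Cn) (f : Cn -> C) z :
  open O -> (forall x, O x -> differentiable f x) -> O z ->
  exists rho M : R, [/\ 0 < rho, holo_bounded f z rho M &
    forall x, nrm (x - z) < rho -> O x].
Proof.
move=> oO df Oz.
have /differentiable_hasD[A HA] := df _ Oz.
have [d d0 dP] := hasD_continuous HA ltr01.
have [d' d'0 dP'] := open_nrmP oO Oz.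
exists (minr d d'), (cn (f z) + 1); split; first by rewrite lt_min d0.
  move=> w; rewrite lt_min => /andP[/dP h1 /dP' h2]; split; first exact: df.
  rewrite -(subrK (f z) (f w)) addrC; apply: le_trans (ler_cnD _ _) _.
  by rewrite lerD2l -nrmc ltW.
by move=> x; rewrite lt_min => /andP[_ /dP'].
Qed.

(** Fixes the radius rho / (8 (|v| + 1)) for circles in direction v: even the disc of twice this
    radius moves x by less than rho / 4, also if v = 0. *)
Lemma circle_point (z x v : Cn) (rho : R) (w : C) : 0 < rho ->
  nrm (x - z) < rho / 2 -> cn w < 2 * (rho / (8 * (nrm v + 1))) ->
  nrm (x + w *: v - z) < rho.
Proof.
move=> rho0 xz; have nv := nrm_ge0 v.
rewrite mulrA ltr_pdivlMr; last by rewrite mulr_gt0// ltr_wpDl.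
move=> wr; rewrite addrAC; apply: le_lt_trans (ler_nrmD _ _) _; rewrite nrmZ.
have := cn_ge0 w; move: (cn w) (nrm v) (nrm (x - z)) wr nv xz rho0 => a b c; nra.
Qed.

Lemma circle_length_neq0 (r : R) : 0 < r -> (2 * pi * r)%:C != 0 :> C.
Proof.
move=> r0; rewrite -cn_gt0 cn_real normr_gt0 gt_eqF//.
exact: mulr_gt0 (mulr_gt0 (ltr0n _ 2) (pi_gt0 R)) r0.
Qed.

(** By [circle_formula] the derivative along v is an integral of translates of f, which depend
    holomorphically on x. *)
Lemma holo_bounded_deriv (f : Cn -> C) z (rho M : R) v : 0 < rho ->
  holo_bounded f z rho M -> differentiable (fun x => 'd f x v) z.
Proof.
move=> rho0 H.
have nv := nrm_ge0 v.
pose r := rho / (8 * (nrm v + 1)).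
have r0 : 0 < r by rewrite divr_gt0// mulr_gt0// ltr_wpDl.
have rr : r < 2 * r by rewrite ltr_pMl// ltr1n.
have rho2 : 0 < rho / 2 by rewrite divr_gt0.
have df x w : nrm (x - z) < rho / 2 -> cn w < 2 * r -> differentiable f (x + w *: v).
  by move=> xz wr; apply: (H _ _).1; exact: circle_point.
pose P x (s : R) := f (x + (r%:C * cexp 0 s) *: v) * conjc (cexp 0 s).
have cr s : cn (r%:C * cexp 0 s) < 2 * r.
  by rewrite Normc.normcM cn_cexp expR0 mulr1 cn_real gtr0_norm.
have HP s : holo_bounded (fun x => P x s) z (rho / 2) M.
  move=> x xz; split.
    have /differentiable_hasD[A HA] := df _ _ xz (cr s).
    apply/differentiable_hasD; eexists; apply: hasD_mul (hasD_cst _ _).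
    exact: (hasD_comp (hasD_shift _ x) HA).
  rewrite Normc.normcM cn_conj cn_cexp expR0 mulr1.
  by apply: (H _ _).2; exact: circle_point (cr s).
have cP x : nrm (x - z) < rho / 2 -> continuous (P x).
  move=> xz; apply: continuous_mul_RC; last exact: (continuous_conj continuous_circle).
  by apply: (continuous_circle_comp r0 rr) => w; exact: df.
have zz : nrm (z - z) < rho / 2 by rewrite subrr nrm0.
have pi0 : 0 <= 2 * pi :> R by rewrite mulr_ge0// pi_ge0.
have HI := holo_param rho2 pi0 HP cP (fun s => diff_hasD (HP s z zz).1).
have pr0 := circle_length_neq0 r0.
apply/differentiable_hasD; eexists.
apply: (@hasD_near _ _ _ (fun x => (2 * pi * r)%:C^-1 * cint 0 (2 * pi) (P x)) _ _ _ (rho / 2)) => //.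
  move=> x xz; have dfx : differentiable f x.
    by have := df x 0 xz; rewrite scale0r addr0 Normc.normc0 mulr_gt0//; exact.
  have := circle_formula r0 rr (fun w => df x w xz) (diff_hasD dfx).
  by rewrite /P => ->; rewrite mulKf.
exact: (hasD_cmul _ HI).
Qed.

Lemma holo_deriv (O : set Cn) (f : Cn -> C) v :
  open O -> (forall x, O x -> differentiable f x) ->
  forall z, O z -> differentiable (fun x => 'd f x v) z.
Proof.
move=> oO df z Oz; have [rho [M [rho0 H _]]] := holo_locally_bounded oO df Oz.
exact: holo_bounded_deriv rho0 H.
Qed.

(** * Functions holomorphic in one variable and antiholomorphic in the other *)

Definition sesq_bounded (P : Cn -> Cn -> C) z (rho M : R) :=
  forall x y, nrm (x - z) < rho -> nrm (y - z) < rho ->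
    [/\ differentiable (fun x' => P x' y) x,
        differentiable (fun y' => conjc (P x y')) y & cn (P x y) <= M].

Lemma sesq_fst P z (rho M : R) y : sesq_bounded P z rho M -> nrm (y - z) < rho ->
  holo_bounded (fun x => P x y) z rho M.
Proof. by move=> H yz x xz; have [h1 _ h3] := H x y xz yz. Qed.

Lemma sesq_snd P z (rho M : R) x : sesq_bounded P z rho M -> nrm (x - z) < rho ->
  holo_bounded (fun y => conjc (P x y)) z rho M.
Proof. by move=> H xz y yz; have [_ h2 h3] := H x y xz yz; rewrite cn_conj. Qed.

Lemma conjc_realM (a : R) (c : C) : conjc (a%:C * c) = a%:C * conjc c.
Proof. by case: c => p q; apply: complex_ext => /=; ring. Qed.

(** The derivative in y is a circle integral in y whose integrand is holomorphic in x, so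
    [holo_param] gives holomorphy in x; in y the argument is the one for a single variable. The
    outer conjugation keeps the roles of x and y. *)
Lemma sesq_deriv P z (rho M : R) w : 0 < rho -> sesq_bounded P z rho M ->
  sesq_bounded (fun x y => conjc ('d (fun y' => conjc (P x y')) y w)) z (rho / 2)
    (4 * M / (rho / 2) * nrm w).
Proof.
move=> rho0 H x0 y0 x0z y0z.
have rho2 : 0 < rho / 2 by lra.
have x0z' : nrm (x0 - z) < rho by lra.
have y0z' : nrm (y0 - z) < rho by lra.
have Hy x : nrm (x - z) < rho -> holo_bounded (fun y => conjc (P x y)) y0 (rho / 2) M.
  by move=> xz; apply: holo_bounded_sub (sesq_snd H xz) _; lra.
have sub x : nrm (x - x0) < rho / 2 -> nrm (x - z) < rho.
  by move=> ?; rewrite -(subrK x0 x) -addrA; apply: le_lt_trans (ler_nrmD _ _) _; lra.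
have nw := nrm_ge0 w.
split.
- pose r := rho / 2 / (8 * (nrm w + 1)).
  have r0 : 0 < r by rewrite divr_gt0// mulr_gt0// ltr_wpDl.
  have rr : r < 2 * r by rewrite ltr_pMl// ltr1n.
  have cr s : cn (r%:C * cexp 0 s) < 2 * r.
    by rewrite Normc.normcM cn_cexp expR0 mulr1 cn_real gtr0_norm.
  have pt c : cn c < 2 * r -> nrm (y0 + c *: w - y0) < rho / 2.
    by move=> cw; apply: circle_point => //; rewrite subrr nrm0 divr_gt0.
  have pt' c : cn c < 2 * r -> nrm (y0 + c *: w - z) < rho.
    move=> /pt h; rewrite -(subrK y0 (y0 + _)) -addrA.
    by apply: le_lt_trans (ler_nrmD _ _) _; lra.
  pose Q x (s : R) := P x (y0 + (r%:C * cexp 0 s) *: w) * cexp 0 s.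
  have HQ s : holo_bounded (fun x => Q x s) x0 (rho / 2) M.
    move=> x xz.
    have xz' := sub x xz.
    have [d1 _ d3] := H x _ xz' (pt' _ (cr s)).
    split; last by rewrite Normc.normcM cn_cexp expR0 mulr1.
    apply/differentiable_hasD; eexists; apply: hasD_mul (hasD_cst _ _).
    exact: diff_hasD d1.
  have cQ x : nrm (x - x0) < rho / 2 -> continuous (Q x).
    move=> xz.
    have xz' := sub x xz.
    apply: continuous_mul_RC; last exact: continuous_circle.
    have c1 : continuous (fun s => conjc (P x (y0 + (r%:C * cexp 0 s) *: w))).
      apply: (@continuous_circle_comp _ _ (fun y => conjc (P x y)) y0 w r (2 * r) r0 rr).
      by move=> c /pt' cz; have [_ d2 _] := H x _ xz' cz.
    have := continuous_conj c1.
    have -> // : (fun s => conjc (conjc (P x (y0 + (r%:C * cexp 0 s) *: w)))) =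
      (fun s => P x (y0 + (r%:C * cexp 0 s) *: w)).
    by apply/funext => s; rewrite conjcK.
  have x00 : nrm (x0 - x0) < rho / 2 by rewrite subrr nrm0.
  have pi0 : 0 <= 2 * pi :> R by rewrite mulr_ge0// pi_ge0.
  have HI := holo_param rho2 pi0 HQ cQ (fun s => diff_hasD (HQ s x0 x00).1).
  apply/differentiable_hasD; eexists.
  apply: (@hasD_near _ _ _ (fun x => (2 * pi * r)%:C^-1 * cint 0 (2 * pi) (Q x)) _ _ _ (rho / 2)) => //; last exact: (hasD_cmul _ HI).
  move=> x xz.
  have xz' := sub x xz.
  have dk' c : cn c < 2 * r -> differentiable (fun y => conjc (P x y)) (y0 + c *: w).
    by move=> /pt' cz; have [_ d2 _] := H x _ xz' cz.
  have dk0 : differentiable (fun y => conjc (P x y)) y0.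
    by have [_ d2 _] := H x _ xz' y0z'.
  have E := circle_formula r0 rr dk' (diff_hasD dk0).
  have c1 := continuous_circle_comp r0 rr dk'.
  have c2 := continuous_mul_RC c1 (continuous_conj continuous_circle).
  move: E; set dk := ('d (fun y' => conjc (P x y')) y0 w : C) => E.
  have E2 : cint 0 (2 * pi) (Q x) = (2 * pi * r)%:C * conjc dk.
    have := congr1 (fun c : C => conjc c) E.
    rewrite conjc_realM => <-; rewrite -cint_conj//.
    apply: eq_cint => s _; rewrite -[LHS]conjcK; congr (conjc _).
    exact: (rmorphM (@conjc R)).
  have pr0 := circle_length_neq0 r0.
  by rewrite E2 mulKf.
- have -> : (fun y => conjc (conjc ('d (fun y' => conjc (P x0 y')) y w))) =
      (fun y => 'd (fun y' => conjc (P x0 y')) y w).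
    by apply/funext => y; rewrite conjcK.
  exact: holo_bounded_deriv rho2 (Hy _ x0z').
- rewrite cn_conj; apply: (cauchy_ball rho2 (Hy _ x0z')).
  by apply: diff_hasD; have [] := H x0 y0 x0z' y0z'.
Qed.

(** The increment along the diagonal passes through P(z, y) with y = z + t v: a Taylor step in x at
    fixed y, a Taylor step in y at fixed z, and the change of the x-derivative as the second
    argument moves from z to y, bounded by Cauchy's estimate. *)
Lemma sesq_diag P z (rho M : R) v A B : 0 < rho -> sesq_bounded P z rho M ->
  hasD (fun x => P x z) z A -> hasD (fun y => conjc (P z y)) z B ->
  forall e : R, 0 < e -> exists2 d : R, 0 < d & forall t : R, `|t| < d ->
    cn (P (z + t%:C *: v) (z + t%:C *: v) - P z z - t%:C * (A v + conjc (B v))) <= e * `|t|.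
Proof.
move=> rho0 H HA HB e e0.
have zz : nrm (z - z) < rho by rewrite subrr nrm0.
have M0 := holo_bounded_ge0 rho0 (sesq_fst H zz).
have nv := nrm_ge0 v.
(* 1152 = 512 + 128 + 512, the constants of the three errors [E1], [E3] and [E2]. *)
pose K := 1152 * M / rho ^+ 2 * nrm v ^+ 2.
have K0 : 0 <= K.
  apply: mulr_ge0 (exprn_ge0 _ nv).
  exact: cauchy_const_ge0 rho0 M0.
have K1 : 0 < K + 1 by rewrite ltr_wpDl.
have v1 : 0 < 8 * (nrm v + 1) by rewrite mulr_gt0// ltr_wpDl.
exists (minr (rho / (8 * (nrm v + 1))) (e / (K + 1))).
  by rewrite lt_min !divr_gt0.
move=> t; rewrite lt_min !ltr_pdivlMr// => /andP[t1 t2].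
set h := t%:C *: v; have hn : nrm h = `|t| * nrm v by rewrite nrmZ cn_real.
have t0 := normr_ge0 t.
have hr : nrm h < rho / 8 by rewrite hn; nra.
have nh := nrm_ge0 h.
set y := z + h.
have yz : nrm (y - z) = nrm h by rewrite /y addrC addKr.
have yr : nrm (y - z) < rho by rewrite yz; lra.
have [dy _ _] := H z y zz yr.
have HAy := diff_hasD dy; set Ay : Cn -> C := 'd _ z in HAy.
have rho2 : 0 < rho / 2 by lra.
have E1 : cn (P y y - P z y - Ay h) <= 512 * M / rho ^+ 2 * nrm h ^+ 2.
  by apply: (taylor2 rho0 (sesq_fst H yr) HAy); lra.
have E2 : cn (conjc (P z y) - conjc (P z z) - B h) <= 512 * M / rho ^+ 2 * nrm h ^+ 2.
  by apply: (taylor2 rho0 (sesq_snd H zz) HB); lra.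
have E3 : cn (Ay h - A h) <= 4 * (16 * M / rho * nrm h) / (rho / 2) * nrm h.
  apply: (cauchy_ball rho2 _ (hasD_sub HAy HA)) => x xz.
  have xz' : nrm (x - z) < rho by lra.
  split.
    have [d1 _ _] := H x y xz' yr; have [d2 _ _] := H x z xz' zz.
    apply/differentiable_hasD; eexists.
    exact: (hasD_sub (diff_hasD d1) (diff_hasD d2)).
  have yz2 : nrm (y - z) < rho / 2 by rewrite yz; lra.
  have zz2 : nrm (z - z) < rho / 2 by rewrite subrr nrm0.
  have := lipschitz_ball rho0 (sesq_snd H xz') yz2 zz2.
  by rewrite yz -rmorphB cn_conj.
have -> : P y y - P z z - t%:C * (A v + conjc (B v)) =
    (P y y - P z y - Ay h) + (Ay h - A h) + conjc (conjc (P z y) - conjc (P z z) - B h).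
  have cjB (a b : C) : conjc (conjc a - conjc b) = a - b.
    by rewrite (rmorphB (@conjc R)) /= !conjcK.
  rewrite (rmorphB (@conjc R)) /= cjB /h (hasDZc _ _ HA) (hasDZc _ _ HB) conjc_realM.
  ring.
apply: le_trans (ler_cnD _ _) _; rewrite cn_conj.
apply: (@le_trans _ _ (K * `|t| * `|t|)); last first.
  by rewrite ler_wpM2r// mulrC; move: t2; rewrite mulrDr mulr1; lra.
have -> : K * `|t| * `|t| = 512 * M / rho ^+ 2 * nrm h ^+ 2 +
   4 * (16 * M / rho * nrm h) / (rho / 2) * nrm h + 512 * M / rho ^+ 2 * nrm h ^+ 2.
  by rewrite hn /K; field; rewrite gt_eqF.
rewrite lerD// (le_trans (ler_cnD _ _))// lerD//.
Qed.

Lemma real_derive_eps (f : Cn -> C) z v c :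
  (forall e : R, 0 < e -> exists2 d : R, 0 < d & forall t : R, `|t| < d ->
    cn (f (z + t%:C *: v) - f z - t%:C * c) <= e * `|t|) ->
  [/\ is_derive (0 : R) 1 (fun t : R => Re (f (z + t%:C *: v))) (Re c),
      is_derive (0 : R) 1 (fun t : R => Im (f (z + t%:C *: v))) (Im c) &
      real_derive v f z = c].
Proof.
move=> H.
have [dR dI] : is_derive (0 : R) 1 (fun t : R => Re (f (z + t%:C *: v))) (Re c) /\
    is_derive (0 : R) 1 (fun t : R => Im (f (z + t%:C *: v))) (Im c).
  split; apply: eps_is_derive => e e0; have [d d0 dP] := H e e0; exists d => // t /dP;
    apply: le_trans; rewrite add0r scale0r addr0.
    apply: le_trans (ler_Re_cn _); rewrite !cReB cReM /= mul0r subr0.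
    by rewrite [_ * t]mulrC.
  apply: le_trans (ler_Im_cn _); rewrite !cImB cImM /= mul0r addr0.
  by rewrite [_ * t]mulrC.
split => //; rewrite /real_derive !derive1E.
by case: dR => _ ->; case: dI => _ ->; case: c {H}.
Qed.

End Holomorphy.

(** * Change of variables *)

Section ChangeOfVariables.
Context {R : realType} {n : nat}.
Local Notation C := R[i].
Local Notation Cn := 'rV[R[i]]_n.+1.
Local Notation I := ('I_n.+1 * bool)%type.
Local Notation L := (@lebesgue_outer R n).

Lemma fin_min (J : finType) (P : J -> R -> Prop) :
  (forall i, exists2 d : R, 0 < d & forall d', 0 < d' <= d -> P i d') ->
  exists2 d : R, 0 < d & forall d', 0 < d' <= d -> forall i, P i d'.
Proof.
move=> H.
have [D HD] : {D : J -> R & forall i, 0 < D i /\ forall d', 0 < d' <= D i -> P i d'}.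
  by apply: (@choice _ _ (fun i d => 0 < d /\ forall d', 0 < d' <= d -> P i d')) => i; have [d d0 dP] := H i; exists d.
have D0 i : 0 <= (D i)^-1 by rewrite invr_ge0 ltW// (HD i).1.
have S0 : 0 < \sum_i (D i)^-1 + 1 by rewrite ltr_wpDl// sumr_ge0.
(* A positive number below every [D i], with no minimum over a possibly empty type. *)
exists (\sum_i (D i)^-1 + 1)^-1; first by rewrite invr_gt0.
move=> d' /andP[d'0 d'D] i; apply: (HD i).2; rewrite d'0/=; apply: le_trans d'D _.
rewrite -[leRHS]invrK lef_pV2 ?posrE// ?invr_gt0 ?(HD i).1//.
by rewrite (bigD1 i)//= -addrA lerDl addr_ge0// sumr_ge0.
Qed.

Lemma hasD_coord (V : normedModType C) (F : V -> Cn) z A i : hasD F z A ->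
  hasD (fun w => F w 0 i : C) z (fun h => A h 0 i).
Proof.
move=> [l [k k0 kP] H]; split.
- by move=> a u v; rewrite l !mxE.
- by exists k => // h; rewrite nrmc; apply: le_trans (nrm_coord _ _) (kP h).
move=> e /H[d d0 dP]; exists d => // h /dP; apply: le_trans.
rewrite nrmc; have -> : F (z + h) 0 i - F z 0 i - A h 0 i = (F (z + h) - F z - A h) 0 i.
  by rewrite !mxE.
exact: nrm_coord.
Qed.

Lemma holo_coord Omega (F : Cn -> Cn) i : holomorphic Omega F ->
  forall z, Omega z -> differentiable (fun w => F w 0 i : C) z.
Proof.
move=> hF z /hF/diff_hasD/(hasD_coord i) H.
by apply/differentiable_hasD; eexists; exact: H.
Qed.

(** Strict differentiability, which compares two moving points: the mean value estimate for each
    coordinate of F minus its differential at z0, whose derivative is small near z0 by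
    [cauchy_diff]. *)
Lemma holo_strict Omega (F : Cn -> Cn) z0 (e : R) : open Omega -> holomorphic Omega F ->
  Omega z0 -> 0 < e -> exists2 d : R, 0 < d &
  forall w w', nrm (w - z0) < d -> nrm (w' - z0) < d ->
    nrm (F w - F w' - 'd F z0 (w - w')) <= e * nrm (w - w').
Proof.
move=> oO hF O0 e0.
have HF0 := diff_hasD (hF _ O0).
set T : Cn -> Cn := 'd F z0 in HF0 *.
have [d d0 dP] : exists2 d : R, 0 < d & forall d', 0 < d' <= d -> forall i,
    forall w w', nrm (w - z0) < d' -> nrm (w' - z0) < d' ->
    cn ((F w - F w' - T (w - w')) 0 i) <= e * nrm (w - w').
  apply: fin_min => i.
  have [rho [M [rho0 HB OB]]] := holo_locally_bounded oO (holo_coord i hF) O0.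
  have M0 := holo_bounded_ge0 rho0 HB.
  have K1 : 0 <= 256 * M / rho ^+ 2.
    exact: cauchy_const_ge0 rho0 M0.
  pose K := 256 * M / rho ^+ 2 + 1.
  have K0 : 0 < K by apply: ltr_wpDl ltr01.
  exists (minr (rho / 4) (e / (2 * K))).
    by rewrite lt_min !divr_gt0// mulr_gt0.
  move=> d' /andP[d'0]; rewrite le_min => /andP[dr]; rewrite ler_pdivlMr ?mulr_gt0// => de.
  move=> w w' wz wz'.
  have E x y : (F x - F y - T (x - y)) 0 i =
      (F x 0 i - T x 0 i) - (F y 0 i - T y 0 i).
    have -> : T (x - y) = T x - T y.
      by rewrite -[- y]scaleN1r (hasDD _ _ HF0) (hasDZ _ _ HF0) scaleN1r.
    by rewrite !mxE; ring.
  rewrite E.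
  have HH x : nrm (x - z0) < d' -> hasD (fun w => F w 0 i - T w 0 i) x
      (fun h => 'd (fun w => F w 0 i : C) x h - T h 0 i) /\ forall v,
      cn ('d (fun w => F w 0 i : C) x v - T v 0 i) <= K * d' * nrm v.
    move=> xz; have xr : nrm (x - z0) < rho / 4 by apply: lt_le_trans xz dr.
    have xr' : nrm (x - z0) < rho by lra.
    have HX := diff_hasD (HB x xr').1.
    move: HX; set X : Cn -> C := 'd _ x => HX.
    split; first exact: (hasD_sub HX (hasD_coord i (hasD_linear HF0 x))).
    move=> v; apply: le_trans (cauchy_diff rho0 HB (hasD_coord i HF0) HX xr v) _.
    apply: ler_wpM2r; first exact: nrm_ge0.
    apply: ler_pM K1 (nrm_ge0 _) _ (ltW xz).
    by rewrite lerDl.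
  have := mvt_ball HH wz wz'; move/le_trans; apply.
  apply: ler_wpM2r; first exact: nrm_ge0.
  by rewrite mulrCA mulrC mulrAC mulrC; apply: le_trans de; rewrite mulrA.
exists d => // w w' wd w'd.
apply: nrm_leP; first by rewrite mulr_ge0 ?nrm_ge0 ?(ltW e0).
by move=> i; apply: (dP d) => //; rewrite d0/=.
Qed.

(** * Jacobian determinants and local scaling of the outer measure *)

Definition jacmx (F : Cn -> Cn) z : 'M[C]_n.+1 := lin1_mx ('d F z).

Definition jacdet F z : C := \det (jacmx F z).

Lemma jacmxE F z v : v *m jacmx F z = 'd F z v.
Proof. exact: mul_rV_lin1. Qed.

Lemma jacmx_comp F G z : differentiable F z -> differentiable G (F z) ->
  (\forall w \near z, G (F w) = w) -> jacmx F z *m jacmx G (F z) = 1%:M.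
Proof.
move=> dF dG /nbhs_nrmP[d d0 GF].
have HF := diff_hasD dF; have HG := diff_hasD dG.
have H1 : hasD id z (fun v => 'd G (F z) ('d F z v)).
  exact: hasD_near d0 GF (hasD_comp HF HG).
have H2 : hasD (id : Cn -> Cn) z id.
  by have := hasD_shift 0 z; apply: hasD_near d0 _ => y _; rewrite addr0.
have H := hasD_unique H1 H2.
apply/row_matrixP => i; rewrite !rowE !mulmxA !jacmxE mulmx1.
exact: (congr1 (fun f : Cn -> Cn => f (delta_mx 0 i)) H).
Qed.

(** The entries are derivatives of the coordinates of F, holomorphic by [holo_deriv], and the
    determinant is a polynomial in them. *)
Lemma jacdet_differentiable Omega F : open Omega -> holomorphic Omega F ->
  holomorphic Omega (jacdet F).
Proof.
move=> oO hF.
have dent z i j : Omega z -> exists A, hasD (fun x => jacmx F x i j : C) z A.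
  move=> Oz; have := holo_deriv (delta_mx 0 i) oO (holo_coord j hF) Oz.
  move=> /diff_hasD H.
  have [d d0 dP] := open_nrmP oO Oz; eexists; apply: hasD_near d0 _ H => y /dP Oy.
  have [_ E] := hasD_diff (hasD_coord j (diff_hasD (hF _ Oy))).
  by rewrite E /jacmx mxE.
have dsum z J (r : seq J) (P : pred J) (f : J -> Cn -> C) :
    (forall j, exists A, hasD (f j) z A) ->
    exists A, hasD (fun x => \sum_(j <- r | P j) f j x) z A.
  move=> H; elim: r => [|j r [A HA]].
    exists (fun=> 0).
    by apply: hasD_near ltr01 _ (hasD_cst 0 z) => y _; rewrite big_nil.
  have [B HB] := H j; case: (boolP (P j)) => Pj.
    by eexists; apply: hasD_near ltr01 _ (hasD_add HB HA) => y _; rewrite big_cons Pj.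
  by exists A; apply: hasD_near ltr01 _ HA => y _; rewrite big_cons (negbTE Pj).
have dprod z J (r : seq J) (P : pred J) (f : J -> Cn -> C) :
    (forall j, exists A, hasD (f j) z A) ->
    exists A, hasD (fun x => \prod_(j <- r | P j) f j x) z A.
  move=> H; elim: r => [|j r [A HA]].
    exists (fun=> 0).
    by apply: hasD_near ltr01 _ (hasD_cst (1 : C) z) => y _; rewrite big_nil.
  have [B HB] := H j; case: (boolP (P j)) => Pj.
    by eexists; apply: hasD_near ltr01 _ (hasD_mul HB HA) => y _; rewrite big_cons Pj.
  by exists A; apply: hasD_near ltr01 _ HA => y _; rewrite big_cons (negbTE Pj).
move=> z Oz; apply/differentiable_hasD; rewrite /jacdet /determinant.
apply: dsum => s; have [A HA] := dprod z _ (index_enum _) xpredT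
  (fun i x => jacmx F x i (s i)) (fun i => dent z i (s i) Oz).
by eexists; exact: hasD_cmul HA.
Qed.

Lemma nrm_mulmx_bound (S : 'M[C]_n.+1) :
  exists2 c : R, 0 < c & forall h : Cn, nrm (h *m S) <= c * nrm h.
Proof.
have S0 : 0 <= \sum_i \sum_j cn (S j i).
  by apply: sumr_ge0 => i _; apply: sumr_ge0 => j _; exact: cn_ge0.
exists (\sum_i \sum_j cn (S j i) + 1) => [|h]; first by rewrite ltr_wpDl.
have h0 := nrm_ge0 h.
apply: nrm_leP => [|i]; first by rewrite mulr_ge0// addr_ge0.
rewrite mxE -nrmc; apply: le_trans (ler_nrm_sum _ _ _) _.
apply: (@le_trans _ _ (\sum_j cn (S j i) * nrm h)).
  apply: ler_sum => j _; rewrite nrmc Normc.normcM mulrC.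
  by rewrite ler_wpM2l ?cn_ge0// nrm_coord.
rewrite -mulr_suml; apply: ler_wpM2r h0 _ _ _; apply: ler_wpDr => //.
rewrite [leRHS](bigD1 i)//= lerDl.
by apply: sumr_ge0 => k _; apply: sumr_ge0 => j _; exact: cn_ge0.
Qed.

(** On a cube of side s near z0, F followed by the inverse of its differential T is a translation up
    to an error eta s in each real coordinate, so the image of the cube lies in the image under T of
    a translated cube of side (1 + 2 eta) s. By [cubes_suffice] cubes are enough, and eta is chosen
    with (1 + 2 eta)^(2n + 2) <= q. *)
Lemma local_scale Omega (F : Cn -> Cn) z0 (q : R) : open Omega -> holomorphic Omega F ->
  Omega z0 -> jacmx F z0 \in unitmx -> 1 < q -> exists2 d : R, 0 < d &
  forall A, (forall z, A z -> nrm (z - z0) < d) ->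
    (L (F @` A) <= (q * cn (jacdet F z0) ^+ 2)%:E * L A)%E.
Proof.
move=> oO hF O0 Tu q1.
set T := jacmx F z0 in Tu *.
have [c c0 cP] := nrm_mulmx_bound (invmx T).
have [eta eta0 etaP] : exists2 eta : R, 0 < eta & (1 + 2 * eta) ^+ #|{: I}| <= q.
  have cont : {for 0, continuous (fun x : R => \prod_(i : I) (1 + 2 * x))}.
    apply: continuous_prodr => i.
    by apply: continuousD; [exact: cst_continuous|exact: mulrl_continuous].
  have : \forall x \near (0 : R), \prod_(i : I) (1 + 2 * x) < q.
    apply: (cvgr_lt _ cont) => //.
    by rewrite big1// => i _; rewrite mulr0 addr0.
  move=> /nbhs_ballP[x /= x0 xP]; exists (x / 2); first by rewrite divr_gt0.
  rewrite -prodr_const ltW//; apply: xP.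
  by rewrite /ball /= sub0r normrN gtr0_norm ?divr_gt0// ltr_pdivrMr// ltr_pMr// ltr1n.
(* Two points of a cube of side s are at distance less than 2 s, and the inverse of T enlarges norms
   by at most c. *)
pose e := eta / (2 * c).
have e0 : 0 < e by rewrite divr_gt0// mulr_gt0.
have [d d0 dP] := holo_strict oO hF O0 e0.
exists d => // A AB.
have J0 : 0 < cn (jacdet F z0) by rewrite cn_gt0 -unitfE -unitmxE.
set k := q * _.
have k0 : 0 < k by rewrite mulr_gt0 ?exprn_gt0// (lt_trans ltr01).
pose B : set Cn := [set z | nrm (z - z0) < d].
have AE : A `&` B = A by apply/setIidl => z; exact: AB.
rewrite -{1}AE.
apply: (@subadd_dominated _ _ (fun A => L (F @` (A `&` B))) k) => //.
  exact: subadd_image.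
apply: cubes_suffice (subadd_image _ _) (ltW k0) _ => a s s0.
have [[w' [Qw' Bw']]|ne] := pselect (exists w', rbox a (fun c => a c + s) w' /\ B w'); last first.
  rewrite (_ : rbox _ _ `&` B = set0).
    rewrite image_set0 lebesgue_outer0 lee_fin.
    by apply: mulr_ge0 (ltW k0) _; rewrite exprn_ge0 ?(ltW s0).
  by apply/seteqP; split=> // w Bw; case: ne; exists w.
(* The translation by p agrees at w' with F followed by the inverse of T. *)
set p := F w' *m invmx T - w'.
pose Q := rbox (fun c => a c - eta * s) (fun c => a c + s + eta * s).
have sub : F @` (rbox a (fun c => a c + s) `&` B) `<=`
    (fun z => z *m T) @` ((fun z => p + z) @` Q).
  move=> _ [w [Qw Bw] <-].
  exists (F w *m invmx T); last by rewrite mulmxKV.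
  exists (F w *m invmx T - p); last by rewrite addrC subrK.
  have ws : nrm (w - w') < 2 * s.
    apply: nrm_rbox => [|j]; first by rewrite mulr_gt0.
    have /andP[h1 h2] := Qw j; have /andP[h3 h4] := Qw' j.
    by rewrite ltr_norml; lra.
  have E : F w *m invmx T - p = w + (F w - F w' - 'd F z0 (w - w')) *m invmx T.
    rewrite -jacmxE !mulmxBl !mulmxK// /p.
    by apply/rowP => j; rewrite !mxE; ring.
  rewrite E => j; rewrite crdD.
  have := dP w w' Bw Bw'; set D := F w - F w' - _ => HD.
  have : `|crd j (D *m invmx T)| <= eta * s.
    apply: le_trans (crd_nrm _ _) _; apply: le_trans (cP _) _.
    apply: (@le_trans _ _ (c * (e * (2 * s)))).
      rewrite ler_pM2l//; apply: le_trans HD _.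
      by rewrite ler_pM2l// ltW.
    by rewrite /e; apply: le_of_eq; field; rewrite gt_eqF.
  rewrite ler_norml => /andP[h1 h2]; have /andP[h3 h4] := Qw j.
  by apply/andP; split; lra.
apply: le_trans (le_lebesgue_outer sub) _.
have [_ H] := outer_scales_mulmx Tu.
apply: le_trans (H _) _.
have -> : k * s ^+ #|{: I}| = cn (\det T) ^+ 2 * (q * s ^+ #|{: I}|).
  by rewrite /k /jacdet; ring.
rewrite [leRHS]EFinM; apply: lee_wpmul2l; first by rewrite lee_fin exprn_ge0 ?cn_ge0.
apply: le_trans (outer_shift _ _) _; apply: le_trans (outer_rbox _ _) _.
rewrite lee_fin /rvol.
rewrite (eq_bigr (fun=> (1 + 2 * eta) * s)) => [|j _]; last first.
  rewrite max_r; first by ring.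
  rewrite (_ : _ - _ = s + 2 * (eta * s)); last by ring.
  by rewrite addr_ge0 ?mulr_ge0 ?(ltW s0) ?(ltW eta0).
by rewrite prodr_const exprMn ler_wpM2r ?exprn_ge0 ?(ltW s0).
Qed.

(** * Measurable functions and the integral formula *)

Lemma continuous_measurable_CnL Omega (f : Cn -> R) : open Omega ->
  (forall z, Omega z -> forall e : R, 0 < e ->
    exists2 d : R, 0 < d & forall w, nrm (w - z) < d -> `|f w - f z| < e) ->
  measurable_fun (Omega : set (CnL R n)) (f : CnL R n -> R).
Proof.
move=> oO cf; have mO := open_measurable_CnL oO.
apply: (measurability _ (measurable_realfun.RGenOInfty.measurableE R)) => //.
move=> _ [_ [x ->] <-]; apply: open_measurable_CnL.
rewrite openE => z [Oz]; rewrite /= in_itv/= andbT => xf.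
have [d d0 dP] := open_nrmP oO Oz.
have fx : 0 < f z - x by rewrite subr_gt0.
have [d' d'0 dP'] := cf z Oz _ fx.
apply/nbhs_nrmP; exists (minr d d'); first by rewrite lt_min d0.
move=> w; rewrite lt_min => /andP[/dP Ow /dP']; rewrite ltr_norml => /andP[h _].
by split => //; rewrite /= in_itv/= andbT; lra.
Qed.

Definition cmeasurable (Omega : set Cn) (u : Cn -> C) : Prop :=
  lebesgue_measurable Omega (fun z => Re (u z)) /\
  lebesgue_measurable Omega (fun z => Im (u z)).

Lemma holo_cmeasurable Omega (f : Cn -> C) : open Omega -> holomorphic Omega f ->
  cmeasurable Omega f.
Proof.
move=> oO hf; split; apply: continuous_measurable_CnL oO _ => z Oz e e0;
  have [d d0 dP] := hasD_continuous (diff_hasD (hf _ Oz)) e0;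
  exists d => // w /dP; apply: le_lt_trans.
  by rewrite -cReB nrmc; exact: ler_Re_cn.
by rewrite -cImB nrmc; exact: ler_Im_cn.
Qed.

Lemma cmeasurable_cn2 Omega u : cmeasurable Omega u ->
  lebesgue_measurable Omega (fun z => cn (u z) ^+ 2).
Proof.
move=> [mR mI]; under eq_fun do rewrite cn_sqr.
by apply: measurable_funD; exact: measurable_funX.
Qed.

Lemma cmeasurableD Omega u v : cmeasurable Omega u -> cmeasurable Omega v ->
  cmeasurable Omega (fun z => u z + v z).
Proof.
move=> [uR uI] [vR vI]; split.
  by under eq_fun do rewrite cReD; exact: measurable_funD.
by under eq_fun do rewrite cImD; exact: measurable_funD.
Qed.

Lemma cmeasurableM Omega u v : cmeasurable Omega u -> cmeasurable Omega v ->
  cmeasurable Omega (fun z => u z * v z).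
Proof.
move=> [uR uI] [vR vI]; split.
  by under eq_fun do rewrite cReM; apply: measurable_funB; exact: measurable_funM.
by under eq_fun do rewrite cImM; apply: measurable_funD; exact: measurable_funM.
Qed.

Lemma cmeasurable_conj Omega f : cmeasurable Omega (fun z => conjc (f z)) ->
  cmeasurable Omega f.
Proof.
move=> [mR mI]; split; first by apply: eq_measurable_fun mR => z _; case: (f z).
have : lebesgue_measurable Omega (fun z => - Im (conjc (f z))).
  exact: measurable_funN.
by apply: eq_measurable_fun => z _; case: (f z) => a b /=; rewrite opprK.
Qed.

Lemma cmeasurable_real Omega m : lebesgue_measurable Omega m ->
  cmeasurable Omega (fun z => (m z)%:C).
Proof. by move=> mm; split => //; exact: measurable_cst. Qed.

(** On each piece the integrals are compared with constants: the integral of f is at most a times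
    the measure of the image, hence at most a b times the measure of the piece, hence at most the
    integral of g. The pieces of Omega' are preimages under G, with known measurability; images
    under F enter through the outer measure only. Both families are made disjoint in the same order,
    so they still correspond. *)
Lemma cover_integral_le (Omega Omega' : set Cn) (F G : Cn -> Cn) (f g : Cn -> R)
    (U : nat -> set Cn) :
  (forall w, Omega' w -> Omega (G w) /\ F (G w) = w) ->
  (forall k, measurable (U k : set (CnL R n))) ->
  (forall k, measurable (Omega' `&` G @^-1` (U k) : set (CnL R n))) ->
  Omega = \bigcup_k U k ->
  lebesgue_measurable Omega' f -> lebesgue_measurable Omega g ->
  (forall w, Omega' w -> 0 <= f w) -> (forall z, Omega z -> 0 <= g z) ->
  (forall k, exists a b : R, [/\ 0 <= a, 0 <= b,
    forall A, A `<=` U k -> (L (F @` A) <= b%:E * L A)%E &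
    forall z, U k z -> f (F z) <= a /\ a * b <= g z]) ->
  (\int[lebesgue]_(w in Omega') (f w)%:E <= \int[lebesgue]_(z in Omega) (g z)%:E)%E.
Proof.
move=> GF mU mU' OU mf mg f0 g0 H.
have EI (E : set (CnL R n)) (V : nat -> set (CnL R n)) (h : CnL R n -> R) : E = \bigcup_k V k ->
    (forall k, measurable (V k)) -> measurable_fun E h -> (forall w, E w -> 0 <= h w) ->
    (\int[lebesgue]_(w in E) (h w)%:E =
     \sum_(k <oo) \int[lebesgue]_(w in seqDU V k) (h w)%:E)%E.
  move=> -> mV; rewrite (seqDU_bigcup_eq V) => mh h0.
  have mh' : measurable_fun (\bigcup_k seqDU V k) (EFin \o h) by exact/measurable_EFinP.
  exact: (ge0_integral_bigcup lebesgue (seqDU_measurable mV) mh' h0 (trivIset_seqDU V)).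
pose U' k := Omega' `&` G @^-1` (U k).
have OU' : Omega' = \bigcup_k U' k.
  apply/seteqP; split=> [w Ow|w [k _ []]//].
  have [] := GF _ Ow; rewrite {1}OU => -[k _ Uk] _; by exists k.
have mD := seqDU_measurable mU; have mD' := seqDU_measurable mU'.
have sD k : seqDU U k `<=` Omega.
  by move=> z Dz; have Uk := subset_seqDU Dz; rewrite OU; exists k.
have sD' k : seqDU U' k `<=` Omega'.
  by move=> z Dz; have Uk := subset_seqDU Dz; rewrite OU'; exists k.
have mO' : measurable (Omega' : set (CnL R n)) by rewrite OU'; exact: bigcupT_measurable.
have mO : measurable (Omega : set (CnL R n)) by rewrite OU; exact: bigcupT_measurable.
have mEf : measurable_fun (Omega' : set (CnL R n)) (EFin \o (f : CnL R n -> R)).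
  exact/measurable_EFinP.
have mEg : measurable_fun (Omega : set (CnL R n)) (EFin \o (g : CnL R n -> R)).
  exact/measurable_EFinP.
rewrite (EI _ _ _ OU' mU' mf f0) (EI _ _ _ OU mU mg g0).
apply: lee_nneseries => [k _ _|k _].
  by apply: integral_ge0 => w /sD' /f0; rewrite lee_fin.
have [a [b [a0 b0 HL Hfg]]] := H k.
have sub : seqDU U' k `<=` F @` seqDU U k.
  move=> w [[Ow Uw] nw]; exists (G w); last by have [] := GF _ Ow.
  split => // Gw; apply: nw; move: Gw; rewrite -!bigcup_mkord => -[j jk Uj].
  by exists j.
apply: (@le_trans _ _ (\int[lebesgue]_(w in seqDU U' k) a%:E)%E).
  apply: ge0_le_integral => //.
  - by move=> w Dw; rewrite lee_fin f0//; exact: sD' Dw.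
  - exact: measurable_funS mO' (@sD' k) mEf.
  - move=> w /sub[z Dz <-]; rewrite lee_fin.
    by have [] := Hfg z (subset_seqDU Dz).
apply: (@le_trans _ _ (\int[lebesgue]_(w in seqDU U k) (a * b)%:E)%E); last first.
  apply: ge0_le_integral => //.
  - by move=> z _; rewrite lee_fin mulr_ge0.
  - exact: measurable_funS mO (@sD k) mEg.
  - move=> z Dz; rewrite lee_fin.
    by have [] := Hfg z (subset_seqDU Dz).
rewrite !integral_cst// EFinM -muleA; apply: lee_wpmul2l; first by rewrite lee_fin.
apply: le_trans (le_lebesgue_outer sub) _.
exact: (HL _ (@subset_seqDU _ _ _)).
Qed.

Definition biholo_pair (Omega Omega' : set Cn) (F G : Cn -> Cn) :=
  [/\ open Omega, open Omega', holomorphic Omega F, holomorphic Omega' G &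
   (forall z, Omega z -> Omega' (F z) /\ G (F z) = z) /\
   (forall w, Omega' w -> Omega (G w) /\ F (G w) = w)].

Lemma biholo_pairC Omega Omega' F G :
  biholo_pair Omega Omega' F G -> biholo_pair Omega' Omega G F.
Proof. by move=> [? ? ? ? [? ?]]; split. Qed.

Lemma biholo_jac Omega Omega' F G z : biholo_pair Omega Omega' F G -> Omega z ->
  jacmx F z \in unitmx /\ jacdet F z * jacdet G (F z) = 1.
Proof.
move=> [oO oO' hF hG [H1 H2]] Oz; have [Oz' E] := H1 _ Oz.
have J : jacmx F z *m jacmx G (F z) = 1%:M.
  apply: jacmx_comp; [exact: hF|exact: hG|].
  have [d d0 dP] := open_nrmP oO Oz.
  by apply/nbhs_nrmP; exists d => // w /dP Ow; have [] := H1 _ Ow.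
by rewrite (mulmx1_unit J).1 /jacdet -det_mulmx J det1.
Qed.

Lemma measurable_preimage_rbox Omega (G : Cn -> Cn) a b : open Omega ->
  holomorphic Omega G -> measurable (Omega `&` G @^-1` (rbox a b) : set (CnL R n)).
Proof.
move=> oO hG; have mO := open_measurable_CnL oO.
have -> : Omega `&` G @^-1` (rbox a b) = \bigcap_(c in [set: I])
    (Omega `&` (fun z => crd c (G z)) @^-1` `]a c, b c]).
  apply/seteqP; split=> [z [Oz H] c _|z H].
    by split => //; rewrite /= in_itv/=; exact: H.
  split; first by have [] := H (ord0, true) Logic.I.
  by move=> c; have [_] := H c Logic.I; rewrite /= in_itv.
apply: fin_bigcap_measurable; first exact: finite_finset.
move=> c _; have [mR mI] := holo_cmeasurable oO (holo_coord c.1 hG).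
by rewrite /crd; case: c.2; [apply: mI|apply: mR]; try exact: measurable_itv.
Qed.

(** With p = 1 / q the hypotheses give b >= (1 + p) / 2 a, and ((1 + p) / 2)^2 >= p. *)
Lemma sqr_le_near (q a b c : R) : 1 < q -> 0 <= a -> 0 <= b ->
  c < (1 - q^-1) / 2 * a -> a <= b + c -> a ^+ 2 <= q * b ^+ 2.
Proof.
move=> q1 a0 b0 h2 h1; have q0 : 0 < q by apply: lt_trans q1.
have p0 : 0 < q^-1 by rewrite invr_gt0.
have p1 : q^-1 < 1 by rewrite invf_lt1.
rewrite -ler_pdivrMl//; move: (q^-1) p0 p1 h2 => p p0 p1 h2.
have p2 : 0 <= (1 + p) / 2 by lra.
have h3 : (1 + p) / 2 * a <= b by lra.
apply: (@le_trans _ _ (((1 + p) / 2 * a) ^+ 2)); last by apply: lerXn2r => //; exact: mulr_ge0.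
rewrite exprMn; apply: ler_wpM2r; first exact: exprn_ge0.
rewrite -subr_ge0 (_ : _ - _ = ((1 - p) / 2) ^+ 2); last by field.
exact: sqr_ge0.
Qed.

(** The three factors q account for the local scaling by F, for the oscillation of the Jacobian and
    for that of f o F on a slice. Rational boxes and rational levels make the slices countable. *)
Lemma change_of_variables_le Omega Omega' F G (f : Cn -> R) (q : R) :
  biholo_pair Omega Omega' F G -> 1 < q ->
  lebesgue_measurable Omega' f -> lebesgue_measurable Omega (fun z => f (F z)) ->
  (forall w, Omega' w -> 0 <= f w) ->
  (\int[lebesgue]_(w in Omega') (f w)%:E <=
   (q ^+ 3)%:E * \int[lebesgue]_(z in Omega) (f (F z) * cn (jacdet F z) ^+ 2)%:E)%E.
Proof.
move=> FG q1 mf mfF f0; have [oO oO' hF hG [H1 H2]] := FG.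
have mO := open_measurable_CnL oO.
have q0 : 0 < q by apply: lt_trans q1.
have mJ := cmeasurable_cn2 (holo_cmeasurable oO (jacdet_differentiable oO hF)).
have mg : lebesgue_measurable Omega (fun z => f (F z) * cn (jacdet F z) ^+ 2).
  exact: measurable_funM.
have g0 z : Omega z -> 0 <= f (F z) * cn (jacdet F z) ^+ 2.
  by move=> /H1[Oz _]; rewrite mulr_ge0 ?f0// exprn_ge0 ?cn_ge0.
rewrite -ge0_integralZl_EFin//; first last.
- by rewrite exprn_ge0 ?ltW.
- exact/measurable_EFinP.
pose T : countType := (({ffun I -> rat} * {ffun I -> rat}) * rat)%type.
pose good (t : T) := [/\ ratbox t.1 `<=` Omega, 0 <= ratr t.2 :> R &
  exists j : R, [/\ 0 <= j,
   (forall A, A `<=` ratbox t.1 -> (L (F @` A) <= (q * j)%:E * L A)%E) &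
   forall z, ratbox t.1 z -> j <= q * cn (jacdet F z) ^+ 2]].
(* On a good slice both f o F and the Jacobian are controlled up to a factor q. *)
pose slice (t : T) : set Cn := ratbox t.1 `&`
  (Omega `&` (fun z => f (F z)) @^-1` `[ratr t.2, q * ratr t.2]).
pose U (k : nat) : set Cn := if unpickle k is Some t then
  (if pselect (good t) then slice t else set0) else set0.
have UP k z : U k z -> exists t, [/\ good t, U k = slice t & slice t z].
  by rewrite /U; case: unpickle => // t; case: pselect => // gt Ut; exists t.
apply: (@cover_integral_le Omega Omega' F G f _ U) => //.
- move=> k; rewrite /U; case: unpickle => [t|]; last exact: measurable0.
  case: pselect => [gt|ngt] /=; last exact: measurable0.
  apply: measurableI; first exact: measurable_rbox.
  by apply: mfF => //; exact: measurable_itv.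
- move=> k; rewrite /U; case: unpickle => [t|]; last by rewrite preimage_set0 setI0; exact: measurable0.
  case: pselect => [gt|ngt] /=; last by rewrite preimage_set0 setI0; exact: measurable0.
  have -> : Omega' `&` G @^-1` slice t = (Omega' `&` G @^-1` ratbox t.1) `&`
      (Omega' `&` f @^-1` `[ratr t.2, q * ratr t.2]).
    apply/seteqP; split=> [w [Ow [rw [_ fw]]]|w [[Ow rw] [_ fw]]].
      by split; split => //; move: fw; rewrite /preimage/= (H2 _ Ow).2.
    have [OG E] := H2 _ Ow.
    by split => //; split => //; split => //; rewrite /preimage/= E.
  apply: measurableI; first exact: measurable_preimage_rbox.
  by apply: mf; [exact: open_measurable_CnL|exact: measurable_itv].
- apply/seteqP; split=> [z Oz|z [k _ /UP[t [_ _ [_ []]]]]//].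
  have [Ju _] := biholo_jac FG Oz.
  have [d d0 dP] := local_scale oO hF Oz Ju q1.
  have J0 : 0 < cn (jacdet F z) ^+ 2 by rewrite exprn_gt0// cn_gt0 -unitfE -unitmxE.
  have [d' d'0 dP'] : exists2 d' : R, 0 < d' & forall w, nrm (w - z) < d' ->
      cn (jacdet F z) ^+ 2 <= q * cn (jacdet F w) ^+ 2.
    have e0 : 0 < (1 - q^-1) / 2 * cn (jacdet F z).
      by rewrite mulr_gt0 ?divr_gt0 ?subr_gt0 ?invf_lt1// cn_gt0 -unitfE -unitmxE.
    have [d1 d10 d1P] := hasD_continuous (diff_hasD (jacdet_differentiable oO hF Oz)) e0.
    exists d1 => // w /d1P; rewrite nrmc => h.
    apply: sqr_le_near q1 (cn_ge0 _) (cn_ge0 _) h _.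
    have tri (a b : C) : cn a <= cn b + cn (b - a).
      by rewrite cn_distC addrC -{1}(subrK b a) ler_cnD.
    exact: tri.
  have [d'' d''0 dP''] := open_nrmP oO Oz.
  pose S : set Cn := [set w | nrm (w - z) < minr d (minr d' d'')].
  have nS : nbhs z S.
    by apply/nbhs_nrmP; exists (minr d (minr d' d'')) => //; rewrite !lt_min d0 d'0.
  have [t tz tS] := ratbox_base (open_interior S) nS.
  have tS' w : ratbox t w -> [/\ nrm (w - z) < d, nrm (w - z) < d' & nrm (w - z) < d''].
    by move=> /tS/interior_subset; rewrite /S/= !lt_min => /and3P[].
  (* Where f o F vanishes the level is 0; elsewhere it is a rational number between f / q and f. *)
  have [r r0 rP] : exists2 r : rat, 0 <= ratr r :> R & ratr r <= f (F z) <= q * ratr r.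
    have := f0 _ (H1 _ Oz).1; rewrite le_eqVlt => /orP[/eqP <-|fz].
      by exists 0; rewrite rmorph0 ?mulr0 lexx.
    have : f (F z) / q < f (F z) by rewrite ltr_pdivrMr// ltr_pMr.
    move=> /rat_in_itvoo[r]; rewrite in_itv/= ltr_pdivrMr// mulrC => /andP[h1 h2].
    exists r; last by rewrite !ltW.
    by rewrite -(pmulr_rge0 _ q0) (le_trans (ltW fz) (ltW h1)).
  exists (pickle ((t, r) : T)); first by [].
  rewrite /U pickleK; case: pselect => [gt|[]] /=; first by split => //; split => //; rewrite /= in_itv.
  split => //.
    by move=> w /tS'[_ _ /dP''].
  exists (cn (jacdet F z) ^+ 2); split; first exact: ltW.
    by move=> A At; apply: dP => w /At/tS'[].
  by move=> w /tS'[_ /dP'].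
- by apply: measurable_funM => //; exact: measurable_cst.
- by move=> z /g0 gz; rewrite mulr_ge0// exprn_ge0// ltW.
move=> k; have [[z Uz]|nU] := pselect (exists z, U k z); last first.
  exists 0, 0; split => //.
    by move=> A AU; rewrite (_ : A = set0) ?image_set0 ?lebesgue_outer0 ?mule0// -subset0 => w /AU Uw; apply: nU; exists w.
  by move=> z Uz; case: nU; exists z.
have [t [[tO r0 [j [j0 jL jJ]]] -> _]] := UP _ _ Uz.
exists (q * ratr t.2), (q * j); split; [by rewrite mulr_ge0// ltW|by rewrite mulr_ge0// ltW| |].
  by move=> A At; apply: jL => w /At[].
move=> w [tw [Ow]]; rewrite /= in_itv/= => /andP[h1 h2]; split => //.
have := jJ _ tw; move: (cn _ ^+ 2) (f (F w)) h1 h2 => J fw h1 h2 hJ.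
have -> : q ^+ 3 * (fw * J) = q ^+ 2 * (fw * (q * J)) by ring.
have -> : q * ratr t.2 * (q * j) = q ^+ 2 * (ratr t.2 * j) by ring.
by rewrite ler_pM2l ?exprn_gt0// ler_pM.
Qed.

(** Letting q tend to 1 gives one inequality. The other one is the same inequality for G and the
    integrand (f o F) |det F'|^2, because the two Jacobians are inverse to each other. *)
Lemma change_of_variables_ge0 Omega Omega' F G (f : Cn -> R) :
  biholo_pair Omega Omega' F G ->
  lebesgue_measurable Omega' f -> lebesgue_measurable Omega (fun z => f (F z)) ->
  (forall w, Omega' w -> 0 <= f w) ->
  (\int[lebesgue]_(w in Omega') (f w)%:E =
   \int[lebesgue]_(z in Omega) (f (F z) * cn (jacdet F z) ^+ 2)%:E)%E.
Proof.
move=> FG0 mf0 mfF0 f00.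
have le (O O' : set Cn) (K H : Cn -> Cn) (h : Cn -> R) : biholo_pair O O' K H ->
  lebesgue_measurable O' h -> lebesgue_measurable O (fun z => h (K z)) ->
  (forall w, O' w -> 0 <= h w) ->
  (\int[lebesgue]_(w in O') (h w)%:E <=
   \int[lebesgue]_(z in O) (h (K z) * cn (jacdet K z) ^+ 2)%:E)%E.
  move=> KH mh mhK h0.
  have := change_of_variables_le KH _ mh mhK h0.
  have : (0 <= \int[lebesgue]_(z in O) (h (K z) * cn (jacdet K z) ^+ 2)%:E)%E.
    have [_ _ _ _ [H1 _]] := KH.
    apply: integral_ge0 => z /H1[Oz _]; rewrite lee_fin mulr_ge0 ?exprn_ge0 ?cn_ge0//.
    exact: h0.
  case: (\int[lebesgue]_(z in O) _)%E => [r| |]//; last by move=> _ _; exact: leey.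
  move=> _ le; have -> : r = (1 + 0) ^+ 3 * r by rewrite addr0 expr1n mul1r.
  apply: (@lee_lim0 _ _ (fun s => (1 + s) ^+ 3 * r)).
    apply: continuousM; last exact: cst_continuous.
    apply: (@continuous_comp _ _ _ (fun s : R => 1 + s) (fun x => x ^+ 3)).
      by apply: continuousD; [exact: cst_continuous|].
    exact: exprn_continuous.
  by move=> s s0; rewrite EFinM; apply: le; rewrite ltrDl.
apply/eqP; rewrite eq_le (le _ _ _ _ _ FG0 mf0 mfF0 f00)/=.
have [oO oO' hF hG [H1 H2]] := FG0.
have mJ := cmeasurable_cn2 (holo_cmeasurable oO (jacdet_differentiable oO hF)).
have E w : Omega' w -> f (F (G w)) * cn (jacdet F (G w)) ^+ 2 * cn (jacdet G w) ^+ 2 = f w.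
  move=> Ow; have [OG FGw] := H2 _ Ow.
  have [_] := biholo_jac FG0 OG; rewrite FGw => J.
  by rewrite -mulrA -exprMn -Normc.normcM J Normc.normc1 expr1n mulr1.
apply: le_trans (le _ _ _ _ _ (biholo_pairC FG0) _ _ _) _.
- exact: measurable_funM.
- apply: (@eq_measurable_fun _ _ _ _ (Omega' : set (CnL R n))
    (fun w : CnL R n => f w * cn (jacdet F (G w)) ^+ 2)).
    by move=> w; rewrite inE => Ow; rewrite (H2 _ Ow).2.
  apply: measurable_funM mf0 _.
  have hJG : holomorphic Omega' (fun w => jacdet F (G w)).
    move=> w Ow; apply/differentiable_hasD; eexists.
    apply: hasD_comp (diff_hasD (hG _ Ow)) (diff_hasD _).
    exact: jacdet_differentiable oO hF _ (H2 _ Ow).1.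
  exact: cmeasurable_cn2 (holo_cmeasurable oO' hJG).
- by move=> z /H1[Oz _]; rewrite mulr_ge0 ?exprn_ge0 ?cn_ge0 ?f00.
apply: le_of_eq; apply: eq_integral => w; rewrite inE => Ow.
by rewrite E.
Qed.

Lemma change_of_variables Omega Omega' F G (f : Cn -> R) :
  biholo_pair Omega Omega' F G ->
  lebesgue_measurable Omega' f -> lebesgue_measurable Omega (fun z => f (F z)) ->
  (\int[lebesgue]_(w in Omega') (f w)%:E =
   \int[lebesgue]_(z in Omega) (f (F z) * cn (jacdet F z) ^+ 2)%:E)%E.
Proof.
move=> FG mf mfF; rewrite [LHS]integralE [RHS]integralE.
have pn (x j : R) : 0 <= j -> maxr (x * j) 0 = maxr x 0 * j.
  by move=> j0; rewrite maxr_pMl// mul0r.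
congr (_ - _)%E.
  transitivity (\int[lebesgue]_(w in Omega') (maxr (f w) 0)%:E)%E.
    by apply: eq_integral => w _; rewrite funeposE EFin_max.
  rewrite (change_of_variables_ge0 FG) => [|||w _].
  - apply: eq_integral => z _.
    by rewrite funeposE -pn ?exprn_ge0 ?cn_ge0// EFin_max.
  - exact: measurable_funrpos.
  - exact: measurable_funrpos.
  - by rewrite le_max lexx orbT.
transitivity (\int[lebesgue]_(w in Omega') (maxr (- f w) 0)%:E)%E.
  by apply: eq_integral => w _; rewrite funenegE EFin_max.
rewrite (change_of_variables_ge0 FG) => [|||w _].
- apply: eq_integral => z _.
  by rewrite funenegE -pn ?exprn_ge0 ?cn_ge0// mulNr EFin_max.
- exact: measurable_funrneg.
- exact: measurable_funrneg.
- by rewrite le_max lexx orbT.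
Qed.

End ChangeOfVariables.

(** * Weighted square-integrable functions *)

Section WeightedSpace.
Context {R : realType} {n : nat}.
Local Notation C := R[i].
Local Notation Cn := 'rV[R[i]]_n.+1.

Context {Omega : set Cn} {mu : Cn -> R}.
Hypotheses (oO : open Omega) (wmu : weight Omega mu).
Local Notation sq := (sqnorm Omega mu).
Local Notation sqf := (fun u z => (cn (u z) ^+ 2 * mu z)).

Lemma ge0_int_le (f g : Cn -> R) : lebesgue_measurable Omega f ->
  lebesgue_measurable Omega g -> (forall z, Omega z -> 0 <= f z <= g z) ->
  (\int[lebesgue]_(z in Omega) (f z)%:E <= \int[lebesgue]_(z in Omega) (g z)%:E)%E.
Proof.
move=> mf mg fg.
have f0 (z : CnL R n) : Omega z -> (0 <= (EFin \o f) z)%E.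
  by move=> Oz; rewrite lee_fin; have /andP[] := fg z Oz.
have fg' (z : CnL R n) : Omega z -> ((EFin \o f) z <= (EFin \o g) z)%E.
  by move=> Oz; rewrite lee_fin; have /andP[] := fg z Oz.
exact: (ge0_le_integral lebesgue (open_measurable_CnL oO) f0
  (iffRL (measurable_EFinP _ _) mf) (iffRL (measurable_EFinP _ _) mg) fg').
Qed.

Lemma ge0_intZ (k : R) (f : Cn -> R) : 0 <= k -> lebesgue_measurable Omega f ->
  (forall z, Omega z -> 0 <= f z) ->
  (\int[lebesgue]_(z in Omega) (k * f z)%:E = k%:E * \int[lebesgue]_(z in Omega) (f z)%:E)%E.
Proof.
move=> k0 mf f0.
have f0' (z : CnL R n) : Omega z -> (0 <= (EFin \o f) z)%E by move=> Oz; rewrite lee_fin f0.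
exact: (ge0_integralZl_EFin lebesgue (open_measurable_CnL oO) f0'
  (iffRL (measurable_EFinP _ _) mf) k0).
Qed.

Lemma ge0_intD (f g : Cn -> R) : lebesgue_measurable Omega f ->
  lebesgue_measurable Omega g -> (forall z, Omega z -> 0 <= f z) ->
  (forall z, Omega z -> 0 <= g z) ->
  (\int[lebesgue]_(z in Omega) (f z + g z)%:E =
   \int[lebesgue]_(z in Omega) (f z)%:E + \int[lebesgue]_(z in Omega) (g z)%:E)%E.
Proof.
move=> mf mg f0 g0.
have f0' (z : CnL R n) : Omega z -> (0 <= (EFin \o f) z)%E by move=> Oz; rewrite lee_fin f0.
have g0' (z : CnL R n) : Omega z -> (0 <= (EFin \o g) z)%E by move=> Oz; rewrite lee_fin g0.
exact: (ge0_integralD lebesgue (open_measurable_CnL oO) f0'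
  (iffRL (measurable_EFinP _ _) mf) g0' (iffRL (measurable_EFinP _ _) mg)).
Qed.

Lemma weight_ge0 z : Omega z -> 0 <= mu z.
Proof. by move=> Oz; rewrite ltW// wmu.2. Qed.

Lemma sqf_ge0 u z : Omega z -> 0 <= sqf u z.
Proof. by move=> Oz; rewrite mulr_ge0 ?exprn_ge0 ?cn_ge0// weight_ge0. Qed.

Lemma measurable_sqf u : cmeasurable Omega u -> lebesgue_measurable Omega (sqf u).
Proof. by move=> mu'; exact: measurable_funM (cmeasurable_cn2 mu') wmu.1. Qed.

Lemma sq_ge0 u : (0 <= sq u)%E.
Proof. by apply: integral_ge0 => z Oz; rewrite lee_fin sqf_ge0. Qed.

Lemma eq_sq u v : (forall z, Omega z -> u z = v z) -> sq u = sq v.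
Proof. by move=> E; apply: eq_integral => z; rewrite inE => Oz; rewrite E. Qed.

Lemma sqZ u c : cmeasurable Omega u ->
  sq (fun z => c * u z) = ((cn c ^+ 2)%:E * sq u)%E.
Proof.
move=> mu'; rewrite /sqnorm -ge0_intZ; first last.
- exact: sqf_ge0.
- exact: measurable_sqf.
- by rewrite exprn_ge0 ?cn_ge0.
by apply: eq_integral => z _; rewrite Normc.normcM exprMn -(mulrA (cn c ^+ 2)).
Qed.

Lemma cn_sqrD (x y : C) : cn (x + y) ^+ 2 <= 2 * cn x ^+ 2 + 2 * cn y ^+ 2.
Proof.
have := ler_cnD x y; have := cn_ge0 (x + y); have := cn_ge0 x; have := cn_ge0 y.
move: (cn (x + y)) (cn x) (cn y) => c a b b0 a0 c0 h.
apply: (@le_trans _ _ ((a + b) ^+ 2)); first by apply: lerXn2r => //; rewrite nnegrE addr_ge0.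
by rewrite -subr_ge0 (_ : _ - _ = (a - b) ^+ 2) ?sqr_ge0//; ring.
Qed.

(** Replaces the triangle inequality of the norm without taking square roots; the geometric decay of
    the series used later absorbs the factors 2. *)
Lemma sqD u v : cmeasurable Omega u -> cmeasurable Omega v ->
  (sq (fun z => u z + v z)%R <= 2%:E * sq u + 2%:E * sq v)%E.
Proof.
move=> mu' mv; have mu2 := measurable_sqf mu'; have mv2 := measurable_sqf mv.
have m2 (w : Cn -> R) : lebesgue_measurable Omega w -> lebesgue_measurable Omega (fun z => 2 * w z).
  by move=> mw; apply: measurable_funM mw; exact: measurable_cst.
have p2 w z : Omega z -> 0 <= 2 * sqf w z by move=> Oz; rewrite mulr_ge0// sqf_ge0.
rewrite /sqnorm -(ge0_intZ (ler0n _ 2) mu2 (sqf_ge0 u)) -(ge0_intZ (ler0n _ 2) mv2 (sqf_ge0 v)).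
rewrite -(ge0_intD (m2 _ mu2) (m2 _ mv2) (p2 u) (p2 v)).
apply: ge0_int_le (measurable_sqf (cmeasurableD mu' mv)) _ _.
  exact: measurable_funD (m2 _ mu2) (m2 _ mv2).
move=> z Oz; rewrite (sqf_ge0 (fun z => u z + v z))//=.
rewrite (mulrA 2 (cn (u z) ^+ 2)) (mulrA 2 (cn (v z) ^+ 2)) -mulrDl.
by apply: ler_wpM2r; [exact: weight_ge0|exact: cn_sqrD].
Qed.

Lemma A2_measurable u : A2 Omega mu u -> cmeasurable Omega u.
Proof. by case=> _ []. Qed.

Lemma A2_intro u : holomorphic Omega u -> (sq u < +oo)%E -> A2 Omega mu u.
Proof. by move=> hu; have [] := holo_cmeasurable oO hu. Qed.

Lemma A2Z c u : A2 Omega mu u -> A2 Omega mu (fun z => c * u z).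
Proof.
move=> au; have [hu [_ _ su]] := au; apply: A2_intro.
  by move=> z Oz; apply/differentiable_hasD; eexists; exact: hasD_cmul (diff_hasD (hu _ Oz)).
by rewrite (sqZ c (A2_measurable au)) lte_mul_pinfty// ?lee_fin ?exprn_ge0 ?cn_ge0.
Qed.

Lemma A2D u v : A2 Omega mu u -> A2 Omega mu v -> A2 Omega mu (fun z => u z + v z).
Proof.
move=> au av; have [hu [_ _ su]] := au; have [hv [_ _ sv]] := av; apply: A2_intro.
  move=> z Oz; apply/differentiable_hasD; eexists.
  exact: hasD_add (diff_hasD (hu _ Oz)) (diff_hasD (hv _ Oz)).
apply: le_lt_trans (sqD (A2_measurable au) (A2_measurable av)) _.
by rewrite lte_add_pinfty// lte_mul_pinfty.
Qed.

Lemma A20 : A2 Omega mu (fun=> 0).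
Proof.
apply: A2_intro; first by move=> z Oz; apply/differentiable_hasD; eexists; exact: hasD_cst.
rewrite /sqnorm (eq_integral (fun=> 0%:E)) ?integral0//.
by move=> z _; rewrite Normc.normc0 expr0n mul0r.
Qed.

Lemma cintegral_bound (f : Cn -> C) (g : Cn -> R) :
  cmeasurable Omega f -> lebesgue_measurable Omega g ->
  (forall z, Omega z -> cn (f z) <= g z) ->
  forall M : R, (\int[lebesgue]_(z in Omega) (g z)%:E <= M%:E)%E ->
  cn (cintegral Omega f) <= 2 * M.
Proof.
move=> [mR mI] mg fg M gM; have mO := open_measurable_CnL oO.
have B (h : Cn -> R) : lebesgue_measurable Omega h -> (forall z, Omega z -> `|h z| <= g z) ->
    `|\int[lebesgue]_(z in Omega) h z| <= M.
  move=> mh hg.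
  have mh' := iffRL (measurable_EFinP _ _) mh.
  have H : (`|\int[lebesgue]_(z in Omega) (h z)%:E| <= M%:E)%E.
    apply: le_trans gM; apply: le_trans (le_abse_integral lebesgue mO mh') _.
    apply: (@ge0_int_le (fun z => `|h z|) g) => //.
      exact: (measurableT_comp (@normr_measurable R setT) mh).
    by move=> z Oz; rewrite normr_ge0 hg.
  rewrite /Rintegral; move: H; case: (\int[lebesgue]_(z in Omega) _)%E => [r| |] //=.
by apply: le_trans (ler_cn_ReIm _) _; rewrite mulrDl mul1r; apply: lerD;
   apply: B => // z Oz; [exact: le_trans (ler_Re_cn _) (fg _ Oz)|
     exact: le_trans (ler_Im_cn _) (fg _ Oz)].
Qed.

(** True for every h, integrable or not: positive and negative parts are exchanged, and [fine] sends
    infinite values to 0. *)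
Lemma RintegralN (h : Cn -> R) :
  \int[lebesgue]_(z in Omega) (- h z) = - \int[lebesgue]_(z in (Omega : set (CnL R n))) h z.
Proof.
rewrite /Rintegral integralE [in RHS]integralE.
have -> : ((fun x : CnL R n => (- h x)%:E)^\+ = (fun x : CnL R n => (h x)%:E)^\-)%E.
  by apply/funext => z; rewrite funeposE funenegE.
have -> : ((fun x : CnL R n => (- h x)%:E)^\- = (fun x : CnL R n => (h x)%:E)^\+)%E.
  by apply/funext => z; rewrite funeposE funenegE /= opprK.
have p : (0 <= \int[lebesgue]_(x in (Omega : set (CnL R n))) ((fun x : CnL R n => (h x)%:E)^\+ x))%E.
  by apply: integral_ge0 => z _.
have m : (0 <= \int[lebesgue]_(x in (Omega : set (CnL R n))) ((fun x : CnL R n => (h x)%:E)^\- x))%E.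
  by apply: integral_ge0 => z _.
move: p m; case: (integral _ _ _) => [a| |] //; case: (integral _ _ _) => [b| |] //= _ _; rewrite ?oppr0//.
by rewrite opprB.
Qed.

Lemma cintegral_conj (f : Cn -> C) :
  cintegral Omega (fun z => conjc (f z)) = conjc (cintegral Omega f).
Proof.
apply: complex_ext => /=.
  by congr fine; apply: eq_integral => z _; case: (f z).
rewrite -RintegralN; congr fine; apply: eq_integral => z _; by case: (f z).
Qed.

Lemma eq_cintegral (f g : Cn -> C) : (forall z, Omega z -> f z = g z) ->
  cintegral Omega f = cintegral Omega g.
Proof.
by move=> E; apply: complex_ext; congr fine; apply: eq_integral => z; rewrite inE => Oz; rewrite E.
Qed.

End WeightedSpace.

(** * Reproducing kernels are locally bounded *)

Section Kernel.
Context {R : realType} {n : nat}.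
Local Notation C := R[i].
Local Notation Cn := 'rV[R[i]]_n.+1.

Lemma mul_conj_cn (x : C) : x * conjc x = (cn x ^+ 2)%:C.
Proof. by rewrite cn_sqr; case: x => a b; apply: complex_ext => /=; ring. Qed.

Context {Omega : set Cn} {mu : Cn -> R}.
Hypotheses (oO : open Omega) (wmu : weight Omega mu).
Local Notation sq := (sqnorm Omega mu).

(** Both sides are the integral of K1(z, w) conj(K2(x, w)) mu(w). With two kernels allowed, this
    yields Hermitian symmetry as well as uniqueness. *)
Lemma kernel_conj K1 K2 x z : reproducing_kernel Omega mu K1 ->
  reproducing_kernel Omega mu K2 -> Omega x -> Omega z -> conjc (K2 x z) = K1 z x.
Proof.
move=> h1 h2 Ox Oz; have [a1 r1] := h1 z Oz; have [a2 r2] := h2 x Ox.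
rewrite (r1 _ a2) -[RHS]conjcK (r2 _ a1) -cintegral_conj.
apply: eq_cintegral => w _.
by case: (K1 z w) => a b; case: (K2 x w) => c d; apply: complex_ext => /=; ring.
Qed.

Lemma kernel_unique K1 K2 x z : reproducing_kernel Omega mu K1 ->
  reproducing_kernel Omega mu K2 -> Omega x -> Omega z -> K1 z x = K2 z x.
Proof.
by move=> h1 h2 Ox Oz; rewrite -(kernel_conj h1 h2 Ox Oz) (kernel_conj h2 h2 Ox Oz).
Qed.

Context {K : Cn -> Cn -> C}.
Hypothesis hK : reproducing_kernel Omega mu K.

Lemma kernel_sq x : Omega x ->
  sq (fun w => conjc (K x w)) = (Re (K x x))%:E /\ 0 <= Re (K x x).
Proof.
move=> Ox; have [a r] := hK Ox.
have E : Re (K x x) = fine (sq (fun w => conjc (K x w))).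
  have -> : Re (K x x) = Re (conjc (K x x)) by case: (K x x).
  rewrite (r _ a) /cintegral /= /Rintegral; congr fine; apply: eq_integral => w _.
  by rewrite mul_conj_cn cn_conj /= mul0r subr0.
have s0 := sq_ge0 wmu (fun w => conjc (K x w)).
have [_ [_ _ sfin]] := a.
by rewrite E fine_ge0// fineK// ge0_fin_numE.
Qed.

(** Cauchy-Schwarz in the form a b <= tau / 2 a^2 + b^2 / (2 tau), with tau left free;
    [cintegral_bound] doubles the result. *)
Lemma kernel_point_bound u x (tau S : R) : A2 Omega mu u -> Omega x -> 0 < tau ->
  (sq u <= S%:E)%E -> cn (u x) <= tau * Re (K x x) + S / tau.
Proof.
move=> au Ox tau0 uS; have [ak r] := hK Ox; rewrite (r _ au).
have mu' := A2_measurable au; have mk' := A2_measurable ak.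
have t2 : 0 <= tau / 2 by rewrite divr_ge0 ?ltW.
have t2' : 0 <= (2 * tau)^-1 by rewrite invr_ge0 mulr_ge0 ?ltW.
pose g z := tau / 2 * (cn (conjc (K x z)) ^+ 2 * mu z) + (2 * tau)^-1 * (cn (u z) ^+ 2 * mu z).
have mk := measurable_sqf wmu mk'; have mu2 := measurable_sqf wmu mu'.
have mkt : lebesgue_measurable Omega (fun z => tau / 2 * (cn (conjc (K x z)) ^+ 2 * mu z)).
  by apply: measurable_funM mk; exact: measurable_cst.
have mut : lebesgue_measurable Omega (fun z => (2 * tau)^-1 * (cn (u z) ^+ 2 * mu z)).
  by apply: measurable_funM mu2; exact: measurable_cst.
have -> : tau * Re (K x x) + S / tau =
    2 * (tau / 2 * Re (K x x) + (2 * tau)^-1 * S).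
  by field; rewrite gt_eqF.
have mf := cmeasurableM (cmeasurableM (cmeasurable_conj mk') mu') (cmeasurable_real wmu.1).
apply: (cintegral_bound oO mf (g := g)).
- exact: measurable_funD mkt mut.
- move=> z Oz; have m0 := weight_ge0 wmu Oz.
  rewrite !Normc.normcM cn_real ger0_norm// /g cn_conj !mulrA -mulrDl.
  apply: ler_wpM2r => //; move: (cn (K x z)) (cn (u z)) => a b.
  rewrite -subr_ge0 (_ : _ - _ = (2 * tau)^-1 * (tau * a - b) ^+ 2).
    by rewrite mulr_ge0// sqr_ge0.
  by field; rewrite gt_eqF.
rewrite ge0_intD//.
- rewrite ge0_intZ//; last by exact: (sqf_ge0 wmu).
  rewrite ge0_intZ//; last by exact: (sqf_ge0 wmu).
  rewrite EFinD !EFinM; apply: leeD; apply: lee_wpmul2l; rewrite ?lee_fin//.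
  by have [<- _] := kernel_sq Ox.
- by move=> z Oz; apply: mulr_ge0 t2 (sqf_ge0 wmu (fun w => conjc (K x w)) Oz).
- by move=> z Oz; apply: mulr_ge0 t2' (sqf_ge0 wmu u Oz).
Qed.

(** * Series with geometrically decreasing terms *)

Local Notation q := (32 : R).

Lemma pow32S k : q ^- k.+1 = q ^- k / 32.
Proof. by rewrite exprS invfM mulrC. Qed.

(** Subtracting 2 D q^-k from s makes it nondecreasing and adding it makes it nonincreasing, so the
    limit and the rate of convergence come out together. *)
Lemma geometric_cvg (s : nat -> R) (D : R) : 0 <= D ->
  (forall k, `|s k.+1 - s k| <= D * q ^- k) ->
  exists2 l, s @ \oo --> l & forall m, `|l - s m| <= 2 * D * q ^- m.
Proof.
move=> D0 H.
have qk k : 0 <= q ^- k by rewrite invr_ge0 exprn_ge0.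
pose a k := s k - 2 * D * q ^- k; pose b k := s k + 2 * D * q ^- k.
have na : nondecreasing_seq a.
  apply/nondecreasing_seqP => k; rewrite /a pow32S.
  have := H k; rewrite ler_norml => /andP[h _].
  have := mulr_ge0 D0 (qk k); move: (q ^- k) h => x h; nra.
have nb : nonincreasing_seq b.
  apply/nonincreasing_seqP => k; rewrite /b pow32S.
  have := H k; rewrite ler_norml => /andP[_ h].
  have := mulr_ge0 D0 (qk k); move: (q ^- k) h => x h; nra.
have ab k : a k <= b k.
  rewrite /a /b; have := mulr_ge0 D0 (qk k); move: (q ^- k) => x; nra.
have ca : cvgn a.
  apply: nondecreasing_is_cvgn => //; exists (b 0) => _ [k _ <-].
  by apply: le_trans (ab k) (nb _ _ _).
have q0 : (fun k => 2 * D * q ^- k) @ \oo --> (0 : R).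
  have -> : (fun k => 2 * D * q ^- k) = geometric (2 * D) q^-1.
    by apply/funext => k; rewrite /= exprVn.
  by apply: cvg_geometric; rewrite ger0_norm ?invr_ge0// invf_lt1// ltr1n.
exists (limn a).
  have -> : s = (fun k => a k + 2 * D * q ^- k) by apply/funext => k; rewrite /a subrK.
  rewrite -[limn a]addr0; exact: cvgD.
move=> m; have h1 : a m <= limn a by exact: nondecreasing_cvgn_le.
have h2 : limn a <= b m.
  apply: limr_le => //; near=> k; apply: le_trans (ab k) (nb _ _ _).
  by near: k; exact: nbhs_infty_ge.
by rewrite ler_norml; rewrite /a /b in h1 h2 *; apply/andP; split; lra.
Unshelve. all: by end_near.
Qed.

Lemma geometric_small (B e : R) : 0 < e -> exists m, B * q ^- m < e.
Proof.
move=> e0; have [m Bm] : exists m : nat, B / e < m%:R.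
  by exists (trunc (B / e)).+1; exact: truncnS_gt.
exists m; rewrite ltr_pdivrMr ?exprn_gt0// mulrC -ltr_pdivrMr//.
apply: lt_le_trans Bm _; rewrite -natrX ler_nat ltnW// ltn_expl//.
Qed.

Lemma limn_einf_le (u : (\bar R)^nat) (M : \bar R) : (forall k, u k <= M)%E ->
  (limn_einf u <= M)%E.
Proof.
move=> uM; rewrite limn_einf_lim; apply: lime_le; first exact: is_cvg_einfs.
near=> k; apply: le_trans (uM k).
by apply: ereal_inf_lbound; exists k => //=.
Unshelve. all: by end_near.
Qed.

Lemma A2B u v : A2 Omega mu u -> A2 Omega mu v -> A2 Omega mu (fun z => u z - v z).
Proof.
move=> au av; have := A2D oO wmu au (A2Z oO wmu (-1) av).
by under eq_fun do rewrite mulN1r.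
Qed.

(** The induction peels off the first difference, so that the factor 2 of [sqD] falls on a tail
    already reduced by 32^2. *)
Lemma sq_telescope (S : nat -> Cn -> C) : (forall k, A2 Omega mu (S k)) ->
  (forall k, sq (fun z => S k.+1 z - S k z)%R <= ((q ^- k) ^+ 2)%:E)%E ->
  forall N m, (sq (fun z => S (N + m)%N z - S m z)%R <= (4 * (q ^- m) ^+ 2)%:E)%E.
Proof.
move=> aS HS; elim=> [|N IH] m.
  rewrite (eq_sq (v := fun=> 0)) => [|z _]; last by rewrite add0n subrr.
  rewrite /sqnorm (eq_integral (fun=> 0%:E)) ?integral0 ?lee_fin ?mulr_ge0 ?sqr_ge0//.
  by move=> z _; rewrite Normc.normc0 expr0n mul0r.
rewrite (eq_sq (v := fun z => (S (N + m.+1)%N z - S m.+1 z) + (S m.+1 z - S m z))) => [|z _]; last first.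
  by rewrite addrA subrK addnS.
have m1 := A2_measurable (A2B (aS (N + m.+1)%N) (aS m.+1)).
have m2 := A2_measurable (A2B (aS m.+1) (aS m)).
apply: le_trans (sqD oO wmu m1 m2) _.
apply: le_trans (leeD (lee_wpmul2l _ (IH m.+1)) (lee_wpmul2l _ (HS m))) _ => //.
rewrite -!EFinM -EFinD lee_fin pow32S.
move: (q ^- m) => y; have := sqr_ge0 y; nra.
Qed.

(** The limit u is taken pointwise, the values at x being controlled by K(x, x). Fatou's lemma
    bounds the norm of u - S m, and closedness provides a holomorphic v equal to u almost
    everywhere. The parameter t is kept free so that the rate can later be adapted to the point
    x. *)
Lemma riesz_fischer (S : nat -> Cn -> C) : A2_closed Omega mu ->
  (forall k, A2 Omega mu (S k)) ->
  (forall k, sq (fun z => S k.+1 z - S k z)%R <= ((q ^- k) ^+ 2)%:E)%E ->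
  exists2 v, A2 Omega mu v & forall x (t : R), Omega x -> 0 < t -> forall m,
    cn (v x - S m x) <= 4 * (t * Re (K x x) + t^-1) * q ^- m.
Proof.
move=> cl aS HS; have mO := open_measurable_CnL oO.
have qp k : 0 < q ^- k by rewrite invr_gt0 exprn_gt0.
pose D t x := t * Re (K x x) + t^-1.
have D0 t x : Omega x -> 0 < t -> 0 <= D t x.
  by move=> Ox t0; rewrite /D addr_ge0 ?invr_ge0 ?(ltW t0)// mulr_ge0 ?(ltW t0)// (kernel_sq Ox).2.
have step t x k : Omega x -> 0 < t -> cn (S k.+1 x - S k x) <= D t x * q ^- k.
  (* With tau = t q^-k both terms of the point bound become multiples of q^-k. *)
  move=> Ox t0; have tq : 0 < t * q ^- k by rewrite mulr_gt0.
  have := kernel_point_bound (A2B (aS k.+1) (aS k)) Ox tq (HS k).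
  move/le_trans; apply; apply: le_of_eq.
  move: (q ^- k) (qp k) => y y0; rewrite /D; field.
  by rewrite !gt_eqF.
have cR x t : Omega x -> 0 < t -> exists2 l, (fun k => Re (S k x)) @ \oo --> l &
    forall m, `|l - Re (S m x)| <= 2 * D t x * q ^- m.
  move=> Ox t0; apply: geometric_cvg; first exact: D0.
  by move=> k; rewrite -cReB; apply: le_trans (ler_Re_cn _) (step t x k Ox t0).
have cI x t : Omega x -> 0 < t -> exists2 l, (fun k => Im (S k x)) @ \oo --> l &
    forall m, `|l - Im (S m x)| <= 2 * D t x * q ^- m.
  move=> Ox t0; apply: geometric_cvg; first exact: D0.
  by move=> k; rewrite -cImB; apply: le_trans (ler_Im_cn _) (step t x k Ox t0).
pose u x : C := limn (fun k => Re (S k x)) +i* limn (fun k => Im (S k x)).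
have uRc x : Omega x -> (fun k => Re (S k x)) @ \oo --> Re (u x).
  by move=> Ox; have [l /cvgP] := cR x 1 Ox ltr01.
have uIc x : Omega x -> (fun k => Im (S k x)) @ \oo --> Im (u x).
  by move=> Ox; have [l /cvgP] := cI x 1 Ox ltr01.
have uS x t m : Omega x -> 0 < t -> cn (u x - S m x) <= 4 * D t x * q ^- m.
  move=> Ox t0; have [l lc lP] := cR x t Ox t0; have [l' lc' lP'] := cI x t Ox t0.
  have E1 : Re (u x) = l by apply: cvg_lim.
  have E2 : Im (u x) = l' by apply: cvg_lim.
  apply: le_trans (ler_cn_ReIm _) _; rewrite cReB cImB E1 E2.
  by apply: le_trans (lerD (lP m) (lP' m)) _; rewrite -mulrDl -mulrDl -natrD.
have mu' : cmeasurable Omega u.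
  split.
    apply: (measurable_fun_cvg (h := fun k (z : CnL R n) => Re (S k z))) => [k|x Ox].
      exact: (A2_measurable (aS k)).1.
    exact: uRc.
  apply: (measurable_fun_cvg (h := fun k (z : CnL R n) => Im (S k z))) => [k|x Ox].
    exact: (A2_measurable (aS k)).2.
  exact: uIc.
have mB k : cmeasurable Omega (fun z => u z + -1 * S k z).
  exact: cmeasurableD mu' (A2_measurable (A2Z oO wmu (-1) (aS k))).
have usq m : (sq (fun z => u z - S m z)%R <= (4 * (q ^- m) ^+ 2)%:E)%E.
  pose f k (z : CnL R n) := (cn (S (k + m)%N z - S m z) ^+ 2 * mu z)%:E.
  have mf k : measurable_fun (Omega : set (CnL R n)) (f k).
    have m1 := A2_measurable (A2B (aS (k + m)%N) (aS m)).
    exact: (iffRL (measurable_EFinP _ _) (measurable_sqf wmu m1)).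
  have f0 k (z : CnL R n) : Omega z -> (0 <= f k z)%E.
    by move=> Oz; rewrite lee_fin (sqf_ge0 wmu (fun z => S (k + m)%N z - S m z)).
  have sh (g : nat -> R) (l : R) : g @ \oo --> l -> (fun k => g (k + m)%N) @ \oo --> l.
    by rewrite cvg_shiftn.
  have := fatou lebesgue mO mf f0.
  have -> : (\int[lebesgue]_(x in Omega) limn_einf (f^~ x) = sq (fun z => u z - S m z)%R)%E.
    apply: eq_integral => x; rewrite inE => Ox.
    apply: (cvg_limn_einf_sup _).1; apply: cvg_EFin; first by near=> k.
    rewrite /f /comp /=.
    have -> : (fun k => cn (S (k + m)%N x - S m x) ^+ 2 * mu x) =
      (fun k => ((Re (S (k + m)%N x) - Re (S m x)) ^+ 2 +
        (Im (S (k + m)%N x) - Im (S m x)) ^+ 2) * mu x).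
      by apply/funext => k; rewrite cn_sqr cReB cImB.
    rewrite cn_sqr cReB cImB; apply: cvgMl; apply: cvgD; rewrite expr2.
      by apply: cvgM; apply: cvgB; try exact: cvg_cst; exact: (sh (fun k => Re (S k x))) (uRc _ Ox).
    by apply: cvgM; apply: cvgB; try exact: cvg_cst; exact: (sh (fun k => Im (S k x))) (uIc _ Ox).
  by move/le_trans; apply; apply: limn_einf_le => k; exact: sq_telescope.
have uL2 : L2 Omega mu u.
  split; [exact: mu'.1|exact: mu'.2|].
  rewrite (eq_sq (v := fun z => (u z + -1 * S 0%N z) + S 0%N z)) => [|z _]; last first.
    by rewrite mulN1r subrK.
  apply: le_lt_trans (sqD oO wmu (mB 0%N) (A2_measurable (aS 0%N))) _.
  rewrite lte_add_pinfty// lte_mul_pinfty//; last by have [_ []] := aS 0%N.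
  rewrite (eq_sq (v := fun z => u z - S 0%N z)) => [|z _]; last by rewrite mulN1r.
  by apply: le_lt_trans (usq 0%N) _; rewrite ltry.
have [v av uv] : exists2 v, A2 Omega mu v & {ae lebesgue, forall z, Omega z -> u z = v z}.
  apply: cl uL2 _ => e e0; have [m me] := geometric_small 2 e0.
  exists (S m) => //; apply: le_lt_trans me; rewrite /L2norm.
  have := usq m; have := sq_ge0 wmu (fun z => u z - S m z).
  rewrite -[X in sqnorm _ _ X]/(u - S m)%R.
  case: (sqnorm _ _ _) => [r| |]//=; rewrite !lee_fin => r0 rm.
  rewrite -[leRHS]ger0_norm ?mulr_ge0 ?(ltW (qp m))// -sqrtr_sqr ler_wsqrtr//.
  by move: (q ^- m) rm => y; nra.
exists v => // x t Ox t0 m.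
(* From almost everywhere to every point: v - S k is small in norm, hence small at x by the point
   bound, while S k x tends to u x. *)
suff -> : v x = u x by exact: uS.
have vsq k : (sq (fun z => v z - S k z)%R <= (4 * (q ^- k) ^+ 2)%:E)%E.
  apply: le_trans (usq k); apply: le_of_eq.
  have m1 := A2_measurable (A2B av (aS k)).
  have m5 : lebesgue_measurable Omega (fun z => cn (u z - S k z) ^+ 2 * mu z).
    apply: eq_measurable_fun (measurable_sqf wmu (mB k)) => z _.
    by rewrite mulN1r.
  have f0 w (z : CnL R n) : Omega z -> (0 <= (cn (w z) ^+ 2 * mu z)%:E)%E.
    by move=> Oz; rewrite lee_fin (sqf_ge0 wmu w).
  apply: (ge0_ae_eq_integral mO (iffRL (measurable_EFinP _ _) (measurable_sqf wmu m1))
    (iffRL (measurable_EFinP _ _) m5) (f0 (fun z => v z - S k z)) (f0 (fun z => u z - S k z))).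
  apply: (negligibleS _ uv) => w /= H1 H2; apply: H1 => Ow.
  by rewrite H2.
apply/eqP; rewrite -subr_eq0 -cn_eq0 eq_le cn_ge0 andbT.
apply/ler_addgt0Pr => e e0; rewrite add0r.
have [k ke] := geometric_small (Re (K x x) + 4 + 4 * D 1 x) e0.
apply: le_trans (ltW ke).
have := kernel_point_bound (A2B av (aS k)) Ox (qp k) (vsq k).
have := uS x 1 k Ox ltr01.
have := ler_cnB (v x - S k x) (u x - S k x); rewrite opprB addrA subrK.
have -> : 4 * q ^- k ^+ 2 / q ^- k = 4 * q ^- k.
  by rewrite expr2 mulrA mulfK// gt_eqF.
move: (q ^- k) (cn _) (cn _) (cn _) => y a b c; nra.
Unshelve. all: by end_near.
Qed.

(** Otherwise K(X k, X k) grows as fast as desired along points X k tending to p, and a signed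
    series of normalised kernel sections at these points sums to some v in A^2 with |v(X k)| >= k +
    1, against continuity of v at p. *)
Lemma kernel_locally_bounded p : A2_closed Omega mu -> Omega p ->
  exists rho M : R, 0 < rho /\
    forall x, nrm (x - p) < rho -> Omega x /\ Re (K x x) <= M.
Proof.
move=> cl Op; have [d0 d00 dP] := open_nrmP oO Op.
apply: contrapT => H.
(* Chosen so that the k-th hump, of height r k q^-k at X k with r k > B k, exceeds 2 (k + 1). *)
pose B k := 2 * k.+1%:R * q ^+ k.
have B0 k : 0 < B k by rewrite mulr_gt0 ?exprn_gt0// mulr_gt0.
have [X XP] : {X : nat -> Cn & forall k, nrm (X k - p) < d0 / k.+1%:R /\
    (B k) ^+ 2 < Re (K (X k) (X k))}.
  apply: (@choice _ _ (fun k x => nrm (x - p) < d0 / k.+1%:R /\ (B k) ^+ 2 < Re (K x x))) => k.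
  apply: contrapT => nx; apply: H; exists (d0 / k.+1%:R), ((B k) ^+ 2); split.
    by rewrite divr_gt0.
  move=> x xk; split.
    apply: dP; apply: lt_le_trans xk _; rewrite ler_pdivrMr// ler_peMr ?(ltW d00)//.
    by rewrite ler1n.
  by rewrite leNgt; apply/negP => lt; apply: nx; exists x.
have OX k : Omega (X k).
  apply: dP; apply: lt_le_trans (XP k).1 _; rewrite ler_pdivrMr// ler_peMr ?(ltW d00)//.
  by rewrite ler1n.
pose r k := Num.sqrt (Re (K (X k) (X k))).
have rB k : B k < r k.
  have p0 : 0 < Re (K (X k) (X k)) by apply: lt_trans (XP k).2; rewrite exprn_gt0.
  by rewrite -[B k]gtr0_norm// -sqrtr_sqr ltr_sqrt//; exact: (XP k).2.
have r0 k : 0 < r k by apply: lt_trans (rB k).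
have r2 k : r k ^+ 2 = Re (K (X k) (X k)) by rewrite sqr_sqrtr// (kernel_sq (OX k)).2.
have qp k : 0 < q ^- k by rewrite invr_gt0 exprn_gt0.
(* The kernel section at X k, normalised to norm 1; its value at X k is r k. *)
pose f k (w : Cn) := (r k)^-1%:C * conjc (K (X k) w).
have fX k : cn (f k (X k)) = r k.
  rewrite Normc.normcM cn_conj cn_real gtr0_norm ?invr_gt0//.
  have -> : K (X k) (X k) = (r k ^+ 2)%:C.
    have := kernel_conj hK hK (OX k) (OX k); rewrite r2.
    case: (K (X k) (X k)) => a b /= [] E; apply: complex_ext => //=; lra.
  by rewrite cn_real ger0_norm ?sqr_ge0// expr2 mulKf// gt_eqF.
have af k : A2 Omega mu (f k) := A2Z oO wmu _ (hK (OX k)).1.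
(* With this sign the k-th summand of the series is not cancelled at X k by the previous
   ones, and the later ones are too small to compensate it. *)
pose sg (S : Cn -> C) k : R :=
  if r k * q ^- k <= cn (S (X k) + (q ^- k)%:C * f k (X k)) then 1 else -1.
pose S := fix S k : Cn -> C := if k is j.+1 then
  (fun z => S j z + (sg (S j) j * q ^- j)%:C * f j z) else (fun=> 0).
have aS k : A2 Omega mu (S k).
  elim: k => [|k IH]; first exact: A20.
  exact: (A2D oO wmu (v := fun z => (sg (S k) k * q ^- k)%:C * f k z) IH (A2Z oO wmu _ (af k))).
have sgn k : `|sg (S k) k| = 1.
  by rewrite /sg; case: ifP => _; rewrite ?normrN normr1.
have HS k : (sq (fun z => S k.+1 z - S k z)%R <= ((q ^- k) ^+ 2)%:E)%E.
  have m1 := A2_measurable (hK (OX k)).1.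
  rewrite (eq_sq (v := fun z => ((sg (S k) k * q ^- k)%:C * (r k)^-1%:C) * conjc (K (X k) z))) => [|z _]; last first.
    by rewrite /= addrC addKr mulrA.
  rewrite (sqZ oO wmu _ m1) (kernel_sq (OX k)).1 -EFinM lee_fin -r2.
  rewrite Normc.normcM !cn_real normrM sgn mul1r !gtr0_norm ?invr_gt0//.
  by rewrite -exprMn mulfVK// gt_eqF.
have [v av vS] := riesz_fischer cl aS HS.
have SX k : r k * q ^- k <= cn (S k.+1 (X k)).
  rewrite /= /sg; case: ifPn => [|/negbTE]; first by rewrite mul1r.
  set b := (q ^- k)%:C * _ => /negbT; rewrite -ltNge => lt.
  have -> : (-1 * q ^- k)%:C * f k (X k) = - b.
    by rewrite /b mulN1r rmorphN mulNr.
  have bE : cn b = r k * q ^- k by rewrite Normc.normcM fX cn_real gtr0_norm// mulrC.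
  (* The two candidates differ by 2 b, so if the first has modulus below |b|, the second has modulus
     above |b|. *)
  have := ler_cnB (S k (X k) + b) (S k (X k) - b).
  have -> : S k (X k) + b - (S k (X k) - b) = 2%:C * b.
    by rewrite rmorph_nat; ring.
  rewrite Normc.normcM cn_real gtr0_norm// bE; lra.
have vX k : k.+1%:R <= cn (v (X k)).
  have ri : 0 < (r k)^-1 by rewrite invr_gt0.
  have := vS (X k) _ (OX k) ri k.+1; rewrite -r2 invrK.
  (* The choice t = 1 / r k gives t K + 1 / t = 2 r k, and the ratio 32 makes the tail after step k
     at most a quarter of the k-th hump. Hence |v(X k)| is at least 3/4 of the hump. *)
  have -> : 4 * ((r k)^-1 * r k ^+ 2 + r k) * q ^- k.+1 = r k * q ^- k / 4.
    rewrite pow32S; move: (q ^- k) => y; field.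
    by rewrite gt_eqF.
  have h1 := SX k; have := ler_cnD (S k.+1 (X k) - v (X k)) (v (X k)); rewrite subrK cn_distC.
  have : 2 * k.+1%:R <= r k * q ^- k.
    by rewrite ler_pdivlMr ?exprn_gt0// ltW// rB.
  have : 0 <= k.+1%:R :> R by [].
  move: h1; move: (cn _) (cn _) (cn _) (r k * _) (k.+1%:R) => a b c d e; lra.
have [d d'0 vd] := hasD_continuous (diff_hasD (av.1 p Op)) ltr01.
pose m := trunc (d0 / d + cn (v p) + 1).
have mP : d0 / d + cn (v p) + 1 < m.+1%:R by exact: truncnS_gt.
have d0d : 0 <= d0 / d by rewrite divr_ge0 ?ltW.
have vp := cn_ge0 (v p).
have Xd : nrm (X m - p) < d.
  apply: lt_trans (XP m).1 _; rewrite ltr_pdivrMr// mulrC -ltr_pdivrMr//.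
  by apply: le_lt_trans mP; lra.
have := vd _ Xd; rewrite nrmc => h; have := vX m; have := ler_cnD (v (X m) - v p) (v p).
by rewrite subrK; lra.
Qed.

End Kernel.

(** * Transformation of the kernel *)

Section KernelTransformation.
Context {R : realType} {n : nat}.
Local Notation C := R[i].
Local Notation Cn := 'rV[R[i]]_n.+1.

(** The bound on the diagonal extends to K(x, y) by the point bound with tau = 1 for the section at
    y, whose squared norm is K(y, y). *)
Lemma kernel_sesq Omega (mu : Cn -> R) K p : open Omega -> weight Omega mu ->
  A2_closed Omega mu -> reproducing_kernel Omega mu K -> Omega p ->
  exists rho M : R, [/\ 0 < rho, sesq_bounded K p rho M &
    forall x, nrm (x - p) < rho -> Omega x].
Proof.
move=> oO wmu cl hK Op.
have [rho [M [rho0 H]]] := kernel_locally_bounded oO wmu hK cl Op.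
exists rho, (M + M); split => //; last by move=> x /H[].
move=> x y xp yp; have [Ox xM] := H x xp; have [Oy yM] := H y yp; split.
- have [d d0 dP] := open_nrmP oO Ox.
  apply/differentiable_hasD; eexists.
  apply: hasD_near d0 _ (diff_hasD ((hK y Oy).1.1 x Ox)) => x' /dP Ox'.
  exact: (kernel_conj hK hK Oy Ox').
- exact: (hK x Ox).1.1.
- have ay := (hK y Oy).1.
  have [Sy _] := kernel_sq wmu hK Oy.
  have := kernel_point_bound oO wmu hK ay Ox ltr01 (eq_ind_r (fun s => (s <= _)%E) (lexx _) Sy).
  rewrite (kernel_conj hK hK Oy Ox) mul1r divr1 => /le_trans; apply.
  exact: lerD.
Qed.

(** Existence of a kernel is read off from positivity: without one, the default value 0 would
    contradict K(z, z) > 0. *)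
Lemma bergman_kernelP Omega (mu : Cn -> R) z : Omega z -> metric_posdef Omega mu ->
  reproducing_kernel Omega mu (bergman_kernel Omega mu).
Proof.
move=> Oz pd; have [ex|nex] := pselect (exists K, reproducing_kernel Omega mu K).
  by apply: xgetPex.
have [+ _] := pd z Oz; rewrite /bergman_kernel xgetPN ?ltxx// => K hK.
by apply: nex; exists K.
Qed.

Lemma conjM (x y : C) : conjc (x * y) = conjc x * conjc y.
Proof. by case: x => a b; case: y => c d; apply: complex_ext => /=; ring. Qed.

Lemma cintegral_change Omega Omega' F G (f : Cn -> C) :
  biholo_pair Omega Omega' F G ->
  cmeasurable Omega' f -> cmeasurable Omega (fun z => f (F z)) ->
  cintegral Omega' f = cintegral Omega (fun z => f (F z) * (cn (jacdet F z) ^+ 2)%:C).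
Proof.
move=> FG [m1 m2] [m3 m4]; apply: complex_ext; congr fine.
  rewrite (change_of_variables FG m1 m3); apply: eq_integral => z _.
  by rewrite cReM mulr0 subr0.
rewrite (change_of_variables FG m2 m4); apply: eq_integral => z _.
by rewrite cImM mulr0 add0r.
Qed.

Lemma holo_comp Omega (Omega' : set Cn) (F : Cn -> Cn) (u : Cn -> C) :
  holomorphic Omega F -> holomorphic Omega' u -> (forall z, Omega z -> Omega' (F z)) ->
  holomorphic Omega (fun z => u (F z)).
Proof.
move=> hF hu H z Oz; apply/differentiable_hasD; eexists.
exact: hasD_comp (diff_hasD (hF _ Oz)) (diff_hasD (hu _ (H _ Oz))).
Qed.

Lemma holo_mul Omega (u v : Cn -> C) : holomorphic Omega u -> holomorphic Omega v ->
  holomorphic Omega (fun z => u z * v z).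
Proof.
move=> hu hv z Oz; apply/differentiable_hasD; eexists.
exact: hasD_mul (diff_hasD (hu _ Oz)) (diff_hasD (hv _ Oz)).
Qed.

Definition weight_pair Omega Omega' F G (mu mu' : Cn -> R) (h : Cn -> C) :=
  [/\ biholo_pair Omega Omega' F G, weight Omega mu, weight Omega' mu',
      holomorphic Omega h /\ (forall z, Omega z -> h z != 0) &
      forall z, Omega z -> mu' (F z) = cn (h z) ^+ 2 * mu z].

Lemma weight_pairC Omega Omega' F G mu mu' h :
  weight_pair Omega Omega' F G mu mu' h ->
  weight_pair Omega' Omega G F mu' mu (fun w => (h (G w))^-1).
Proof.
move=> [FG wm wm' [hh h0] E]; have [oO oO' hF hG [H1 H2]] := FG.
have Oh w : Omega' w -> h (G w) != 0 by move=> /H2[OG _]; exact: h0.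
split; [exact: biholo_pairC|exact: wm'|exact: wm| |].
  split; last by move=> w Ow; rewrite invr_neq0// Oh.
  move=> w Ow; apply/differentiable_hasD; eexists; apply: hasD_inv; first exact: Oh.
  exact: hasD_comp (diff_hasD (hG _ Ow)) (diff_hasD (hh _ (H2 _ Ow).1)).
move=> w Ow; have [OG FGw] := H2 _ Ow.
have := E _ OG; rewrite FGw => ->; rewrite Normc.normcV exprVn mulKf//.
by rewrite expf_neq0// cn_eq0 Oh.
Qed.

Lemma A2_pull Omega Omega' F G mu mu' h u : weight_pair Omega Omega' F G mu mu' h ->
  A2 Omega' mu' u -> A2 Omega mu (fun z => jacdet F z * h z * u (F z)).
Proof.
move=> [FG wm wm' [hh h0] E] au; have [hu [_ _ su]] := au.
have [oO oO' hF hG [H1 H2]] := FG.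
have huF : holomorphic Omega (fun z => u (F z)).
  by apply: (holo_comp hF hu) => z /H1[].
have hJ := jacdet_differentiable oO hF.
have ha := holo_mul (holo_mul hJ hh) huF.
apply: (A2_intro oO ha).
have mu2 := measurable_sqf wm' (A2_measurable au).
have mu2F : lebesgue_measurable Omega (fun z => cn (u (F z)) ^+ 2 * mu' (F z)).
  have m5 := cmeasurable_cn2 (holo_cmeasurable oO (holo_mul hh huF)).
  apply: (@eq_measurable_fun _ _ _ _ (Omega : set (CnL R n))
    (fun z : CnL R n => cn (h z * u (F z)) ^+ 2 * mu z)); last exact: measurable_funM m5 wm.1.
  by move=> z; rewrite inE => Oz; rewrite E// Normc.normcM; ring.
have f0 w : Omega' w -> 0 <= cn (u w) ^+ 2 * mu' w by exact: (sqf_ge0 wm').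
have CV := change_of_variables_ge0 FG mu2 mu2F f0.
rewrite (_ : sqnorm _ _ _ = sqnorm Omega' mu' u)// /sqnorm CV.
apply: eq_integral => z; rewrite inE => Oz; rewrite E// !Normc.normcM.
by congr EFin; ring.
Qed.

(** The algebra of [kernel_pull] over an abstract field: j and h are the Jacobian and the factor h
    at z and w, jb and hb their conjugates at w, and m is the weight. The Jacobian and h at w
    cancel, leaving their conjugates. *)
Lemma transform_identity (E : fieldType) (jz hz jw hw k u m jb hb : E) :
  jw != 0 -> hw != 0 ->
  k * (jz * hz * (jw^-1 / hw * u)) * (hw * hb * m) * (jw * jb) =
  jz * hz * k * (jb * hb) * u * m.
Proof. by move=> j0 h0; field; rewrite j0 h0. Qed.

(** A function u on Omega is transported to Omega' by the inverse pair and scaled by a constant to a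
    function U with U(F z) = u(z). The reproducing property of K' for U at F z then becomes the
    claim after a change of variables. *)
Lemma kernel_pull Omega Omega' F G mu mu' h K' : weight_pair Omega Omega' F G mu mu' h ->
  reproducing_kernel Omega' mu' K' ->
  reproducing_kernel Omega mu (fun x y =>
    jacdet F x * h x * K' (F x) (F y) * conjc (jacdet F y * h y)).
Proof.
move=> W hK'; have [FG wm wm' [hh h0] E] := W.
have [oO oO' hF hG [H1 H2]] := FG.
move=> z Oz; have [OF GF] := H1 _ Oz.
have [ak rk] := hK' (F z) OF; split.
  have := A2Z oO wm (conjc (jacdet F z * h z)) (A2_pull W ak).
  congr (A2 _ _ _); apply/funext => w; rewrite !conjM !conjcK.
  move: (jacdet F z) (h z) (jacdet F w) (h w) => a b c d. ring.
move=> u au.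
have J0 w : Omega w -> jacdet G (F w) = (jacdet F w)^-1 /\ jacdet F w != 0.
  move=> Ow; have [Ju JJ] := biholo_jac FG Ow.
  have Jn : jacdet F w != 0 by rewrite -unitfE -unitmxE.
  by split => //; rewrite -[LHS](mulKf Jn) JJ mulr1.
pose U w := jacdet F z * h z * (jacdet G w * (h (G w))^-1 * u (G w)).
have aU : A2 Omega' mu' U := A2Z oO' wm' _ (A2_pull (weight_pairC W) au).
have UF w : Omega w -> U (F w) =
    jacdet F z * h z * ((jacdet F w)^-1 * (h w)^-1 * u w).
  by move=> Ow; rewrite /U (J0 _ Ow).1 (H1 _ Ow).2.
have -> : u z = U (F z).
  rewrite UF//; move: (h0 _ Oz) (J0 _ Oz).2 => h1 h2; field.
  by rewrite h1.
have mO (O : set Cn) (nu : Cn -> R) (k v : Cn -> C) : open O ->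
    lebesgue_measurable O nu -> holomorphic O (fun w => conjc (k w)) -> holomorphic O v ->
    cmeasurable O (fun w => k w * v w * (nu w)%:C).
  move=> oO0 mnu hk hv; apply: cmeasurableM (cmeasurable_real mnu).
  exact: cmeasurableM (cmeasurable_conj (holo_cmeasurable oO0 hk)) (holo_cmeasurable oO0 hv).
have FO w : Omega w -> Omega' (F w) by move=> /H1[].
have mF := mO Omega (fun w => cn (h w) ^+ 2 * mu w) (fun w => K' (F z) (F w)) (fun w => U (F w)) oO
  _ (holo_comp hF ak.1 FO) (holo_comp hF aU.1 FO).
have mh : lebesgue_measurable Omega (fun w => cn (h w) ^+ 2 * mu w).
  exact: measurable_funM (cmeasurable_cn2 (holo_cmeasurable oO hh)) wm.1.
rewrite (rk _ aU) (cintegral_change FG).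
- apply: eq_cintegral => w Ow.
  rewrite UF// E// (rmorphM (real_complex R)) /= -!mul_conj_cn conjM.
  exact: transform_identity (J0 _ Ow).2 (h0 _ Ow).
- exact: (mO Omega' mu' _ _ oO' wm'.1 ak.1 aU.1).
- split; [have := (mF mh).1|have := (mF mh).2]; apply: eq_measurable_fun => w;
    by rewrite inE => Ow; rewrite E.
Qed.

End KernelTransformation.

(** * Transformation of the metric *)

Section Metric.
Context {R : realType} {n : nat}.
Local Notation C := R[i].
Local Notation Cn := 'rV[R[i]]_n.+1.

(** The two Wirtinger operators separate the complex linear part A of the real differential from its
    antilinear part. *)
Lemma wirtinger (f : Cn -> C) z (A B : Cn -> C) :
  (forall v, real_derive v f z = A v + conjc (B v)) ->
  (forall c v, A (c *: v) = c * A v) -> (forall c v, B (c *: v) = c * B v) ->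
  forall j, dz j f z = A (std_basis R j) /\ dzbar j f z = conjc (B (std_basis R j)).
Proof.
move=> H HA HB j; rewrite /dz /dzbar !H HA HB conjM.
have ii : 'i%C * 'i%C = -1 :> C by apply: complex_ext => /=; ring.
have -> : conjc 'i%C = - 'i%C :> C by apply: complex_ext => /=; ring.
move: (A _) (conjc _) ('i%C) ii => a b i ii.
have n2 : 2 != 0 :> C by rewrite pnatr_eq0.
split; apply: (mulIf n2); rewrite mulfVK//.
  have -> : a + b - i * (i * a + - i * b) = a + b - i * i * (a - b) by ring.
  by rewrite ii; ring.
have -> : a + b + i * (i * a + - i * b) = a + b + i * i * (a - b) by ring.
by rewrite ii; ring.
Qed.

Lemma real_derive_ln (f : Cn -> C) z v c : 0 < Re (f z) ->
  (forall e : R, 0 < e -> exists2 d : R, 0 < d & forall t : R, `|t| < d ->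
    cn (f (z + t%:C *: v) - f z - t%:C * c) <= e * `|t|) ->
  real_derive v (fun x => (ln (Re (f x)))%:C) z =
  (Re c / Re (f z))%:C.
Proof.
move=> f0 H; have [dR _ _] := real_derive_eps H.
have f00 : 0 < Re (f (z + 0%:C *: v)) by rewrite scale0r addr0.
have dl := is_derive1_comp (is_derive1_ln f00) dR.
rewrite /real_derive; apply: complex_ext => /=.
  by rewrite derive1E; case: dl => _ ->; rewrite scale0r addr0 mulrC.
exact: derive1_cst.
Qed.

Definition herm_kernel Omega (K : Cn -> Cn -> C) :=
  [/\ open Omega,
      forall p, Omega p -> exists rho M : R, [/\ 0 < rho, sesq_bounded K p rho M &
        forall x, nrm (x - p) < rho -> Omega x],
      forall x z, Omega x -> Omega z -> conjc (K x z) = K z x &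
      forall z, Omega z -> 0 < K z z].

(* The derivative of log K along w in the antiholomorphic variable y. *)
Definition kernel_ratio (K : Cn -> Cn -> C) w x y : C :=
  conjc ('d (fun y' => conjc (K x y')) y w) / K x y.

Lemma kernel_ratioE K w x y D : hasD (fun y' => conjc (K x y')) y D ->
  kernel_ratio K w x y = conjc (D w) / K x y.
Proof. by move=> /hasD_diff[_ E]; rewrite /kernel_ratio E. Qed.

Lemma sesq_sub (P : Cn -> Cn -> C) z (rho M rho' M' : R) : sesq_bounded P z rho M -> rho' <= rho -> M <= M' ->
  sesq_bounded P z rho' M'.
Proof.
move=> H rr MM x y xz yz; have [h1 h2 h3] := H x y (lt_le_trans xz rr) (lt_le_trans yz rr).
by split => //; apply: le_trans h3 MM.
Qed.

Lemma conjV (x : C) : conjc x^-1 = (conjc x)^-1.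
Proof. exact: (fmorphV (@conjc R)). Qed.

Lemma sesq_div (P N : Cn -> Cn -> C) z (rho M M' c : R) : 0 < c -> sesq_bounded P z rho M ->
  sesq_bounded N z rho M' ->
  (forall x y, nrm (x - z) < rho -> nrm (y - z) < rho -> c <= cn (P x y)) ->
  sesq_bounded (fun x y => N x y / P x y) z rho (M' / c).
Proof.
move=> c0 HP HN Pc x y xz yz.
have [p1 p2 _] := HP x y xz yz; have [n1 n2 nM] := HN x y xz yz.
have cP := Pc x y xz yz.
have P0 : P x y != 0 by rewrite -cn_gt0 (lt_le_trans c0).
split.
- apply/differentiable_hasD; eexists.
  exact: hasD_mul (diff_hasD n1) (hasD_inv P0 (diff_hasD p1)).
- have -> : (fun y' => conjc (N x y' / P x y')) = (fun y' => conjc (N x y') * (conjc (P x y'))^-1).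
    by apply/funext => y'; rewrite conjM conjV.
  have P0' : conjc (P x y) != 0 by rewrite -cn_eq0 cn_conj cn_eq0.
  apply/differentiable_hasD; eexists.
  exact: (hasD_mul (diff_hasD n2) (hasD_inv (f := fun y' => conjc (P x y')) P0' (diff_hasD p2))).
- rewrite Normc.normcM Normc.normcV; apply: ler_pM => //; rewrite ?invr_ge0 ?cn_ge0//.
  by rewrite lef_pV2 ?posrE// (lt_le_trans c0).
Qed.

Lemma cn_pos (x : C) : 0 < x -> cn x = Re x /\ 0 < Re x.
Proof.
by move=> /gtc0_real[x0 E]; rewrite {1}E cn_real gtr0_norm.
Qed.

(** Moving x and y from p one after the other changes K by at most K(p, p) / 4 each time, by
    [lipschitz_ball]; this fixes the radius and leaves half of K(p, p). *)
Lemma kernel_nonvanishing (K : Cn -> Cn -> C) p (rho M : R) : 0 < rho -> sesq_bounded K p rho M -> 0 < K p p ->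
  exists c rho' : R, [/\ 0 < c, 0 < rho' <= rho / 2 &
    forall x y, nrm (x - p) < rho' -> nrm (y - p) < rho' -> c <= cn (K x y)].
Proof.
move=> rho0 H /cn_pos[cE c0].
set c := Re (K p p) in cE c0.
have pp : nrm (p - p) < rho / 2 by rewrite subrr nrm0 divr_gt0.
have pp' : nrm (p - p) < rho by rewrite subrr nrm0.
have M0 := holo_bounded_ge0 rho0 (sesq_fst H pp').
have M1 : 0 < 64 * (M + 1) by rewrite mulr_gt0// ltr_wpDl.
exists (c / 2), (minr (rho / 2) (c * rho / (64 * (M + 1)))); split.
- by rewrite divr_gt0.
- by rewrite lt_min ge_min lexx !divr_gt0 ?mulr_gt0 ?ltr_wpDl.
move=> x y; rewrite !lt_min => /andP[x1 x2] /andP[y1 y2].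
have y1' : nrm (y - p) < rho by lra.
have h1 := lipschitz_ball rho0 (sesq_fst H y1') x1 pp.
have h2 := lipschitz_ball rho0 (sesq_snd H pp') y1 pp.
rewrite -(rmorphB (@conjc R)) cn_conj in h2.
have bnd (s : R) : 0 <= s -> s < c * rho / (64 * (M + 1)) -> 16 * M / rho * s <= c / 4.
  move=> s0; rewrite ltr_pdivlMr// => hs.
  by rewrite mulrAC ler_pdivrMr//; nra.
have := bnd _ (nrm_ge0 _) x2; have := bnd _ (nrm_ge0 _) y2.
have := ler_cnB (K x y - K p y + (K p y - K p p)) (K x y).
have := ler_cnD (K x y - K p y) (K p y - K p p).
rewrite addrA subrK addrAC subrr sub0r cnN cE.
move: (cn (K x y - K p y)) (cn (K p y - K p p)) (cn (K x y - K p p)) (cn (K x y)) h1 h2.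
move=> a b d e h1 h2; move: h1 h2.
move: (16 * M / rho * _) (16 * M / rho * _) => s t; lra.
Qed.

Lemma kernel_ratio_sesq Omega K w p : herm_kernel Omega K -> Omega p ->
  exists rho M : R, [/\ 0 < rho, sesq_bounded (kernel_ratio K w) p rho M &
    forall x, nrm (x - p) < rho -> Omega x].
Proof.
move=> [oO lb sym pos] Op; have [rho [M [rho0 H HO]]] := lb p Op.
have [c [rho' [c0 /andP[rho'0 rr] Hc]]] := kernel_nonvanishing rho0 H (pos p Op).
have HN := sesq_deriv w rho0 H.
have rr' : rho' <= rho by lra.
exists rho', (4 * M / (rho / 2) * nrm w / c); split => //; last first.
  by move=> x xp; apply: HO; apply: lt_le_trans xp rr'.
exact: sesq_div c0 (sesq_sub H rr' (lexx _)) (sesq_sub HN rr (lexx _)) Hc.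
Qed.

(** By Hermitian symmetry the derivative in x and that of the conjugate in y are the same A, so the
    real derivative of log K(x, x) is A / K plus its conjugate, and [dzbar] selects the
    conjugate. *)
Lemma dzbar_log_kernel Omega K z k : herm_kernel Omega K -> Omega z ->
  dzbar k (fun x => (ln (Re (K x x)))%:C) z = kernel_ratio K (std_basis R k) z z.
Proof.
move=> [oO lb sym pos] Oz; have [rho [M [rho0 H HO]]] := lb z Oz.
have zz : nrm (z - z) < rho by rewrite subrr nrm0.
have [_ d2 _] := H z z zz zz; have HB := diff_hasD d2.
rewrite /kernel_ratio; move: HB; set A : Cn -> C := 'd _ z => HB.
have HA : hasD (fun x => K x z) z A.
  by apply: hasD_near rho0 _ HB => y /HO Oy; exact: sym.
have [_ K0] := cn_pos (pos z Oz).
have [_ Kr] := gtc0_real (pos z Oz).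
have Ki : (K z z)^-1 = ((Re (K z z))^-1)%:C.
  by rewrite {1}Kr (fmorphV (real_complex R)).
have D v : real_derive v (fun x => (ln (Re (K x x)))%:C) z =
    (K z z)^-1 * A v + conjc ((K z z)^-1 * A v).
  rewrite (real_derive_ln K0 (sesq_diag v rho0 H HA HB)) Ki.
  by move: (A v) (_^-1) => [a b] r; apply: complex_ext => /=; ring.
have [] := wirtinger D _ _ k.
- by move=> c v; rewrite (hasDZc _ _ HA); ring.
- by move=> c v; rewrite (hasDZc _ _ HA); ring.
by move=> _ ->; rewrite conjM conjV sym// mulrC.
Qed.

(** The ratio is again holomorphic in x and antiholomorphic in y, so [sesq_diag] differentiates it
    along the diagonal and [dz] keeps the part coming from x. *)
Lemma dz_dzbar_log_kernel Omega K z j k A : herm_kernel Omega K -> Omega z ->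
  hasD (fun x => kernel_ratio K (std_basis R k) x z) z A ->
  dz j (dzbar k (fun x => (ln (Re (K x x)))%:C)) z = A (std_basis R j).
Proof.
move=> hK Oz HA; have [rho [M [rho0 H HO]]] := kernel_ratio_sesq (std_basis R k) hK Oz.
have zz : nrm (z - z) < rho by rewrite subrr nrm0.
have [_ d2 _] := H z z zz zz; have HB := diff_hasD d2.
move: HB; set B : Cn -> C := 'd _ z => HB.
have D v : real_derive v (dzbar k (fun x => (ln (Re (K x x)))%:C)) z =
    A v + conjc (B v).
  suff : forall e : R, 0 < e -> exists2 d : R, 0 < d & forall t : R, `|t| < d ->
      cn (dzbar k (fun x => (ln (Re (K x x)))%:C) (z + t%:C *: v) -
        dzbar k (fun x => (ln (Re (K x x)))%:C) z - t%:C * (A v + conjc (B v))) <= e * `|t|.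
    by move=> /real_derive_eps[_ _ ->].
  move=> e e0; have [d d0 dP] := sesq_diag v rho0 H HA HB e0.
  have nv := nrm_ge0 v.
  exists (minr d (rho / (nrm v + 1))); first by rewrite lt_min d0 divr_gt0// ltr_wpDl.
  move=> t; rewrite lt_min => /andP[/dP h1]; rewrite ltr_pdivlMr ?ltr_wpDl// => h2.
  have Ot : Omega (z + t%:C *: v).
    apply: HO; rewrite addrC addKr nrmZ cn_real; apply: le_lt_trans h2.
    by rewrite ler_wpM2l// lerDl.
  by rewrite !(dzbar_log_kernel k hK).
by have [] := wirtinger D (fun c v => hasDZc c v HA) (fun c v => hasDZc c v HB) j.
Qed.

(** A coordinate-free form of the metric: the differential of F does not respect the standard basis,
    so the transformation is carried out for arbitrary directions v and w. *)
Lemma bergman_metric_ratio Omega mu z v w : open Omega -> weight Omega mu ->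
  herm_kernel Omega (bergman_kernel Omega mu) -> Omega z ->
  exists2 A, hasD (fun x => kernel_ratio (bergman_kernel Omega mu) w x z) z A &
    bergman_metric Omega mu z v w = A v.
Proof.
move=> oO wmu; set K := bergman_kernel Omega mu => hK Oz.
have [_ lb sym _] := hK.
have hA k : exists A, hasD (fun x => kernel_ratio K (std_basis R k) x z) z A.
  have [rho [M [rho0 H HO]]] := kernel_ratio_sesq (std_basis R k) hK Oz.
  have zz : nrm (z - z) < rho by rewrite subrr nrm0.
  by have [d1 _ _] := H z z zz zz; eexists; exact: diff_hasD d1.
have [A HA] : {A : 'I_n.+1 -> Cn -> C &
    forall k, hasD (fun x => kernel_ratio K (std_basis R k) x z) z (A k)}.
  exact: (@choice _ _ (fun k A => hasD (fun x => kernel_ratio K (std_basis R k) x z) z A)).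
have [rho [M [rho0 H HO]]] := lb z Oz.
have zz : nrm (z - z) < rho by rewrite subrr nrm0.
have basis (L : Cn -> C) (x : Cn) : (forall a u v, L (a *: u + v) = a *: L u + L v) ->
    L x = \sum_k x 0 k * L (std_basis R k).
  move=> lL; have L0 : L 0 = 0.
    by have := lL (-1) 0 0; rewrite scaler0 addr0 scaleN1r addNr.
  rewrite {1}(row_sum_delta x).
  elim/big_rec2: _ => [//|k y1 y2 _ <-].
  by rewrite lL.
exists (fun v => \sum_k conjc (w 0 k) * A k v).
  have dsum (r : seq 'I_n.+1) : hasD
      (fun x => \sum_(k <- r) conjc (w 0 k) * kernel_ratio K (std_basis R k) x z) z
      (fun v => \sum_(k <- r) conjc (w 0 k) * A k v).
    elim: r => [|k r IH].
      have := hasD_cst (0 : C) z.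
      congr (hasD _ _ _); apply/funext => y; by rewrite big_nil.
    have := hasD_add (hasD_cmul (conjc (w 0 k)) (HA k)) IH.
    by congr (hasD _ _ _); apply/funext => y; rewrite big_cons.
  apply: hasD_near rho0 _ (dsum _) => x xz.
  have [_ d2 _] := H x z xz zz; have [lin _ _] := diff_hasD d2.
  rewrite /kernel_ratio [in RHS](basis _ w lin) (big_morph _ (rmorphD (@conjc R)) (rmorph0 (@conjc R))).
  rewrite mulr_suml; apply: eq_bigr => k _.
  by rewrite mulrA; congr (_ / _); exact: esym (conjM _ _).
rewrite /bergman_metric exchange_big; apply: eq_bigr => k _.
have [lin _ _] := HA k.
rewrite [in RHS](basis _ v lin) mulr_sumr; apply: eq_bigr => j _.
rewrite /log_kernel (dz_dzbar_log_kernel j hK Oz (HA k)); ring.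
Qed.

Lemma ratio_transform (Omega Omega' : set Cn) (F : Cn -> Cn) (K K' : Cn -> Cn -> C) (a : Cn -> C) z w B :
  herm_kernel Omega K -> herm_kernel Omega' K' ->
  holomorphic Omega F -> holomorphic Omega a -> (forall x, Omega x -> a x != 0) ->
  (forall x, Omega x -> Omega' (F x)) ->
  (forall x y, Omega x -> Omega y -> K x y = a x * K' (F x) (F y) * conjc (a y)) ->
  Omega z -> hasD (fun x => kernel_ratio K' ('d F z w) x (F z)) (F z) B ->
  hasD (fun x => kernel_ratio K w x z) z (fun v => B ('d F z v)).
Proof.
move=> [oO lb sym pos] [oO' lb' sym' pos'] hF ha a0 FO KK Oz HB.
have HF := diff_hasD (hF _ Oz); have Ha := diff_hasD (ha _ Oz).
have [rho' [M' [rho'0 H' HO']]] := lb' _ (FO _ Oz).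
have [c [r' [c0 /andP[r'0 rr'] Hc]]] := kernel_nonvanishing rho'0 H' (pos' _ (FO _ Oz)).
have [d d0 dP] := hasD_continuous HF r'0.
have [d1 d10 d1P] := open_nrmP oO Oz.
move: HF Ha HB; set T : Cn -> Cn := 'd F z; set A : Cn -> C := 'd a z => HF Ha HB.
(* The summand due to conj(a(y)): a logarithmic derivative at z, constant in x. *)
pose k := conjc (A w) / conjc (a z).
have := hasD_add (hasD_cst k z) (hasD_comp HF HB).
have -> : (fun v => 0 + B (T v)) = (fun v => B (T v)) by apply/funext => v; rewrite add0r.
have dm : 0 < minr d d1 by rewrite lt_min d0.
apply: hasD_near dm _ => x; rewrite lt_min => /andP[/dP xd /d1P Ox].
have FzFz : nrm (F z - F z) < r' by rewrite subrr nrm0.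
have K0 : K' (F x) (F z) != 0 by rewrite -cn_gt0 (lt_le_trans c0)// Hc.
have [_ d2 _] : [/\ differentiable (fun x' => K' x' (F z)) (F x),
        differentiable (fun y' => conjc (K' (F x) y')) (F z) & cn (K' (F x) (F z)) <= M'].
  by apply: H'; [lra|rewrite subrr nrm0].
have [D HD] := (differentiable_hasD _ _).1 d2.
have HK : hasD (fun y => conjc (K x y)) z
    (fun v => conjc (a x) * (conjc (K' (F x) (F z)) * A v + a z * D (T v))).
  apply: hasD_near d10 _ (hasD_cmul (conjc (a x)) (hasD_mul (hasD_comp HF HD) Ha)) => y /d1P Oy.
  by rewrite KK// !conjM conjcK; ring.
rewrite (kernel_ratioE _ HD) (kernel_ratioE _ HK).
rewrite KK// /k !conjM (rmorphD (@conjc R)) /= !conjM !conjcK.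
have := a0 _ Ox; have : conjc (a z) != 0 by rewrite -cn_eq0 cn_conj cn_eq0 a0.
move: (a x) (conjc (a z)) (K' _ _) K0 (conjc (A w)) (conjc (D _)) => a1 a2 k0 K0 e f a20 a10.
by field; rewrite a10 a20 K0.
Qed.

End Metric.

Lemma bergman_herm_kernel (R : realType) (n : nat) (Omega : set 'rV[R[i]]_n.+1) mu z :
  open Omega -> Omega z -> admissible Omega mu -> metric_posdef Omega mu ->
  reproducing_kernel Omega mu (bergman_kernel Omega mu) /\
  herm_kernel Omega (bergman_kernel Omega mu).
Proof.
move=> oO Oz [wmu cl _] pd; have hK := bergman_kernelP Oz pd; split => //; split => //.
- by move=> p Op; exact: (kernel_sesq oO wmu cl hK Op).
- by move=> x y Ox Oy; exact: (kernel_conj hK hK Ox Oy).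
- by move=> x /pd[].
Qed.

Theorem theorem1 (R : realType) (n : nat) (D : set (set 'rV[R[i]]_n.+1))
    (M : set 'rV[R[i]]_n.+1 -> 'rV[R[i]]_n.+1 -> R)
    (D_domain : forall Omega, D Omega -> domain Omega)
    (M_admissible : forall Omega, D Omega -> admissible Omega (M Omega))
    (g_posdef : forall Omega, D Omega -> metric_posdef Omega (M Omega))
    (M_invariant : invariant_assignment D M) :
  forall (Omega : set 'rV[R[i]]_n.+1) (F : 'rV[R[i]]_n.+1 -> 'rV[R[i]]_n.+1),
    D Omega -> biholomorphism Omega F -> D (F @` Omega) ->
    forall z, Omega z -> forall v w : 'rV[R[i]]_n.+1,
      bergman_metric Omega (M Omega) z v w =
      pullback F (bergman_metric (F @` Omega) (M (F @` Omega))) z v w.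
Proof.
move=> Omega F DO bF DF z Oz v w.
have [h [hh h0 hM]] := M_invariant _ _ DO bF DF.
have [oO _ _] := D_domain _ DO; have [oO' _ _] := D_domain _ DF.
have [hF [G [hG GF]]] := bF.
have FO x : Omega x -> (F @` Omega) (F x) by move=> Ox; exists x.
have [wm _ _] := M_admissible _ DO; have [wm' _ _] := M_admissible _ DF.
have FG : biholo_pair Omega (F @` Omega) F G.
  split => //; split => [x Ox|_ [x Ox <-]]; first by split; [exact: FO|exact: GF].
  by rewrite GF.
have W : weight_pair Omega (F @` Omega) F G (M Omega) (M (F @` Omega)) h by split.
have [rK hK] := bergman_herm_kernel oO Oz (M_admissible _ DO) (g_posdef _ DO).
have [rK' hK'] := bergman_herm_kernel oO' (FO _ Oz) (M_admissible _ DF) (g_posdef _ DF).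
have [A HA ->] := bergman_metric_ratio v w oO wm hK Oz.
rewrite /pullback.
have [B HB ->] := bergman_metric_ratio ('d F z v) ('d F z w) oO' wm' hK' (FO _ Oz).
have ha := holo_mul (jacdet_differentiable oO hF) hh.
have a0 x : Omega x -> jacdet F x * h x != 0.
  move=> Ox; have [Ju _] := biholo_jac FG Ox.
  by rewrite mulf_neq0 ?h0// -unitfE -unitmxE.
have KK x y : Omega x -> Omega y -> bergman_kernel Omega (M Omega) x y =
    jacdet F x * h x * bergman_kernel (F @` Omega) (M (F @` Omega)) (F x) (F y) *
    conjc (jacdet F y * h y).
  by move=> Ox Oy; exact: (kernel_unique rK (kernel_pull W rK') Oy Ox).
have H := ratio_transform hK hK' hF ha a0 FO KK Oz HB.
by rewrite (hasD_unique HA H).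
Qed.
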